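(* Let $\mathfrak g$ be a simple finite-dimensional Lie algebra over $\Bbbk$ of rank $n\ge 2$, with Coxeter number $h=h(\mathfrak g)$ and dual Coxeter number $h^*=h^*(\mathfrak g)$. Let $(\mathfrak{sl}_2)^{pr}$ and $(\mathfrak{sl}_2)^{sub}$ be a principal and a subregular $\mathfrak{sl}_2$-subalgebra of $\mathfrak g$, respectively, and let $a\le b$ be the integers attached to $\mathfrak g$ by the decomposition $$\mathfrak g|_{(\mathfrak{sl}_2)^{sub}}=\Bigl(\bigoplus_{i=1}^{n-1}\mathsf R_{2m_i}\Bigr)\oplus \mathsf R_{a-2}\oplus\mathsf R_{b-2}\oplus\mathsf R_{h-2},\qquad a+b=h+2,$$ where $1=m_1<m_2\le\dots\le m_{n-1}<m_n=h-1$ are the exponents of $\mathfrak g$. Then $$\mathsf{ind}((\mathfrak{sl}_2)^{pr}\hookrightarrow\mathfrak g)-\mathsf{ind}((\mathfrak{sl}_2)^{sub}\hookrightarrow\mathfrak g)=\frac{h}{h^*}\left(\binom{h}{2}+\frac{(a-2)(b-2)}{4}\right).$$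
   Context: The ground field $\Bbbk$ is algebraically closed of characteristic zero. Normalised form: for a simple Lie algebra $\mathfrak g$ with Cartan subalgebra $\mathfrak t$, root system $\Delta$, positive roots $\Delta^+$ and highest root $\theta$, let $(\ ,\ )_{\mathfrak g}$ be the non-degenerate invariant symmetric bilinear form on $\mathfrak g$ such that the form induced on $\mathfrak t^*$ (via the isomorphism $\mathfrak t\simeq\mathfrak t^*$ given by the restriction of the form to $\mathfrak t$) satisfies $(\theta,\theta)_{\mathfrak g}=2$; that is, $(\beta,\beta)_{\mathfrak g}=2$ for every long root $\beta$. Dynkin index of a subalgebra: if $\mathfrak s\subset\mathfrak g$ is a simple subalgebra, then the restriction of $(\ ,\ )_{\mathfrak g}$ to $\mathfrak s$ is proportional to $(\ ,\ )_{\mathfrak s}$, and $\mathsf{ind}(\mathfrak s\hookrightarrow\mathfrak g)$ is the scalar with $(x,y)_{\mathfrak g}=\mathsf{ind}(\mathfrak s\hookrightarrow\mathfrak g)\,(x,y)_{\mathfrak s}$ for all $x,y\in\mathfrak s$. The dual Coxeter number is $h^*(\mathfrak g)=1+(\rho,\theta^\vee)_{\mathfrak g}$, where $\rho=\frac12\sum_{\gamma\in\Delta^+}\gamma$ and $\theta^\vee=2\theta/(\theta,\theta)_{\mathfrak g}$. A principal $\mathfrak{sl}_2$-subalgebra is one (isomorphic to $\mathfrak{sl}_2$) containing a principal (= regular) nilpotent element of $\mathfrak g$. The set of non-regular nilpotent elements of $\mathfrak g$ contains a dense $G$-orbit ($G$ a connected group with Lie algebra $\mathfrak g$); elements of this orbit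 are called subregular, and an $\mathfrak{sl}_2$-subalgebra containing a subregular nilpotent element is called subregular. $\mathsf R_d$ denotes the simple $\mathfrak{sl}_2$-module of dimension $d+1$. It is a known fact (Kostant; see Slodowy) that $\mathfrak g|_{(\mathfrak{sl}_2)^{pr}}=\bigoplus_{i=1}^n\mathsf R_{2m_i}$ and that the restriction of $\mathfrak g$ to $(\mathfrak{sl}_2)^{sub}$ has the form displayed in the claim for some integers $a\le b$ with $a+b=h+2$. Explicitly, $(a,b)$ equals: $(2,n+1)$ for $\mathbf A_n$; $(2,2n)$ for $\mathbf B_n$; $(4,2n-2)$ for $\mathbf C_n$, $n\ge3$; $(4,2n-4)$ for $\mathbf D_n$, $n\ge4$; $(6,8)$ for $\mathbf E_6$; $(8,12)$ for $\mathbf E_7$; $(12,20)$ for $\mathbf E_8$; $(6,8)$ for $\mathbf F_4$; $(4,4)$ for $\mathbf G_2$. *)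

(* Defs.v *)
From HB Require Import structures.
From mathcomp Require Import all_boot all_order all_algebra.
From mathcomp Require Import sesquilinear mpoly.

Set Implicit Arguments.
Unset Strict Implicit.
Unset Printing Implicit Defensive.

Import GRing.Theory.
Local Open Scope ring_scope.

HB.mixin Record Vector_isLieAlgebra (k : fieldType) g of Vector k g := {
  lie : g -> g -> g;
  lie_bilinear : bilinear_for *:%R *:%R lie;
  liexx : forall x, lie x x = 0;
  jacobi : forall x y z,
    lie x (lie y z) + lie y (lie z x) + lie z (lie x y) = 0
}.

#[short(type="lieAlgType")]
HB.structure Definition LieAlgebra (k : fieldType) :=
  {g of Vector k g & Vector_isLieAlgebra k g}.

HB.instance Definition _ (k : fieldType) (g : lieAlgType k) :=
  bilinear_isBilinear.Build k g g g *:%R *:%R (@lie k g) lie_bilinear.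

Section Subalgebra.
Context (k : fieldType) (g : lieAlgType k).

Record lie_subalgebra := LieSubalgebra {
  subalg_space :> {vspace g};
  subalg_closed : forall x y,
    x \in subalg_space -> y \in subalg_space -> lie x y \in subalg_space
}.

Definition subalg_lie (S : lie_subalgebra) (x y : subvs_of S) : subvs_of S :=
  Subvs (subalg_closed (subvsP x) (subvsP y)).

Lemma subalg_lie_bilinear (S : lie_subalgebra) :
  bilinear_for *:%R *:%R (@subalg_lie S).
Proof.
split=> u c x y; apply: val_inj => /=.
  by rewrite linearPl.
by rewrite linearPr.
Qed.

Lemma subalg_liexx (S : lie_subalgebra) (x : subvs_of S) : subalg_lie x x = 0.
Proof. by apply: val_inj => /=; rewrite liexx. Qed.

Lemma subalg_jacobi (S : lie_subalgebra) (x y z : subvs_of S) :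
  subalg_lie x (subalg_lie y z) + subalg_lie y (subalg_lie z x)
    + subalg_lie z (subalg_lie x y) = 0.
Proof. by apply: val_inj => /=; rewrite jacobi. Qed.

HB.instance Definition _ (S : lie_subalgebra) :=
  Vector_isLieAlgebra.Build k (subvs_of S)
    (@subalg_lie_bilinear S) (@subalg_liexx S) (@subalg_jacobi S).

End Subalgebra.

Section Structure.
Context (k : fieldType) (g : lieAlgType k).

Definition simple_lie : Prop :=
  (exists x y : g, lie x y != 0) /\
  forall I : {vspace g}, (forall x y : g, y \in I -> lie x y \in I) ->
    I = 0%VS \/ I = fullv.

Definition lie_space (U V : {vspace g}) : {vspace g} :=
  <<[seq lie x y | x <- vbasis U, y <- vbasis V]>>%VS.

Definition nilpotent_subalgebra (S : lie_subalgebra g) : Prop :=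
  exists N : nat, iter N (lie_space S) S = 0%VS.

Definition self_normalising (S : lie_subalgebra g) : Prop :=
  forall x : g, (forall y, y \in (S : {vspace g}) -> lie x y \in (S : {vspace g})) ->
    x \in (S : {vspace g}).

Definition cartan_subalgebra (S : lie_subalgebra g) : Prop :=
  nilpotent_subalgebra S /\ self_normalising S.

Definition dual (t : {vspace g}) := 'Hom(subvs_of t, k^o).

Definition is_root (t : {vspace g}) (a : dual t) : Prop :=
  a != 0 /\
  exists2 x : g, x != 0 & forall y : subvs_of t, lie (vsval y) x = (a y : k) *: x.

Definition nonneg_comb (t : {vspace g}) (P : seq (dual t)) (l : dual t) : Prop :=
  exists c : nat -> nat, l = \sum_(i < size P) nth 0 P i *+ c i.

Definition root_base (t : {vspace g}) (P : seq (dual t)) : Prop :=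
  [/\ basis_of fullv P,
      forall a, a \in P -> is_root a
    & forall a, is_root a -> nonneg_comb P a \/ nonneg_comb P (- a)].

(* A Cartan subalgebra together with a choice of positive roots. *)
Record root_data := RootData {
  csa : lie_subalgebra g;
  simple_roots : seq (dual csa);
  positive_roots : seq (dual csa);
  highest_root : dual csa;
  csaP : cartan_subalgebra csa;
  simple_rootsP : root_base simple_roots;
  positive_roots_uniq : uniq positive_roots;
  positive_rootsP : forall a,
    a \in positive_roots <-> is_root a /\ nonneg_comb simple_roots a;
  highest_rootP : is_root highest_root /\
    forall a, is_root a -> nonneg_comb simple_roots (highest_root - a)
}.

Definition rank (T : root_data) : nat := \dim (csa T).

(* The isomorphism t -> t^* given by the restriction of B to t, and the form
   it induces on t^*. *)
Definition flat (t : {vspace g}) (B : {biscalar g}) : 'Hom(subvs_of t, dual t) :=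
  linfun (fun x : subvs_of t =>
    linfun (fun y : subvs_of t => (B (vsval x) (vsval y) : k^o))).

Definition dual_form (t : {vspace g}) (B : {biscalar g}) (l m : dual t) : k :=
  B (vsval ((flat t B)^-1%VF l)) (vsval ((flat t B)^-1%VF m)).

Definition normalised_form (T : root_data) (B : {biscalar g}) : Prop :=
  [/\ forall x y, B x y = B y x,
      forall x y z, B (lie x y) z = B x (lie y z),
      forall x, (forall y, B x y = 0) -> x = 0
    & dual_form B (highest_root T) (highest_root T) = 2].

(* In the following definitions B is meant to be the normalised form of g. *)
Definition rho (T : root_data) : dual (csa T) :=
  2^-1 *: \sum_(a <- positive_roots T) a.

Definition coroot (T : root_data) (B : {biscalar g}) (a : dual (csa T)) : dual (csa T) :=
  (2 / dual_form B a a) *: a.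

Definition dual_coxeter_number (T : root_data) (B : {biscalar g}) : k :=
  1 + dual_form B (rho T) (coroot B (highest_root T)).

Definition reflection (T : root_data) (B : {biscalar g}) (a l : dual (csa T)) :
    dual (csa T) :=
  l - dual_form B l (coroot B a) *: a.

Definition coxeter_element (T : root_data) (B : {biscalar g}) :
    dual (csa T) -> dual (csa T) :=
  foldr (fun a w => reflection B a \o w) id (simple_roots T).

(* The Coxeter number is the order of a Coxeter element of the Weyl group. *)
Definition is_coxeter_number (T : root_data) (B : {biscalar g}) (h : nat) : Prop :=
  [/\ (0 < h)%N,
      iter h (coxeter_element B) =1 (id : dual (csa T) -> dual (csa T))
    & forall j, (0 < j < h)%N ->
        ~ iter j (coxeter_element B) =1 (id : dual (csa T) -> dual (csa T))].

Definition ad_nilpotent (x : g) : Prop :=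
  exists N : nat, forall y, iter N (lie x) y = 0.

(* exp(ad x) for x ad-nilpotent: then (ad x)^(dim g) = 0. *)
Definition exp_ad (x y : g) : g :=
  \sum_(i < \dim {:g}) (i`!%:R : k)^-1 *: iter i (lie x) y.

(* The adjoint group, generated by exp(ad x) with x nilpotent.  Inverses are
   covered by exp(ad (- x)). *)
Inductive adjoint_group : (g -> g) -> Prop :=
| adjoint_id : adjoint_group id
| adjoint_exp x s : ad_nilpotent x -> adjoint_group s ->
    adjoint_group (exp_ad x \o s).

Definition poly_eval (p : {mpoly k[\dim {:g}]}) (x : g) : k :=
  p.@[fun i => coord (vbasis {:g}) i x].

Definition invariant_poly (p : {mpoly k[\dim {:g}]}) : Prop :=
  forall s, adjoint_group s -> forall x, poly_eval p (s x) = poly_eval p x.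

(* The exponents of g are the m_i such that k[g]^G is freely generated by
   homogeneous polynomials of degrees m_i + 1. *)
Definition is_exponents (n : nat) (m : 'I_n -> nat) : Prop :=
  exists f : n.-tuple {mpoly k[\dim {:g}]},
    [/\ forall i, invariant_poly (tnth f i) /\ tnth f i \is (m i).+1.-homog,
        forall p : {mpoly k[\dim {:g}]}, invariant_poly p ->
          exists q : {mpoly k[n]}, p = q \mPo f
      & forall q : {mpoly k[n]}, q \mPo f = 0 -> q = 0].

Definition centraliser (x : g) : {vspace g} := lker (linfun (lie x)).

Definition regular (T : root_data) (x : g) : Prop := \dim (centraliser x) = rank T.

Definition principal_nilpotent (T : root_data) (e : g) : Prop :=
  ad_nilpotent e /\ regular T e.

Definition nonregular_nilpotent (T : root_data) (e : g) : Prop :=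
  ad_nilpotent e /\ ~ regular T e.

(* The orbit of e is (Zariski) dense in the set of non-regular nilpotents. *)
Definition subregular_nilpotent (T : root_data) (e : g) : Prop :=
  nonregular_nilpotent T e /\
  forall p : {mpoly k[\dim {:g}]},
    (forall s, adjoint_group s -> poly_eval p (s e) = 0) ->
    forall x, nonregular_nilpotent T x -> poly_eval p x = 0.

End Structure.

Section SL2.
Context (k : fieldType).

(* s is isomorphic to sl_2: it has a basis with the standard relations. *)
Definition is_sl2 (s : lieAlgType k) : Prop :=
  exists e h f : s,
    [/\ basis_of fullv [:: e; h; f],
        lie h e = 2 *: e, lie h f = - (2 *: f) & lie e f = h].

Context (g : lieAlgType k).

Definition principal_sl2 (T : root_data g) (S : lie_subalgebra g) : Prop :=
  is_sl2 (subvs_of S) /\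
  exists2 e, e \in (S : {vspace g}) & principal_nilpotent T e.

Definition subregular_sl2 (T : root_data g) (S : lie_subalgebra g) : Prop :=
  is_sl2 (subvs_of S) /\
  exists2 e, e \in (S : {vspace g}) & subregular_nilpotent T e.

(* c = ind(S -> g), where B is the normalised form of g. *)
Definition is_dynkin_index (B : {biscalar g}) (S : lie_subalgebra g) (c : k) : Prop :=
  exists (T' : root_data (subvs_of S)) (B' : {biscalar (subvs_of S)}),
    normalised_form T' B' /\
    forall x y : subvs_of S, B (vsval x) (vsval y) = c * B' x y.

Definition submodule (S : lie_subalgebra g) (V : {vspace g}) : Prop :=
  forall x v, x \in (S : {vspace g}) -> v \in V -> lie x v \in V.

Definition simple_submodule (S : lie_subalgebra g) (V : {vspace g}) : Prop :=
  [/\ submodule S V, V <> 0%VS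
    & forall U : {vspace g}, submodule S U -> (U <= V)%VS -> U = 0%VS \/ U = V].

(* g, restricted to the sl_2-subalgebra S, is the direct sum of the R_d for d
   in ds, R_d being the simple sl_2-module of dimension d + 1. *)
Definition decomposes_as (S : lie_subalgebra g) (ds : seq nat) : Prop :=
  exists V : 'I_(size ds) -> {vspace g},
    [/\ (\sum_i V i)%VS = fullv, directv (\sum_i V i)
      & forall i, simple_submodule S (V i) /\ \dim (V i) = (nth 0 ds i).+1].

End SL2.

(* Main.v *)
Require Import Defs.
From HB Require Import structures.
From mathcomp Require Import all_boot all_order all_algebra.
From mathcomp Require Import sesquilinear mpoly.
From mathcomp Require Import ring zify.

Set Implicit Arguments.
Unset Strict Implicit.
Unset Printing Implicit Defensive.

Import GRing.Theory.
Local Open Scope ring_scope.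

(* Let (e, h, f) span an sl_2-subalgebra of index c.  The Killing form is
   2 h^* times the normalised form, as one sees on the coroot of theta, and the
   normalised form takes the value 2 c at (h, h); so tr (ad h)^2 = 4 h^* c.  If g
   splits over the sl_2 into modules R_d, the trace is also the sum of
   d (d + 1) (d + 2) / 3.  The decomposition under the subregular sl_2 is given.
   For the principal one, let d_1 <= ... <= d_n be the highest weights; the
   restrictions of the basic invariants to Kostant's slice e + ker (ad f) are
   algebraically independent and weighted homogeneous of degrees 2 (m_i + 1) for
   the weights d_j + 2, whence d_i <= 2 m_i.  The subregular decomposition gives
   dim g = sum (2 m_i + 1), and so d_i = 2 m_i.  The claim is the difference of
   the two sums of cubic terms. *)

(** Only the subregular decomposition is given as data. It yields dim g because a + b = h + 2 makes
    (a - 1) + (b - 1) + (h - 1) equal to 2 m_n + 1, the term absent from its list of exponents.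
    Regularity of e enters through dim ker (ad e) = n: there are as many weights d_i as exponents,
    so n one-sided bounds and the equality of the two sums force equality everywhere. The
    restrictions to the slice are independent because an invariant that vanishes on the slice is
    zero. This is a Taylor argument at the single point e; it uses invariance under all of g in
    infinitesimal form, which comes from differentiating exp (t ad x) for nilpotent x and then
    taking brackets to reach the Cartan subalgebra. Neither ad h nor the Cartan subalgebra is known
    beforehand to act diagonalisably, so both the sl_2-theory and the root theory start from
    generalised eigenvectors. Honest ones come from the identity e^(n+1) f = f e^(n+1) + (n+1) (h -
    c n/2) e^n, which confines the spectrum of h on ker e: with c = 2 for modules, with c = 0 to
    show that roots are not isotropic. *)

Section Char0Nat.
Context (k : fieldType) (char0 : [pchar k] =i pred0).

Lemma natr_eq (m n : nat) : (m%:R == n%:R :> k) = (m == n).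
Proof.
wlog le : m n / (m <= n)%N.
  move=> W; case/orP: (leq_total m n) => [/W //|/W].
  by rewrite eq_sym [RHS]eq_sym.
rewrite -{1}(subnK le) natrD eq_sym -subr_eq0 addrK.
by rewrite ((pcharf0P k).1 char0) subn_eq0 eqn_leq le.
Qed.

End Char0Nat.

(** * Generalised eigenvectors *)

Section Iterates.
Context (k : fieldType) (V : vectType k).
Implicit Types (f g : {linear V -> V}) (u v : V) (c : k).

Lemma linearBZ f c u v : f (u - c *: v) = f u - c *: f v.
Proof. by rewrite linearB (linearZ_LR f). Qed.

Lemma iter_linearP f n c u v : iter n f (c *: u + v) = c *: iter n f u + iter n f v.
Proof. by elim: n => //= n ->; rewrite linearP. Qed.

Lemma iter_linear0 f n : iter n f 0 = 0.
Proof. by elim: n => //= n ->; rewrite linear0. Qed.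

Lemma iter_linearZ f n c v : iter n f (c *: v) = c *: iter n f v.
Proof. by rewrite -[c *: v]addr0 iter_linearP iter_linear0 addr0. Qed.

Lemma iter_linearD f n u v : iter n f (u + v) = iter n f u + iter n f v.
Proof. by rewrite -[u]scale1r iter_linearP !scale1r. Qed.

Lemma iter_linear_leq f m n v : (m <= n)%N -> iter m f v = 0 -> iter n f v = 0.
Proof. by move=> lemn fv0; rewrite -(subnK lemn) iterD fv0 iter_linear0. Qed.

(** Named so that the iterate carries a linear structure; [string_free] takes its kernel. *)
Definition iter_map n f v := iter n f v.

HB.instance Definition _ n f :=
  GRing.isLinear.Build k V V *:%R (iter_map n f) (iter_linearP f n).

Definition shiftl f c v := f v - c *: v.

Lemma shiftl_is_linear f c : linear (shiftl f c).
Proof.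
move=> a u v; rewrite /shiftl linearP scalerDr !scalerA [c * a]mulrC -scalerA.
by rewrite scalerBr opprD addrACA.
Qed.

HB.instance Definition _ f c :=
  GRing.isLinear.Build k V V *:%R (shiftl f c) (shiftl_is_linear f c).

Lemma iter_comm (f g : V -> V) n v : (forall u, f (g u) = g (f u)) ->
  iter n f (g v) = g (iter n f v).
Proof. by move=> fg; elim: n => //= n ->. Qed.

Lemma shiftl_comm f g c u : (forall u, f (g u) = g (f u)) ->
  shiftl f c (g u) = g (shiftl f c u).
Proof. by move=> fg; rewrite /shiftl fg linearBZ. Qed.

Lemma shiftl_shiftl f c d u : shiftl f c (shiftl f d u) = shiftl f d (shiftl f c u).
Proof. by apply: shiftl_comm => v; rewrite /shiftl linearBZ. Qed.

(** Predicates rather than [{vspace V}], so that existence statements, generalised eigenspaces and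
    [kills_invariants] can serve as subspaces in the induction principles. *)
Definition subspace_pred (U : V -> Prop) :=
  U 0 /\ forall c u v, U u -> U v -> U (c *: u + v).

Lemma subspaceZ U c v : subspace_pred U -> U v -> U (c *: v).
Proof. by case=> U0 UP Uv; rewrite -[_ *: _]addr0; apply: UP. Qed.

Lemma subspaceD U u v : subspace_pred U -> U u -> U v -> U (u + v).
Proof. by case=> U0 UP Uu Uv; rewrite -[u]scale1r; apply: UP. Qed.

Lemma subspaceB U u v : subspace_pred U -> U u -> U v -> U (u - v).
Proof. by case=> U0 UP Uu Uv; rewrite addrC -scaleN1r; apply: UP. Qed.

Lemma subspace_sum U I (r : seq I) (P : pred I) (F : I -> V) :
  subspace_pred U -> (forall i, P i -> U (F i)) -> U (\sum_(i <- r | P i) F i).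
Proof. by move=> sU UF; apply: big_ind => //; [case: sU | move=> *; apply: subspaceD]. Qed.

Lemma subspace_vspace (W : {vspace V}) : subspace_pred (fun v => v \in W).
Proof. by split=> [|c u v Wu Wv]; rewrite ?mem0v // memvD ?memvZ. Qed.

Lemma subspaceI U W : subspace_pred U -> subspace_pred W ->
  subspace_pred (fun v => U v /\ W v).
Proof. by case=> U0 UP [W0 WP]; split=> // c u v [? ?] [? ?]; split; [apply: UP | apply: WP]. Qed.

Definition gev f c v := exists n, iter n (shiftl f c) v = 0.

Lemma gev_eigen f c v : f v = c *: v -> gev f c v.
Proof. by exists 1%N; rewrite /= /shiftl H subrr. Qed.

Lemma subspace_gev f c : subspace_pred (gev f c).
Proof.
split=> [|a u v [m um] [n vn]]; first by exists 0%N.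
exists (m + n)%N; rewrite iter_linearP (iter_linear_leq (leq_addr n m) um).
by rewrite (iter_linear_leq (leq_addl m n) vn) scaler0 addr0.
Qed.

Lemma gev_comm f g c v : (forall u, f (g u) = g (f u)) -> gev f c v -> gev f c (g v).
Proof.
move=> fg [n vn]; exists n; rewrite iter_comm ?vn ?linear0 // => u.
exact: shiftl_comm.
Qed.

(* A finite-dimensional form of "f acts invertibly where c != 0". *)
Lemma gev_mem f (S : V -> Prop) c v : subspace_pred S -> (forall u, S u -> S (f u)) ->
  c != 0 -> gev f c v -> S (f v) -> S v.
Proof.
move=> sS fS c0 [n]; elim: n v => [|n IH] v.
  by rewrite /= => -> _; case: sS.
rewrite iterSr => vn' Sfv.
have Sfc : S (f (shiftl f c v)).
  by rewrite /shiftl linearBZ; apply: subspaceB => //; [apply: fS | apply: subspaceZ].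
have := IH _ vn' Sfc; rewrite /shiftl => Sc.
have: S (f v - (f v - c *: v)) by apply: subspaceB.
by rewrite subKr => /(subspaceZ c^-1 sS); rewrite scalerA mulVf // scale1r.
Qed.

Lemma gev_shift f c d v : gev f c v -> gev (shiftl f d) (c - d) v.
Proof.
case=> n vn; exists n; rewrite -[RHS]vn; apply: eq_iter => u.
by rewrite /shiftl /= /shiftl scalerBl opprB addrA subrK.
Qed.

Lemma gev_mem_shift f (S : V -> Prop) c d v : subspace_pred S ->
  (forall u, S u -> S (f u)) -> c != d -> gev f c v -> S (shiftl f d v) -> S v.
Proof.
move=> sS fS cd /(gev_shift d) gv; apply: gev_mem gv => //; last by rewrite subr_eq0.
by move=> u Su; apply: subspaceB => //; [apply: fS | apply: subspaceZ].
Qed.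

(** A split polynomial in f, given by the list of its roots. *)
Definition shifts f (s : seq k) v := foldr (shiftl f) v s.

Lemma shifts_comm f g s u : (forall u, f (g u) = g (f u)) ->
  shifts f s (g u) = g (shifts f s u).
Proof. by move=> fg; elim: s => //= c s ->; rewrite shiftl_comm. Qed.

Lemma shifts_eigen f s c v : f v = c *: v ->
  shifts f s v = (\prod_(d <- s) (c - d)) *: v.
Proof.
move=> fv; elim: s => [|d s /= ->]; first by rewrite big_nil scale1r.
by rewrite big_cons /shiftl linearZ_LR fv !scalerA -scalerBl; congr (_ *: _); ring.
Qed.

Lemma shifts_eigen0 f s c v : f v = c *: v -> v != 0 -> shifts f s v = 0 -> c \in s.
Proof.
move=> /shifts_eigen -> v0 /eqP; rewrite scaler_eq0 (negPf v0) orbF.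
by rewrite prodf_seq_eq0 => /hasP[d ds]; rewrite /= subr_eq0 => /eqP ->.
Qed.

(** Each factor f - d with d != c is injective on the generalised eigenspace for c, so the factors
    can be stripped off one by one. *)
Lemma gev_shifts0 f s c v : gev f c v -> shifts f s v = 0 -> c \notin s -> v = 0.
Proof.
elim: s v => [//|d s IH] v gv /= sv0; rewrite inE negb_or => /andP[cd cs].
apply: (IH) => //; apply: (@gev_mem_shift f (fun x => x = 0) c d) => //.
- by split=> // a u w -> ->; rewrite scaler0 addr0.
- by move=> u ->; rewrite linear0.
elim: s {IH sv0 cs} => //= a s; apply: gev_comm => u.
by rewrite /shiftl linearBZ.
Qed.

Lemma gev_gev f c d v : gev f c v -> gev f d v -> v != 0 -> c = d.
Proof.
move=> gc [n vn] v0; apply/eqP; apply: contraNT v0 => cd; apply/eqP.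
apply: (@gev_shifts0 f (nseq n d) c) => //; last by rewrite mem_nseq negb_and cd orbT.
by rewrite -[RHS]vn; elim: n {vn} => //= n ->.
Qed.

(* Leibniz rule: generalised eigenvalues add up along a bilinear pairing. *)
Lemma iter_pairing (U W X : zmodType) (m : U -> W -> X)
    (D : {additive X -> X}) (F : U -> U) (G : W -> W) :
  (forall y, m 0 y = 0) -> (forall x, m x 0 = 0) -> F 0 = 0 -> G 0 = 0 ->
  (forall x y, D (m x y) = m (F x) y + m x (G y)) ->
  forall a b x y, iter a F x = 0 -> iter b G y = 0 -> iter (a + b) D (m x y) = 0.
Proof.
move=> m1 m2 F0 G0 DFG.
have it0 n : iter n D 0 = 0 by elim: n => //= n ->; rewrite raddf0.
have itD n x y : iter n D (x + y) = iter n D x + iter n D y.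
  by elim: n => //= n ->; rewrite raddfD.
move=> a b; move En: (a + b)%N => n.
elim: n a b En => [|n IH] [|a] [|b] // En x y xa yb.
- by move: xa => /= ->; rewrite m1.
- by move: xa => /= ->; rewrite m1 it0 raddf0.
- by move: yb => /= ->; rewrite m2 it0 raddf0.
rewrite iterSr DFG itD (IH a b.+1) 1?(IH a.+1 b) ?addr0 //.
- by move: En => [<-]; rewrite addSnnS.
- by rewrite -iterSr.
- by move: En => [].
- by rewrite -iterSr.
Qed.

(** An induction in place of the binomial expansion of ((f - c) + (g - d))^(m+n), where every term
    contains (f - c)^m or (g - d)^n. *)
Lemma gev_add f g (h : {linear V -> V}) c d v : (forall u, f (g u) = g (f u)) ->
  (forall u, h u = f u + g u) -> gev f c v -> gev g d v -> gev h (c + d) v.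
Proof.
move=> fg hE [m vm] [n vn].
have sfg u : shiftl f c (shiftl g d u) = shiftl g d (shiftl f c u).
  by apply: shiftl_comm => w; symmetry; apply: shiftl_comm => x; rewrite fg.
have Esum u : shiftl h (c + d) u = shiftl f c u + shiftl g d u.
  by rewrite {1}/shiftl hE scalerDl opprD addrACA.
exists (m + n)%N.
move: (leqnn (m + n)); move: {2 3}(m + n)%N => p.
elim: p m n v vm vn => [|p IH] a b v va vb le.
  by move: va; move: le; rewrite leqn0 addn_eq0 => /andP[/eqP-> _].
case: a => [|a] in le va *; first by move: va => /= ->; rewrite iter_linear0 linear0.
case: b => [|b] in le vb *; first by move: vb => /= ->; rewrite iter_linear0 linear0.
rewrite iterSr Esum iter_linearD.
have -> : iter p (shiftl h (c + d)) (shiftl f c v) = 0.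
  apply: (IH a b.+1); [by rewrite -iterSr | | by move: le; rewrite addSn].
  by rewrite iter_comm ?vb ?linear0 // => u; rewrite sfg.
rewrite add0r; apply: (IH a.+1 b); [| by rewrite -iterSr | by move: le; rewrite addnS].
by rewrite iter_comm ?va ?linear0 // => u; rewrite sfg.
Qed.

End Iterates.

(** * Coordinate matrices and generalised eigenspace decompositions *)

Section CoordinateMatrix.
Context (k : fieldType) (V : vectType k) (n : nat) (e : n.-tuple V).
Hypothesis be : basis_of fullv e.
Implicit Types (f g : {linear V -> V}) (v : V).

Definition coordrow v := \row_i coord e i v.

Lemma coordrow_is_linear : linear coordrow.
Proof. by move=> c u v; apply/rowP => i; rewrite !mxE linearP. Qed.

HB.instance Definition _ :=
  GRing.isLinear.Build k V 'rV_n *:%R coordrow coordrow_is_linear.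

Lemma coordrow_eq0 v : coordrow v = 0 -> v = 0.
Proof.
move=> /rowP v0; rewrite (coord_basis be (memvf v)) big1 // => i _.
by move/(_ i): v0; rewrite !mxE => ->; rewrite scale0r.
Qed.

(** Row-vector convention: the matrix acts from the right, hence the reversed product in
    [coordmx_comp]. *)
Definition coordmx (f : V -> V) : 'M_n := \matrix_(i, j) coord e j (f e`_i).

Lemma coordrow_lin f v : coordrow (f v) = coordrow v *m coordmx f.
Proof.
apply/rowP=> j; rewrite !mxE {1}(coord_basis be (memvf v)) !linear_sum.
by apply: eq_bigr => i _; rewrite !linearZ !mxE.
Qed.

Lemma coordmx_comp f g : coordmx (f \o g) = coordmx g *m coordmx f.
Proof.
apply/row_matrixP=> i; rewrite row_mul.
have rowE h : row i (coordmx h) = coordrow (h e`_i) by apply/rowP=> j; rewrite !mxE.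
by rewrite !rowE /= coordrow_lin.
Qed.

End CoordinateMatrix.

Section EigenvectorInduction.
Context (k : closedFieldType) (V : vectType k).
Implicit Types (f g : {linear V -> V}) (u v : V) (c : k).

Lemma shifts_annihilator f : exists s, forall v, shifts f s v = 0.
Proof.
have [n [e be]] : exists n, exists e : n.-tuple V, basis_of fullv e.
  by exists (\dim {:V}), (vbasis {:V}); apply: vbasisP.
(* Dimension 0 is set apart because [horner_mx] is taken in a matrix ring of positive size. *)
case: n e be => [|n] e be.
  exists [::] => v /=; apply/eqP; rewrite -memv0.
  by have := memvf v; rewrite -(span_basis be) (tuple0 e) span_nil.
pose M := coordmx e f.
have [s Es] := closed_field_poly_normal (char_poly M).
exists s => v; apply: (coordrow_eq0 be).
suff -> : coordrow e (shifts f s v) =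
    coordrow e v *m horner_mx M (\prod_(z <- s) ('X - z%:P)).
  have := Cayley_Hamilton M; rewrite Es (monicP (char_poly_monic M)) scale1r => ->.
  by rewrite mulmx0.
elim: s {Es} => [|c s IH] /=; first by rewrite big_nil rmorph1 mulmx1.
rewrite big_cons mulrC rmorphM rmorphB /= horner_mx_X horner_mx_C mulmxA -IH.
rewrite mulmxBr mul_mx_scalar /shiftl linearB (linearZ_LR (coordrow e)).
by rewrite /= (coordrow_lin be).
Qed.

(** The decomposition of U into generalised eigenspaces, as an induction principle. One root c of an
    annihilating polynomial is removed at a time: (f - c) v is a sum of generalised eigenvectors,
    those for eigenvalues other than c are lifted through f - c, and what remains of v is a
    generalised eigenvector for c. *)
Lemma gev_ind f (U W : V -> Prop) : subspace_pred U -> (forall u, U u -> U (f u)) ->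
  subspace_pred W -> (forall c v, U v -> gev f c v -> W v) -> forall v, U v -> W v.
Proof.
move=> sU fU sW gW.
pose P v := exists s : seq (k * V),
  (forall p, p \in s -> U p.2 /\ gev f p.1 p.2) /\ v = \sum_(p <- s) p.2.
suff PU v : U v -> P v.
  move=> v /PU[s [sP ->]]; rewrite big_seq; apply: subspace_sum => // p /sP[].
  by move=> Up gp; apply: gW gp.
have inv c d w : d != c -> U w -> gev f d w ->
    exists2 x, U x /\ gev f d x & shiftl f c x = w.
  move=> dc Uw gw; move: (gw) => [n]; elim: n w Uw gw => [|n IH] w Uw gw.
    by move=> /= ->; exists 0; rewrite ?linear0 //; split; [case: sU | case: (subspace_gev f d)].
  rewrite iterSr => /IH[].
  - by rewrite /shiftl; apply: subspaceB => //; [apply: fU | apply: subspaceZ].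
  - by apply: gev_comm gw => u; rewrite /shiftl linearBZ.
  move=> x [Ux gx] Ex.
  (* Here (f - c) x = (f - d) w, while (f - c) w = (f - d) w + (d - c) w. *)
  exists ((d - c)^-1 *: (w - x)).
    by split; [apply: subspaceZ => //; apply: subspaceB
              | apply: subspaceZ (subspace_gev f d) _; apply: subspaceB (subspace_gev f d) _ _].
  rewrite (linearZ_LR (shiftl f c)) linearB /= Ex /shiftl opprB [X in _ *: X]addrC addrA subrK.
  by rewrite -scalerBl scalerA mulVf ?subr_eq0 ?scale1r.
have [s sV] := shifts_annihilator f.
elim: s v {sV}(sV v) => [|c s IH] v sv Uv.
  by move: sv => /= ->; exists [::]; rewrite big_nil; split.
have: P (shiftl f c v).
  apply: IH; last by rewrite /shiftl; apply: subspaceB => //; [apply: fU | apply: subspaceZ].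
  move: sv => /=; rewrite shifts_comm // => u; by rewrite /shiftl linearBZ.
case=> r [rP Er].
have [X XP] : exists X : k * V -> V, forall p, p \in r -> p.1 != c ->
    (U (X p) /\ gev f p.1 (X p)) /\ shiftl f c (X p) = p.2.
  elim: r rP {Er} => [|p r IHr] rP; first by exists (fun=> 0).
  have [|X XP] := IHr; first by move=> q qr; apply: rP; rewrite inE qr orbT.
  have [Up gp] := rP p (mem_head _ _).
  have [pc|pc] := eqVneq p.1 c.
    by exists X => q; rewrite inE => /predU1P[->|/XP//]; rewrite pc eqxx.
  have [x xP Ex] := inv c _ _ pc Up gp.
  exists (fun q => if q == p then x else X q) => q; rewrite inE.
  by case: eqP => [-> _ _|_ /= /XP].
pose r' := [seq p <- r | p.1 != c].
pose x0 := v - \sum_(p <- r') X p.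
exists ((c, x0) :: [seq (p.1, X p) | p <- r']); split; last first.
  by rewrite big_cons big_map /= subrK.
have r'P p : p \in r' -> (U (X p) /\ gev f p.1 (X p)) /\ shiftl f c (X p) = p.2.
  by rewrite mem_filter => /andP[pc pr]; apply: XP.
move=> p; rewrite inE => /predU1P[->|/mapP[q /r'P qP ->] /=]; last by case: qP.
split=> /=.
  apply: subspaceB => //; rewrite big_seq; apply: subspace_sum => // q /r'P qP.
  by case: qP => [[]].
suff [n nP] : gev f c (shiftl f c x0) by exists n.+1; rewrite iterSr.
rewrite linearB /= Er linear_sum.
have -> : \sum_(p <- r') shiftl f c (X p) = \sum_(p <- r') p.2.
  by rewrite !big_seq; apply: eq_bigr => q /r'P [].
rewrite /r' big_filter (bigID (fun p => p.1 == c)) /= addrK big_seq_cond.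
apply: subspace_sum; first exact: subspace_gev.
by move=> q /andP[/rP[_ gq] /eqP <-].
Qed.

(** The operators are treated in turn; as they commute, each generalised eigenspace of one is stable
    under the others and can replace Q. *)
Lemma joint_gev_ind n (F : 'I_n -> {linear V -> V}) (U W : V -> Prop) :
  (forall i j u, F i (F j u) = F j (F i u)) ->
  subspace_pred U -> (forall i u, U u -> U (F i u)) -> subspace_pred W ->
  (forall v, U v -> (forall i, exists c, gev (F i) c v) -> W v) ->
  forall v, U v -> W v.
Proof.
move=> FC sU FU sW FW.
suff H m (Q : V -> Prop) : (m <= n)%N -> subspace_pred Q ->
    (forall i u, Q u -> Q (F i u)) ->
    (forall v, Q v -> (forall i : 'I_n, (i < m)%N -> exists c, gev (F i) c v) -> W v) ->
    forall v, Q v -> W v.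
  by move=> v Uv; apply: (H n U) => // w Uw gw; apply: FW => // i; apply: gw.
elim: m Q => [|m IH] Q mn sQ FQ QW; first by move=> v Qv; apply: QW.
pose im := Ordinal mn.
apply: (gev_ind (f := F im)) => // [u Qu|c v Qv gv]; first exact: FQ.
apply: (IH (fun u => Q u /\ gev (F im) c u)) => //.
- exact: ltnW.
- exact: subspaceI (subspace_gev _ _).
- by move=> i u [Qu gu]; split; [apply: FQ | apply: gev_comm gu].
move=> w [Qw gw] iw; apply: QW => // i; rewrite ltnS leq_eqVlt => /predU1P[im_i|/iw //].
by exists c; suff -> : i = im by []; apply: val_inj.
Qed.

(** The last non-zero vector among the successive images of v under the factors f - c is an
    eigenvector, and it has stayed in U. *)
Lemma eigen_in_subspace f (U : V -> Prop) s v : (forall c u, U u -> U (shiftl f c u)) ->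
  U v -> v != 0 -> shifts f s v = 0 -> exists c u, [/\ c \in s, U u, u != 0 & f u = c *: u].
Proof.
move=> fU; elim: s v => [|c s IH] v Uv v0 /= sv; first by rewrite sv eqxx in v0.
have [cv|cv] := eqVneq (shiftl f c v) 0.
  by exists c, v; rewrite mem_head; split => //; apply/eqP; rewrite -subr_eq0 -/(shiftl f c v) cv.
have [||d [u [ds Uu u0 du]]] := IH (shiftl f c v) _ cv; first exact: fU.
  by rewrite -sv shifts_comm // => u; rewrite /shiftl linearBZ.
by exists d, u; rewrite inE ds orbT.
Qed.

End EigenvectorInduction.

Section WeightShift.
Context (k : closedFieldType) (V : vectType k).
Implicit Types (f g : {linear V -> V}) (u v : V) (c : k).
Hypothesis char0 : [pchar k] =i pred0.

Lemma nat_avoiding (s : seq k) c : c != 0 -> exists n : nat, c *+ n \notin s.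
Proof.
move=> c0; pose t := [seq c *+ n | n <- iota 0 (size s).+1].
have ut : uniq t.
  rewrite map_inj_in_uniq ?iota_uniq // => m n _ _ /eqP.
  by rewrite -!(mulr_natr c) (inj_eq (mulfI c0)) (natr_eq char0) => /eqP.
have [/allP ts|/allPn[x /mapP[n _ ->] xs]] := boolP (all (mem s) t).
  by have := uniq_leq_size ut ts; rewrite size_map size_iota ltnn.
by exists n.
Qed.

Definition lcommutator (p q : 'End(V)) : 'End(V) := (p \o q)%VF - (q \o p)%VF.

Lemma lcommutator_is_linear p : linear (lcommutator p).
Proof.
move=> c x y; rewrite /lcommutator comp_lfunDr comp_lfunDl -comp_lfunZr -comp_lfunZl.
by rewrite scalerBr opprD addrACA.
Qed.

HB.instance Definition _ p :=
  GRing.isLinear.Build k 'End(V) 'End(V) *:%R (lcommutator p) (lcommutator_is_linear p).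

(* psi^n is an eigenvector of [phi, -] with eigenvalue n c, and these are
   distinct. *)
Lemma weight_shift_nilpotent (phi psi : {linear V -> V}) c : c != 0 ->
  (forall v, phi (psi v) = psi (phi v) + c *: psi v) ->
  exists N, forall v, iter N psi v = 0.

Proof.
move=> c0 comm; pose p := linfun phi : 'End(V).
have [s sV] : exists s, forall q : 'End(V), shifts (lcommutator p) s q = 0.
  exact: shifts_annihilator.
have [n ns] := nat_avoiding s c0; exists n.
pose q : 'End(V) := iter n (fun q => linfun psi \o q)%VF \1%VF.
have qE v : q v = iter n psi v.
  rewrite /q; elim: n {ns q} v => [|n IH] v /=; first by rewrite id_lfunE.
  by rewrite comp_lfunE lfunE /= IH.
have pq : lcommutator p q = (c *+ n) *: q.
  apply/lfunP => v; rewrite scale_lfunE add_lfunE opp_lfunE !comp_lfunE !qE lfunE /=.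
  rewrite [p v]lfunE /=; apply/eqP; rewrite subr_eq; apply/eqP.
  elim: n {ns q qE} => [|n IH] /=; first by rewrite mulr0n scale0r add0r.
  by rewrite comm IH linearD linearZ /= mulrSr scalerDl addrAC.
move=> v; rewrite -qE; suff -> : q = 0 by rewrite zero_lfunE.
apply/eqP; apply: contraNT ns => q0.
exact: (shifts_eigen0 pq q0 (sV q)).
Qed.

End WeightShift.

(** * Traces and eigenbases *)

Section Trace.
Context (k : fieldType) (V : vectType k).
Implicit Types (f g : {linear V -> V}) (u v : V).

Lemma scalar_ext u v : (forall phi : {scalar V}, phi u = phi v) -> u = v.
Proof.
move=> uv; apply/eqP; rewrite -subr_eq0; apply/eqP.
rewrite (coord_vbasis (memvf (u - v))) big1 // => i _.
by rewrite linearB /= uv subrr scale0r.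
Qed.

(** The lengths n and m are not assumed equal, so the transition matrices are rectangular; Q P = 1
    and cyclicity of the trace suffice. *)
Lemma tr_coordmx_indep n m (X : n.-tuple V) (Y : m.-tuple V) (f : {linear V -> V}) :
  basis_of fullv X -> basis_of fullv Y -> \tr (coordmx X f) = \tr (coordmx Y f).
Proof.
move=> bX bY.
pose P := \matrix_(i < n, j < m) coord Y j X`_i.
pose Q := \matrix_(i < m, j < n) coord X j Y`_i.
have rQ v : coordrow X v = coordrow Y v *m Q.
  apply/rowP=> j; rewrite !mxE {1}(coord_basis bY (memvf v)) linear_sum.
  by apply: eq_bigr => i _; rewrite !mxE linearZ.
have rP v : coordrow Y v = coordrow X v *m P.
  apply/rowP=> j; rewrite !mxE {1}(coord_basis bX (memvf v)) linear_sum.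
  by apply: eq_bigr => i _; rewrite !mxE linearZ.
have QP : Q *m P = 1%:M.
  apply/row_matrixP => i; rewrite row_mul.
  have -> : row i Q = coordrow X Y`_i by apply/rowP=> j; rewrite !mxE.
  rewrite -rP; apply/rowP=> j.
  by rewrite !mxE coord_free ?(basis_free bY).
have -> : coordmx X f = P *m coordmx Y f *m Q.
  apply/row_matrixP => i; rewrite !row_mul.
  have -> : row i P = coordrow Y X`_i by apply/rowP=> j; rewrite !mxE.
  by rewrite -(coordrow_lin bY) -rQ; apply/rowP=> j; rewrite !mxE.
by rewrite -mulmxA mxtrace_mulC -mulmxA QP mulmx1.
Qed.

Definition ltr (f : V -> V) := \tr (coordmx (vbasis {:V}) f).

Lemma eq_ltr (f g : V -> V) : f =1 g -> ltr f = ltr g.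
Proof. by move=> fg; apply: eq_bigr => i _; rewrite !mxE fg. Qed.

Lemma ltrD (f g : V -> V) : ltr (fun v => f v + g v) = ltr f + ltr g.
Proof. by rewrite -big_split; apply: eq_bigr => i _; rewrite !mxE linearD. Qed.

Lemma ltrZ c (f : V -> V) : ltr (fun v => c *: f v) = c * ltr f.
Proof. by rewrite /ltr /mxtrace big_distrr; apply: eq_bigr => i _; rewrite !mxE linearZ. Qed.

Lemma ltrC f g : ltr (f \o g) = ltr (g \o f).
Proof. by rewrite /ltr !(coordmx_comp (vbasisP _)) mxtrace_mulC. Qed.

Lemma ltr_eigenbasis f (s : seq (k * V)) : basis_of fullv (unzip2 s) ->
  (forall p, p \in s -> f p.2 = p.1 *: p.2) -> ltr f = \sum_(p <- s) p.1.
Proof.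
move=> bs fs; pose X := map_tuple snd (in_tuple s).
rewrite /ltr (tr_coordmx_indep f (vbasisP _) (bs : basis_of fullv X)) /mxtrace.
rewrite (big_nth (0, 0)) big_mkord; apply: eq_bigr => i _.
rewrite mxE.
have Xi : X`_i = (nth (0, 0) s i).2 by rewrite (nth_map (0, 0)).
rewrite {1}Xi fs ?mem_nth // linearZ /= -Xi coord_free ?(basis_free bs) // eqxx.
by rewrite mulr1.
Qed.

End Trace.

(** Vectors are compared through an arbitrary linear form, whose values [ring] then treats as
    atoms. *)
Ltac lmod := let phi := fresh "phi" in apply: scalar_ext => phi;
  repeat (progress rewrite ?(linear0 phi, linearD phi, linearN phi, linearZ_LR phi) /=).

Section EigenBasis.
Context (k : fieldType) (V : vectType k) (f : {linear V -> V}).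

Lemma shifts_linearP s c u v : shifts f s (c *: u + v) = c *: shifts f s u + shifts f s v.
Proof. by elim: s => //= d s ->; rewrite (linearP (shiftl f d)). Qed.

Lemma subspace_shifts_ker s : subspace_pred (fun v => shifts f s v = 0).
Proof.
split=> [|c u v su sv]; last by rewrite shifts_linearP su sv scaler0 addr0.
by elim: s => //= d s ->; rewrite linear0.
Qed.

Lemma shifts_shiftl s c v : shifts f s (shiftl f c v) = shiftl f c (shifts f s v).
Proof. by apply: shifts_comm => u; rewrite /shiftl linearBZ. Qed.

Lemma shifts_rem s c v : c \in s -> shifts f s v = shifts f (rem c s) (shiftl f c v).
Proof.
elim: s => //= d s IH; rewrite inE eq_sym; case: eqVneq => [->|_] /= cs.
  by rewrite shifts_shiftl.
by rewrite IH.
Qed.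

(** The roots are distinct, so the factors other than f - c are injective on the generalised
    eigenspace for c, and f - c alone must kill v. *)
Lemma gev_shifts_eigen s c v : uniq s -> gev f c v -> v != 0 -> shifts f s v = 0 ->
  c \in s /\ f v = c *: v.
Proof.
move=> us gv v0 sv.
have cs : c \in s by apply: contraNT v0 => /(gev_shifts0 gv sv) ->.
split=> //; apply/eqP; rewrite -subr_eq0; apply/eqP.
apply: (@gev_shifts0 _ _ f (rem c s) c); last by rewrite mem_rem_uniq // inE eqxx.
  by apply: (@gev_comm _ _ f (shiftl f c)) gv => u; rewrite /shiftl linearBZ.
by rewrite -/(shiftl f c v) -shifts_rem.
Qed.

Lemma eigen_basis (W : {vspace V}) s : uniq s -> (forall v, v \in W -> f v \in W) ->
  (forall v, v \in W -> shifts f s v = 0) ->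
  exists X : seq (k * V), basis_of W (unzip2 X) /\
    forall p, p \in X -> [/\ p.1 \in s & f p.2 = p.1 *: p.2].
Proof.
elim: s W => [|c s IH] W /=.
  move=> _ _ W0; have -> : W = 0%VS.
    by apply/eqP; rewrite -subv0; apply/subvP => v /W0 ->; rewrite mem0v.
  by exists [::]; split=> //; apply: nil_basis.
move=> /andP[cs us] fW sW.
have sWW v : v \in W -> shifts f s v \in W.
  by elim: (s) v => //= d t IHt v Wv; rewrite /shiftl memvB ?memvZ ?fW ?IHt.
pose W1 : {vspace V} := (W :&: lker (linfun (shiftl f c)))%VS.
pose Fs v := shifts f s v.
have Fs_lin : linear Fs by move=> a u v; apply: shifts_linearP.
pose FsL : {linear V -> V} := HB.pack Fs (GRing.isLinear.Build k V V *:%R Fs Fs_lin).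
pose W2 : {vspace V} := (W :&: lker (linfun FsL))%VS.
have W1P v : v \in W1 -> f v = c *: v.
  by rewrite memv_cap memv_ker lfunE /= subr_eq0 => /andP[_ /eqP].
have W2E v : (v \in W2) = (v \in W) && (shifts f s v == 0).
  by rewrite memv_cap memv_ker lfunE.
have W2P v : v \in W2 -> v \in W /\ shifts f s v = 0.
  by rewrite W2E => /andP[? /eqP].
have [X [bX XP]] : exists X : seq (k * V), basis_of W2 (unzip2 X) /\
    forall p, p \in X -> [/\ p.1 \in s & f p.2 = p.1 *: p.2].
  apply: IH => // [v /W2P[Wv sv]|v /W2P[]//].
  rewrite W2E fW //=.
  by rewrite (@shifts_comm _ _ f f) // sv linear0.
have q0 : \prod_(d <- s) (c - d) != 0.
  rewrite prodf_seq_neq0; apply/allP => d ds /=; rewrite subr_eq0.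
  by apply: contraNneq cs => ->.
have dW : directv (W1 + W2).
  apply/directv_addP/eqP; rewrite -subv0; apply/subvP => v.
  rewrite memv_cap => /andP[/W1P ev /W2P[_]]; rewrite (shifts_eigen _ ev) => /eqP.
  by rewrite scaler_eq0 (negPf q0) memv0.
have sumW : (W1 + W2)%VS = W.
  apply/eqP; rewrite eqEsubv subv_add !capvSl /=; apply/subvP => v Wv.
  (* Lagrange interpolation: the product over s sends v into the c-eigenspace and acts there by the
     scalar that is divided out. *)
  pose w := (\prod_(d <- s) (c - d))^-1 *: shifts f s v.
  have ew : f (shifts f s v) = c *: shifts f s v.
    by apply/eqP; rewrite -subr_eq0; apply/eqP; apply: sW.
  have Ww : w \in W by rewrite memvZ ?sWW.
  rewrite -(subrK w v) addrC memv_add //.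
    by rewrite memv_cap Ww memv_ker lfunE /= /shiftl /w (linearZ_LR f) ew scalerA mulrC -scalerA subrr.
  rewrite W2E memvB //= addrC -scaleN1r shifts_linearP.
  rewrite /w -[_ *: shifts f s v]addr0 shifts_linearP (shifts_eigen _ ew) scalerA mulVf //.
  have -> : shifts f s 0 = 0 by case: (subspace_shifts_ker s).
  by rewrite scale1r addr0 scaleN1r addNr.
exists ([seq (c, v) | v <- vbasis W1] ++ X); split.
  rewrite /unzip2 map_cat -map_comp map_id -sumW; apply: cat_basis => //.
  exact: vbasisP.
move=> p; rewrite mem_cat => /orP[/mapP[v /vbasis_mem /W1P ev ->]|/XP[ps ep]].
  by rewrite mem_head.
by rewrite inE ps orbT.
Qed.

End EigenBasis.

Section KernelSpectrum.
Context (k : closedFieldType) (char0 : [pchar k] =i pred0).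
Context (V : vectType k) (e h f : {linear V -> V}) (c : k).
Hypothesis he : forall v, h (e v) = e (h v) + c *: e v.
Hypothesis ef : forall v, e (f v) = f (e v) + h v.

Let natf_neq0 n : n.+1%:R != 0 :> k.
Proof. by rewrite ((pcharf0P k).1 char0). Qed.

(** The scalar c stays free for the sake of [root_norm_neq0], where it is 0. No relation between h
    and f is assumed: in [root_ker], f only lies in a generalised weight space. *)
Lemma iter_e_f n v :
  iter n.+1 e (f v) = f (iter n.+1 e v) + n.+1%:R *: shiftl h (c * n%:R / 2%:R) (iter n e v).
Proof.
have two := natf_neq0 1.
elim: n => [|n IH].
  by rewrite /= ef /shiftl mulr0 mul0r scale0r subr0 scale1r.
rewrite iterS IH linearD ef (linearZ_LR e) /shiftl linearBZ -addrA; congr (_ + _).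
have -> : e (h (iter n e v)) = h (iter n.+1 e v) - c *: iter n.+1 e v.
  by rewrite /= he addrK.
rewrite -iterS; set x := iter n.+1 e v.
apply: scalar_ext => phi.
rewrite !(linearD phi, linearN phi, linearZ_LR phi) /=.
field.
exact: two.
Qed.

Definition ker_spectrum n := [seq c * i%:R / 2%:R | i <- rev (iota 0 n)].

(** Each factor pushes the vector into the image of a higher power of e: if e^(n+1) u = 0, then
    [iter_e_f] gives (n+1) (h - c n/2) e^n u = e^(n+1) f u. After N factors nothing is left. *)
Lemma ker_spectrumP N : (forall v, iter N e v = 0) ->
  forall v, e v = 0 -> shifts h (ker_spectrum N) v = 0.
Proof.
move=> eN v ev.
suff [u _ ->] : exists2 u, e (shifts h (ker_spectrum N) v) = 0 &
  shifts h (ker_spectrum N) v = iter N e u by exact: eN.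
elim: (N) => [|n [u eu E]]; first by exists v.
have -> : ker_spectrum n.+1 = c * n%:R / 2%:R :: ker_spectrum n.
  by rewrite /ker_spectrum -[n.+1]addn1 iotaD rev_cat.
rewrite /=; set x := shifts _ _ _ in eu E *.
exists (n.+1%:R^-1 *: f u).
  by rewrite /shiftl linearBZ eu scaler0 subr0 -[LHS](addrK (c *: e x)) -he eu scaler0 linear0 subr0.
have := iter_e_f n u; rewrite [iter n.+1 e u]iterS -E eu linear0 add0r => Ef.
by rewrite -iterS iter_linearZ Ef scalerA mulVf ?scale1r.
Qed.

End KernelSpectrum.

(** * Modules over sl_2 *)

Section Sl2Relations.
Context (k : closedFieldType) (V : vectType k).

(* The action of a standard triple on a module, written with maps that need
   not belong to an algebra of endomorphisms. *)
Definition sl2_triple (e h f : V -> V) : Prop :=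
  [/\ forall v, h (e v) = e (h v) + 2 *: e v,
      forall v, h (f v) = f (h v) - 2 *: f v
    & forall v, e (f v) = f (e v) + h v].

Definition opp_map (h : V -> V) (v : V) := - h v.

Lemma opp_map_is_linear (h : {linear V -> V}) : linear (opp_map h).
Proof. by move=> c u v; rewrite /opp_map linearP opprD scalerN. Qed.

HB.instance Definition _ (h : {linear V -> V}) :=
  GRing.isLinear.Build k V V *:%R (opp_map h) (opp_map_is_linear h).

Lemma sl2_triple_opp (e h f : {linear V -> V}) :
  sl2_triple e h f -> sl2_triple f (opp_map h) e.
Proof.
case=> he hf ef; split=> v; rewrite /opp_map.
- by rewrite hf opprB linearN addrC.
- by rewrite he opprD linearN.
- by rewrite ef addrK.
Qed.

End Sl2Relations.

Section Sl2Module.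
Context (k : closedFieldType) (char0 : [pchar k] =i pred0).
Context (V : vectType k).
Implicit Types (e h f : {linear V -> V}) (v : V).

Let nat0 n : n.+1%:R != 0 :> k.
Proof. by rewrite ((pcharf0P k).1 char0). Qed.

Lemma sl2_e_nilpotent e h f : sl2_triple e h f -> exists N, forall v, iter N e v = 0.
Proof. by case=> he _ _; apply: (weight_shift_nilpotent char0 (nat0 1) he). Qed.

Definition nats n := [seq i%:R | i <- rev (iota 0 n)] : seq k.

Lemma nats_uniq n : uniq (nats n).
Proof.
rewrite map_inj_uniq ?rev_uniq ?iota_uniq // => i j /eqP.
by rewrite (natr_eq char0) => /eqP.
Qed.

Lemma mem_nats n c : c \in nats n -> exists d : nat, c = d%:R.
Proof. by case/mapP=> d _ ->; exists d. Qed.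

Lemma highest_weights e h f : sl2_triple e h f ->
  exists N, forall v, e v = 0 -> shifts h (nats N) v = 0.
Proof.
move=> t; have [N eN] := sl2_e_nilpotent t; exists N => v ev.
case: t => he _ ef; have := ker_spectrumP char0 he ef eN ev.
suff -> : ker_spectrum 2 N = nats N by [].
by apply: eq_map => i; rewrite mulrAC mulfV ?mul1r ?(nat0 1).
Qed.

(** On ker e the operator h is annihilated by a polynomial with distinct natural roots, so a
    generalised eigenvector there is an honest one. *)
Lemma highest_weight_eigen e h f c v : sl2_triple e h f -> e v = 0 -> v != 0 ->
  gev h c v -> exists d : nat, c = d%:R /\ h v = d%:R *: v.
Proof.
move=> /highest_weights[N hN] ev v0 gv.
have [/mem_nats[d ->] hv] := gev_shifts_eigen (nats_uniq N) gv v0 (hN v ev).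
by exists d.
Qed.

(** Twice the operator h^2/2 + e f + f e, ordered with f to the left of e; it acts on R_d by d (d +
    2). *)
Definition casimir (e h f : V -> V) v := 4 *: f (e v) + h (h v) + 2 *: h v.

Lemma casimir_is_linear e h f : linear (casimir e h f).
Proof.
move=> c u v; rewrite /casimir !linearP /=; lmod; ring.
Qed.

HB.instance Definition _ e h f :=
  GRing.isLinear.Build k V V *:%R (casimir e h f) (casimir_is_linear e h f).

Section Triple.
Context (e h f : {linear V -> V}) (t : sl2_triple e h f).
Let C := casimir e h f.

Let he v : h (e v) = e (h v) + 2 *: e v. Proof. by case: t. Qed.
Let hf v : h (f v) = f (h v) - 2 *: f v. Proof. by case: t. Qed.
Let ef v : e (f v) = f (e v) + h v. Proof. by case: t. Qed.

Ltac pbw := repeat (progress rewrite ?(linearD e, linearN e, linearZ_LR e,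
  linearD h, linearN h, linearZ_LR h, linearD f, linearN f, linearZ_LR f, he, hf, ef) /=).

Lemma casimir_h v : C (h v) = h (C v).
Proof. by rewrite /C /casimir; pbw; lmod; ring. Qed.

Lemma casimir_e v : C (e v) = e (C v).
Proof. by rewrite /C /casimir; pbw; lmod; ring. Qed.

Lemma casimir_f v : C (f v) = f (C v).
Proof. by rewrite /C /casimir; pbw; lmod; ring. Qed.

Lemma casimir_highest d v : e v = 0 -> h v = d *: v -> C v = (d * (d + 2)) *: v.
Proof.
move=> ev hv; rewrite /C /casimir ev linear0 hv (linearZ_LR h) hv.
lmod; ring.
Qed.

(** First tr h = tr [e, f] = 0. Then tr h^2 = tr h [e, f] = tr [f, h] e = 2 tr f e, so tr C = 4 tr f
    e + tr h^2 = 3 tr h^2. This trades a sum of squared weights for one scalar per simple module. *)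
Lemma tr_casimir : ltr C = 3%:R * ltr (h \o h).
Proof.
have trh : ltr h = 0.
  have -> : ltr h = ltr (fun v => (e \o f) v + (-1) *: (f \o e) v).
    by apply: eq_ltr => v /=; pbw; lmod; ring.
  by rewrite ltrD ltrZ (ltrC e f) mulN1r subrr.
have trhh : ltr (h \o h) = 2 * ltr (f \o e).
  have -> : ltr (h \o h) = ltr (fun v => ((h \o e) \o f) v + (-1) *: h (f (e v))).
    by apply: eq_ltr => v /=; pbw; lmod; ring.
  rewrite ltrD ltrZ (ltrC (h \o e) f).
  have -> : ltr (f \o (h \o e)) = ltr (fun v => h (f (e v)) + 2 *: (f \o e) v).
    by apply: eq_ltr => v /=; pbw; lmod; ring.
  by rewrite ltrD ltrZ; ring.
have -> : ltr C = ltr (fun v => (4 *: (f \o e) v + (h \o h) v) + 2 *: h v) by [].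
by rewrite !ltrD !ltrZ trh trhh; ring.
Qed.

Lemma h_string d i v : h v = d%:R *: v -> h (iter i f v) = (d%:R - 2 * i%:R) *: iter i f v.
Proof.
move=> hv; elim: i => [|i IH] /=; first by rewrite mulr0 subr0.
by rewrite hf IH (linearZ_LR f); lmod; ring.
Qed.

Lemma e_string d i v : e v = 0 -> h v = d%:R *: v ->
  e (iter i.+1 f v) = (i.+1%:R * (d%:R - i%:R)) *: iter i f v.
Proof.
move=> ev hv; elim: i => [|i IH] /=.
  by rewrite ef ev linear0 hv; lmod; ring.
rewrite ef -/(iter i.+1 f v) IH (linearZ_LR f) (h_string _ hv) /=; lmod; ring.
Qed.

(** Otherwise f^(d+1) v would be a highest weight vector of the negative weight -d - 2. *)
Lemma string_end d v : e v = 0 -> h v = d%:R *: v -> iter d.+1 f v = 0.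
Proof.
move=> ev hv; apply/eqP; apply: contraT => x0.
have ex : e (iter d.+1 f v) = 0 by rewrite (e_string _ ev hv) subrr mulr0 scale0r.
have := highest_weight_eigen t ex x0 (gev_eigen (h_string _ hv)).
case=> m [/eqP]; rewrite subr_eq -natrM -natrD (natr_eq char0) => /eqP E _.
by have := leq_addl m (2 * d.+1); rewrite -E mul2n -addnn leqNgt ltnS leq_addr.
Qed.

Lemma e_iter_string d i v : e v = 0 -> h v = d%:R *: v -> (i <= d)%N ->
  exists2 c, c != 0 & iter i e (iter i f v) = c *: v.
Proof.
move=> ev hv; elim: i => [|i IH] id; first by exists 1; rewrite ?oner_eq0 ?scale1r.
have [c c0 E] := IH (ltnW id).
exists (i.+1%:R * (d%:R - i%:R) * c).
  by rewrite !mulf_neq0 ?nat0 // subr_eq0 (natr_eq char0) neq_ltn id orbT.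
by rewrite iterSr (e_string _ ev hv) iter_linearZ E scalerA.
Qed.

End Triple.
End Sl2Module.

Section Sl2Structure.
Context (k : closedFieldType) (char0 : [pchar k] =i pred0).
Context (V : vectType k).
Implicit Types (e h f : {linear V -> V}) (v : V).

Let nat0 n : n.+1%:R != 0 :> k.
Proof. by rewrite ((pcharf0P k).1 char0). Qed.

Lemma gev_raise e h f c v : sl2_triple e h f -> gev h c v -> gev h (c + 2) (e v).
Proof.
case=> he _ _ [n vn]; exists n; suff -> : iter n (shiftl h (c + 2)) (e v) = e (iter n (shiftl h c) v).
  by rewrite vn linear0.
elim: n {vn} => //= n ->; rewrite {1}/shiftl he /shiftl linearBZ; lmod; ring.
Qed.

Lemma gev_iter_raise e h f c v n : sl2_triple e h f -> gev h c v ->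
  gev h (c + 2 * n%:R) (iter n e v).
Proof.
move=> t gv; elim: n => [|n IH]; first by rewrite mulr0 addr0.
rewrite (_ : _ + _ = c + 2 * n%:R + 2); [exact: (gev_raise t) | by ring].
Qed.

Lemma iter_last (g : V -> V) N v : v != 0 -> iter N g v = 0 ->
  exists M, iter M g v != 0 /\ iter M.+1 g v = 0.
Proof.
move=> v0; elim: N => [|N IH]; first by move=> /= E; rewrite E eqxx in v0.
by have [/IH|x0] := eqVneq (iter N g v) 0; last by exists N.
Qed.

(** The last non-zero e^M v is a highest weight vector of some weight d; there C has eigenvalue d (d
    + 2), and h has eigenvalue l + 2 M. *)
Lemma raise_weight e h f c l v : sl2_triple e h f -> v != 0 ->
  gev (casimir e h f) c v -> gev h l v ->
  exists d M : nat, [/\ c = d%:R * (d%:R + 2), l = d%:R - 2 * M%:R & iter M.+1 e v = 0].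
Proof.
move=> t v0 gC gh; have [N eN] := sl2_e_nilpotent char0 t.
have [M [xM eM]] := iter_last v0 (eN v).
have [d [E hx]] := highest_weight_eigen char0 t eM xM (gev_iter_raise M t gh).
exists d, M; split=> //; last by rewrite -E addrK.
have gCx : gev (casimir e h f) c (iter M e v).
  elim: (M) => //= m gm; apply: gev_comm gm => u; exact: casimir_e.
exact: gev_gev gCx (gev_eigen (casimir_highest f eM hx)) xM.
Qed.

(** The opposite triple has the same Casimir operator, so lowering v leads to the same d; comparing
    the two expressions for l gives M + M' = d. *)
Lemma joint_weight e h f c l v : sl2_triple e h f -> v != 0 ->
  gev (casimir e h f) c v -> gev h l v ->
  exists d M : nat, [/\ c = d%:R * (d%:R + 2), l = d%:R - 2 * M%:R,
    iter M.+1 e v = 0 & (M <= d)%N].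
Proof.
move=> t v0 gC gh; have [d [M [Ec El eM]]] := raise_weight t v0 gC gh.
exists d, M; split=> //.
have gC' : gev (casimir f (opp_map h) e) c v.
  case: gC => n nv; exists n; rewrite -[RHS]nv; apply: eq_iter => u.
  by case: t => he hf ef; rewrite /shiftl /= /casimir /opp_map (linearN h) ef; lmod; ring.
have gh' : gev (opp_map h) (- l) v.
  case: gh => n nv; exists n.
  suff -> : iter n (shiftl (opp_map h) (- l)) v = (-1) ^+ n *: iter n (shiftl h l) v.
    by rewrite nv scaler0.
  elim: n {nv} => [|n IH]; first by rewrite scale1r.
  by rewrite !iterS IH exprS /shiftl /= /opp_map (linearZ_LR h); lmod; ring.
have [d' [M' [Ec' El' _]]] := raise_weight (sl2_triple_opp t) v0 gC' gh'.
have dd : d = d'.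
  have /eqP : (d * (d + 2))%:R == (d' * (d' + 2))%:R :> k.
    by rewrite !natrM !natrD -Ec -Ec'.
  move/eqP; rewrite (natr_eq char0) => /eqP; nia.
have /eqP : (2 * d)%:R == (2 * (M + M'))%:R :> k.
  rewrite !natrM natrD; move: El'; rewrite El -dd => E; rewrite -subr_eq0 -oppr_eq0.
  apply/eqP; move/eqP: E; rewrite -subr_eq0 => /eqP <-; ring.
move/eqP; rewrite (natr_eq char0) => /eqP; lia.
Qed.

Lemma iter_factor (D A B : {linear V -> V}) n v : (forall u, D u = B (A u)) ->
  (forall u, A (B u) = B (A u)) -> iter n A v = 0 -> iter n D v = 0.
Proof.
move=> DE AB An; suff -> : iter n D v = iter n B (iter n A v) by rewrite An iter_linear0.
elim: n v {An} => //= n IH v; rewrite -!iterS !iterSr DE IH; congr (iter n B _).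
by rewrite iter_comm.
Qed.

(** Minus h^2 + 2 h: added to the Casimir operator it leaves 4 f e, and the two summands commute, as
    [gev_add] requires. *)
Definition weight_poly (h : V -> V) v := - (h (h v) + 2 *: h v).

Lemma weight_poly_is_linear h : linear (weight_poly h).
Proof. by move=> c u v; rewrite /weight_poly !linearP /=; lmod; ring. Qed.

HB.instance Definition _ h :=
  GRing.isLinear.Build k V V *:%R (weight_poly h) (weight_poly_is_linear h).

Definition raise_lower (e f : V -> V) v := 4 *: f (e v).

Lemma raise_lower_is_linear e f : linear (raise_lower e f).
Proof. by move=> c u v; rewrite /raise_lower !linearP /=; lmod; ring. Qed.

HB.instance Definition _ e f :=
  GRing.isLinear.Build k V V *:%R (raise_lower e f) (raise_lower_is_linear e f).

Section Triple.
Context (e h f : {linear V -> V}) (t : sl2_triple e h f).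
Let C := casimir e h f.

(** The generalised eigenvalue of 4 f e at v is d (d + 2) - l (l + 2) = 4 M (d - M + 1). It is
    non-zero, since e v != 0 forces M >= 1 and [joint_weight] gives M <= d; hence [gev_mem]
    applies. *)
Lemma lower_raise_mem c l v (S : V -> Prop) : gev C c v -> gev h l v -> e v != 0 ->
  subspace_pred S -> (forall u, S u -> S (f (e u))) -> S (f (e v)) -> S v.
Proof.
move=> gC gh ev0 sS feS Sv.
have v0 : v != 0 by apply: contraNneq ev0 => ->; rewrite linear0.
have [d [[|M] [Ec El eM Md]]] := joint_weight t v0 gC gh.
  by move: ev0; rewrite -[e v]/(iter 1 e v) eM eqxx.
have gq : gev (weight_poly h) (- (l * (l + 2))) v.
  case: gh => n hn; exists n; apply: (iter_factor (A := shiftl h l)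
      (B := opp_map (shiftl h (- l - 2)))) hn => u.
    rewrite /shiftl /= /weight_poly /opp_map /shiftl (linearB h) (linearZ_LR h); lmod; ring.
  rewrite /opp_map linearN; congr (- _); apply: shiftl_shiftl.
have gfe : gev (raise_lower e f) (c - l * (l + 2)) v.
  apply: (@gev_add _ _ _ (weight_poly h)) gC gq => u /=; rewrite /weight_poly /raise_lower.
    rewrite -!(casimir_h t) /casimir.
    rewrite !(linearN e, linearN h, linearD e, linearD h, linearZ_LR e, linearZ_LR h).
    rewrite !(linearN f, linearD f, linearZ_LR f); lmod; ring.
  by rewrite /casimir; lmod; ring.
apply: (gev_mem sS _ _ gfe) => [u Su||].
- by apply: subspaceZ => //; apply: feS.
- rewrite Ec El; have -> : d%:R * (d%:R + 2) - (d%:R - 2 * M.+1%:R) * (d%:R - 2 * M.+1%:R + 2)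
    = 4 * M.+1%:R * (d - M)%:R :> k by rewrite natrB ?(ltnW Md) //; ring.
  by rewrite !mulf_neq0 ?nat0 // ((pcharf0P k).1 char0) subn_eq0 -ltnNge.
by apply: subspaceZ.
Qed.

Lemma casimir_weight_ind (S : V -> Prop) : subspace_pred S ->
  (forall c l v, gev C c v -> gev h l v -> S v) -> forall v, S v.
Proof.
move=> sS CS v.
apply: (gev_ind (f := casimir e h f) (U := fun=> True)) => // c u _ gu.
apply: (gev_ind (f := h) (U := gev C c)) gu => //; first exact: subspace_gev.
  by move=> w; apply: gev_comm => x; exact: casimir_h.
by move=> l w; apply: CS.
Qed.

(** For the opposite of an adjoint triple this is the transversality of e + ker (ad f) to the orbit
    of e. *)
Lemma im_f_ker_e v : exists x y, e y = 0 /\ v = f x + y.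
Proof.
apply: (casimir_weight_ind (S := fun v => exists x y, e y = 0 /\ v = f x + y)).
  split; first by exists 0, 0; rewrite !linear0 addr0.
  move=> c _ _ [x [y [ey ->]]] [x' [y' [ey' ->]]].
  exists (c *: x + x'), (c *: y + y'); rewrite !linearP ey ey' scaler0 addr0.
  by split=> //; lmod; ring.
move=> c l w gC gh; have [ew|ew] := eqVneq (e w) 0.
  by exists 0, w; rewrite linear0 add0r.
have [x ->] : exists x, w = f x.
  apply: (lower_raise_mem (S := fun w => exists x, w = f x) gC gh ew).
  - split; first by exists 0; rewrite linear0.
    by move=> a _ _ [x ->] [y ->]; exists (a *: x + y); rewrite linearP.
  - by move=> u _; exists (e u).
  by exists (e w).
by exists x, 0; rewrite linear0 addr0.
Qed.

(** Induction on the power of e that kills v: e v lies in U, so does f e v, and [lower_raise_mem]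
    returns to v. *)
Lemma generated_by_ker_e (U : {vspace V}) : (forall v, v \in U -> e v \in U) ->
  (forall v, v \in U -> f v \in U) -> (forall v, e v = 0 -> v \in U) -> U = fullv.
Proof.
move=> eU fU kU; apply/eqP; rewrite eqEsubv subvf; apply/subvP => v _.
have [N eN] := sl2_e_nilpotent char0 t; move: v.
apply: casimir_weight_ind (subspace_vspace U) _ => c l v gC gh.
elim: N l v {eN}(eN v) gC gh => [|N IH] l v eN gC gh.
  by move: eN => /= ->; rewrite mem0v.
have [/kU //|ev] := eqVneq (e v) 0.
apply: (lower_raise_mem (S := fun v => v \in U) gC gh ev (subspace_vspace U)).
  by move=> u Uu; rewrite fU ?eU.
apply: fU; apply: (IH (l + 2)); first by rewrite -iterSr.
  by apply: gev_comm gC => u; exact: casimir_e.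
exact: (gev_raise t).
Qed.

(** Every vector f^i v is paired with its Casimir eigenvalue, the format of [ltr_eigenbasis]. *)
Definition string_basis (X : seq (nat * V)) : seq (k * V) :=
  flatten [seq [seq (p.1%:R * (p.1%:R + 2), iter i f p.2) | i <- iota 0 p.1.+1] | p <- X].

Lemma string_basisP X q : q \in string_basis X ->
  exists p i, [/\ p \in X, (i <= p.1)%N & q = (p.1%:R * (p.1%:R + 2), iter i f p.2)].
Proof.
move=> /flattenP[_ /mapP[p pX ->] /mapP[i]]; rewrite mem_iota add0n ltnS => ip ->.
by exists p; exists i; split.
Qed.

Lemma mem_string_basis X p i : p \in X -> (i <= p.1)%N ->
  iter i f p.2 \in unzip2 (string_basis X).
Proof.
move=> pX ip; apply/mapP; exists (p.1%:R * (p.1%:R + 2), iter i f p.2) => //.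
apply/flattenP; exists [seq (p.1%:R * (p.1%:R + 2), iter i f p.2) | i <- iota 0 p.1.+1].
  by apply/mapP; exists p.
by apply/mapP; exists i; rewrite // mem_iota add0n ltnS.
Qed.

Lemma big_string_basis X (R : nmodType) (F : k -> R) :
  \sum_(q <- string_basis X) F q.1 = \sum_(p <- X) F (p.1%:R * (p.1%:R + 2)) *+ p.1.+1.
Proof.
rewrite /string_basis big_flatten big_map; apply: eq_bigr => p _.
rewrite big_map; have sumc n m (c : R) : \sum_(j <- iota m n) c = c *+ n.
  by elim: n m => [|n IH] m; rewrite ?big_nil // big_cons mulrS IH.
transitivity (\sum_(j <- iota 0 p.1.+1) F (p.1%:R * (p.1%:R + 2))).
  exact: eq_bigr.
by rewrite sumc.
Qed.

(* Counting: e^m (resp. the image of e^m) meets ker e in at least the highest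
   weight vectors of weight >= m, because e^m f^m v is a multiple of v. *)
Lemma dim_strings (X : seq (nat * V)) : free (unzip2 X) ->
  (forall p, p \in X -> e p.2 = 0 /\ h p.2 = p.1%:R *: p.2) ->
  (\sum_(p <- X) p.1.+1 <= \dim {:V})%N.
Proof.
move=> fX XP; pose E : 'End(V) := linfun e.
pose I m := iter m (lfun_img E) fullv.
have memI m v : iter m e v \in I m.
  by elim: m => [|m IH]; rewrite ?memvf //= -(lfunE e) memv_img.
have dI m : (count (fun p => m <= p.1) X + \dim (I m.+1) <= \dim (I m))%N.
  rewrite -[leqRHS](limg_ker_dim E) leq_add2r -size_filter.
  set Xm := filter _ X.
  have fXm : free (unzip2 Xm).
    rewrite /Xm; elim: (X) fX => //= p Y IH; rewrite free_cons => /andP[pY fY].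
    case: ifP => _ /=; last exact: IH.
    rewrite free_cons IH // andbT; apply: contra pY; apply/subvP/sub_span => v.
    by case/mapP=> q; rewrite mem_filter => /andP[_ qY] ->; apply: map_f.
  rewrite -(size_map snd) -(eqP fXm); apply/dimvS/span_subvP => v /mapP[p].
  rewrite mem_filter => /andP[mp pX] ->; have [ep hp] := XP p pX.
  have [c c0 Ec] := e_iter_string char0 t ep hp mp.
  rewrite memv_cap memv_ker lfunE /= ep eqxx andbT.
  have -> : p.2 = iter m e (c^-1 *: iter m f p.2).
    by rewrite iter_linearZ Ec scalerA mulVf ?scale1r.
  exact: memI.
have dsum M : (\sum_(m < M) count (fun p => m <= p.1) X + \dim (I M) <= \dim {:V})%N.
  elim: M => [|M IH]; first by rewrite big_ord0.
  rewrite big_ord_recr /= -addnA; apply: leq_trans IH; rewrite leq_add2l; exact: dI.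
(* Any M above all the weights would do; then each p counts for p.1 + 1 values of m. *)
pose M := (\sum_(p <- X) p.1.+1)%N.
apply: leq_trans (dsum M); apply: leq_trans (leq_addr _ _).
rewrite (eq_bigr (fun m : 'I_M => \sum_(p <- X) (m <= p.1))%N); last first.
  by move=> m _; rewrite -sum1_count big_mkcond.
rewrite exchange_big /= big_seq [leqRHS]big_seq; apply: leq_sum => p pX.
have pM : (p.1.+1 <= M)%N.
  by rewrite /M (big_rem p) //= leq_addr.
rewrite -(big_mkord predT (fun m => (m <= p.1 : nat))%N) (big_cat_nat (n := p.1.+1)) //=.
apply: leq_trans (leq_addr _ _).
rewrite big_nat (eq_bigr (fun=> 1%N)) -?big_nat ?sum_nat_const_nat ?muln1 ?subn0 //.
by move=> i /andP[_]; rewrite ltnS => ->.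
Qed.

(** The strings span by [generated_by_ker_e]; by [dim_strings] there are no more vectors than the
    dimension, so they are a basis. *)
Theorem string_basis_basis (X : seq (nat * V)) : basis_of (lker (linfun e)) (unzip2 X) ->
  (forall p, p \in X -> h p.2 = p.1%:R *: p.2) -> basis_of fullv (unzip2 (string_basis X)).
Proof.
move=> bX hX; set Y := unzip2 (string_basis X).
have kerX v : e v = 0 -> v \in <<unzip2 X>>%VS.
  by move=> ev; rewrite (span_basis bX) memv_ker lfunE /= ev.
have XP p : p \in X -> e p.2 = 0 /\ h p.2 = p.1%:R *: p.2.
  move=> pX; split; last exact: hX.
  have := basis_mem bX (map_f snd pX); by rewrite memv_ker lfunE => /eqP.
have stable (g : {linear V -> V}) : (forall p i, p \in X -> (i <= p.1)%N ->
    g (iter i f p.2) \in <<Y>>%VS) -> forall v, v \in <<Y>>%VS -> g v \in <<Y>>%VS.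
  move=> gY v; have -> : g v = linfun g v by rewrite lfunE.
  move=> vY; suff : (linfun g @: <<Y>> <= <<Y>>)%VS by move/subvP; apply; apply: memv_img.
  rewrite limg_span; apply/span_subvP => _ /mapP[_ /mapP[q /string_basisP[p [i [pX ip ->]]] ->] ->].
  by rewrite lfunE; apply: gY.
have sY : <<Y>>%VS = fullv.
  apply: (generated_by_ker_e).
  - apply: stable => p [|i] pX ip; have [ep hp] := XP p pX; first by rewrite /= ep mem0v.
    rewrite (e_string t _ ep hp) memvZ // memv_span //.
    by apply: mem_string_basis => //; apply: ltnW.
  - apply: stable => p i pX; have [ep hp] := XP p pX.
    rewrite leq_eqVlt => /predU1P[->|ip]; rewrite -iterS.
      by rewrite (string_end char0 t ep hp) mem0v.
    by rewrite memv_span // mem_string_basis.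
  move=> v /kerX; apply/subvP/span_subvP => _ /mapP[p pX ->].
  by apply: memv_span; apply: (mem_string_basis (i := 0)).
rewrite basisEdim sY subvf /= size_map.
have -> : size (string_basis X) = (\sum_(p <- X) p.1.+1)%N.
  rewrite -sum1_size (big_string_basis X (fun=> 1%N)); apply: eq_bigr => p _.
  exact: natn.
apply: dim_strings => //; exact: basis_free bX.
Qed.

End Triple.

(** The last clause, for a triple and for its opposite, yields dim ker e = dim ker f: regularity
    concerns ker e, whereas the slice is made from ker f. *)
Theorem sl2_structure e h f : sl2_triple e h f -> exists X : seq (nat * V),
  [/\ basis_of (lker (linfun e)) (unzip2 X),
      forall p, p \in X -> h p.2 = p.1%:R *: p.2,
      \dim {:V} = (\sum_(p <- X) p.1.+1)%N,
      3%:R * ltr (h \o h) = (\sum_(p <- X) p.1 * p.1.+1 * p.1.+2)%:R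
    & (size X <= \dim (lker (linfun f)))%N].
Proof.
move=> t; have [N hN] := highest_weights char0 t.
have [| |X0 [bX0 X0P]] := eigen_basis (f := h) (W := lker (linfun e)) (nats_uniq char0 N).
- move=> v; rewrite !memv_ker !lfunE /= => /eqP ev.
  by case: (t) => he _ _; move: (he v); rewrite ev linear0 scaler0 addr0 => <-.
- by move=> v; rewrite memv_ker lfunE => /eqP/hN.
(* Reversed, [nats] lists 0, 1, ..., N - 1, so the index of an eigenvalue is the natural number it
   stands for. *)
pose X := [seq (index p.1 (rev (nats k N)), p.2) | p <- X0].
have X2 : unzip2 X = unzip2 X0 by rewrite /unzip2 -map_comp.
have hX p : p \in X -> h p.2 = p.1%:R *: p.2.
  move=> /mapP[q /X0P[qN hq] ->] /=; rewrite hq; congr (_ *: _).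
  move: qN; rewrite -mem_rev /nats -map_rev revK => qN.
  have := nth_index 0 qN; rewrite -index_mem size_map size_iota in qN *.
  by rewrite (nth_map 0%N) ?size_iota // nth_iota.
have bX : basis_of (lker (linfun e)) (unzip2 X) by rewrite X2.
have bY := string_basis_basis t bX hX.
have dV : \dim {:V} = (\sum_(p <- X) p.1.+1)%N.
  have /eqP := basis_free bY; rewrite (span_basis bY) => ->; rewrite size_map -sum1_size.
  rewrite (big_string_basis f X (fun=> 1%N)); apply: eq_bigr => p _.
  exact: natn.
have ek p : p \in X -> e p.2 = 0.
  by move=> pX; have := basis_mem bX (map_f snd pX); rewrite memv_ker lfunE => /eqP.
exists X; split=> //.
  rewrite -(tr_casimir t) (ltr_eigenbasis (f := casimir e h f) bY); last first.
    move=> _ /string_basisP[p [i [pX _ ->]]] /=.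
    elim: i => [|i IH] /=; first by rewrite (casimir_highest f (ek p pX) (hX p pX)).
    by rewrite (casimir_f t) IH (linearZ_LR f).
  rewrite (big_string_basis f X id) natr_sum; apply: eq_bigr => p _ /=.
  by rewrite -mulr_natr !natrM -[p.1.+2]addn2 natrD; ring.
have := limg_ker_dim (linfun f) fullv; rewrite capfv dV => dk.
have : (\dim (limg (linfun f)) <= \sum_(p <- X) p.1)%N.
  (* The image of f is spanned by the string vectors other than the highest ones, so its codimension
     is at least [size X]. *)
  pose Z := [seq iter i.+1 f p.2 | p <- X, i <- iota 0 p.1].
  have -> : (\sum_(p <- X) p.1 = size Z)%N.
    rewrite /Z size_allpairs_dep sumnE big_map; apply: eq_bigr => p _.
    by rewrite size_iota.
  apply: leq_trans (dim_span Z); apply: dimvS.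
  rewrite -(span_basis bY) limg_span; apply/span_subvP.
  move=> _ /mapP[_ /mapP[q /string_basisP[p [i [pX ip ->]]] ->] ->] /=.
  rewrite lfunE /=; move: ip; rewrite leq_eqVlt => /predU1P[->|ip]; rewrite -iterS.
    by rewrite (string_end char0 t (ek p pX) (hX p pX)) mem0v.
  apply: memv_span; apply/allpairsPdep; exists p, i; split=> //.
  by rewrite mem_iota.
move: dk; rewrite (eq_bigr (fun p => p.1 + 1)%N) ?big_split /=; last by move=> p _; rewrite addn1.
rewrite sum1_size => E le.
by rewrite -(leq_add2r (\dim (limg (linfun f)))) E addnC leq_add2r.
Qed.

End Sl2Structure.

Section SimpleModules.
Context (k : closedFieldType) (char0 : [pchar k] =i pred0).
Context (V : vectType k) (e h f : {linear V -> V}) (t : sl2_triple e h f).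

Definition stable_under (g : V -> V) (W : {vspace V}) := forall v, v \in W -> g v \in W.

Lemma stable_span (g : {linear V -> V}) (s : seq V) :
  (forall v, v \in s -> g v \in <<s>>%VS) -> stable_under g <<s>>%VS.
Proof.
move=> gs v; have -> : g v = linfun g v by rewrite lfunE.
move=> vs; suff : (linfun g @: <<s>> <= <<s>>)%VS by move/subvP; apply; apply: memv_img.
by rewrite limg_span; apply/span_subvP => _ /mapP[w ws ->]; rewrite lfunE; apply: gs.
Qed.

(** The power e^m kills f^i v for i < m but not f^m v. *)
Lemma string_free d v : v != 0 -> e v = 0 -> h v = d%:R *: v ->
  forall m, (m <= d.+1)%N -> free [seq iter i f v | i <- rev (iota 0 m)].
Proof.
move=> v0 ev hv; elim=> [|m IH] md; first exact: nil_free.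
rewrite -[m.+1]addn1 iotaD rev_cat /= free_cons IH ?(ltnW md) // andbT.
have [c c0 Em] := e_iter_string char0 t ev hv md.
apply/negP => vs; suff : linfun (iter_map m e) (iter m f v) = 0.
  by rewrite lfunE /= /iter_map Em => /eqP; rewrite scaler_eq0 (negPf c0) (negPf v0).
apply/eqP; rewrite -memv_ker; move: vs; apply/subvP/span_subvP => w /mapP[i].
rewrite mem_rev mem_iota add0n => im ->; rewrite memv_ker lfunE /= /iter_map.
have [c' _ Ei] := e_iter_string char0 t ev hv (leq_trans (ltnW im) (md : (m <= d)%N)).
rewrite (_ : m = (m - i.+1).+1 + i)%N; last by lia.
by rewrite iterD Ei iter_linearZ iterSr ev iter_linear0 scaler0.
Qed.

(** The string of a highest weight vector in W spans a submodule, hence W, and dim W then determines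
    the weight. *)
Lemma simple_casimir (W : {vspace V}) d :
  stable_under e W -> stable_under h W -> stable_under f W -> \dim W = d.+1 ->
  (forall U : {vspace V}, stable_under e U -> stable_under h U -> stable_under f U ->
     (U <= W)%VS -> U = 0%VS \/ U = W) ->
  forall v, v \in W -> casimir e h f v = (d%:R * (d%:R + 2)) *: v.
Proof.
move=> eW hW fW dW simpleW.
have [u uW u0] : exists2 u, u \in W & u != 0.
  exists (vpick W); rewrite ?memv_pick // vpick0.
  by apply/eqP => W0; move: dW; rewrite W0 dimv0.
have [N eN] := sl2_e_nilpotent char0 t.
have [M [xM eM]] := iter_last u0 (eN u).
have xW : iter M e u \in W by elim: (M) => //= m; apply: eW.
have [N' hN] := highest_weights char0 t.
have he v : h (e v) = e (h v) + 2 *: e v by case: (t).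
have [||||c [v [/(mem_nats)[d' ->] [vW ev] v0 hv]]] :=
  @eigen_in_subspace k V h (fun v => v \in W /\ e v = 0) (nats k N') (iter M e u).
- move=> c v [vW ev]; split; first by rewrite /shiftl memvB ?memvZ ?hW.
  rewrite /shiftl linearBZ ev scaler0 subr0.
  by move: (he v); rewrite ev linear0 scaler0 addr0 => <-.
- by split.
- exact: xM.
- exact: hN.
pose s := [seq iter i f v | i <- rev (iota 0 d'.+1)].
have ms i : (i <= d')%N -> iter i f v \in s.
  by move=> id; apply/mapP; exists i; rewrite // mem_rev mem_iota.
have sP w : w \in s -> exists2 i, (i <= d')%N & w = iter i f v.
  by case/mapP=> i; rewrite mem_rev mem_iota => ? ->; exists i.
have es : stable_under e <<s>>%VS.
  apply: stable_span => _ /sP[[|i] id ->]; first by rewrite /= ev mem0v.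
  by rewrite (e_string t _ ev hv) memvZ // memv_span // ms // ltnW.
have hs : stable_under h <<s>>%VS.
  by apply: stable_span => _ /sP[i id ->]; rewrite (h_string t _ hv) memvZ // memv_span // ms.
have fs : stable_under f <<s>>%VS.
  apply: stable_span => _ /sP[i id ->]; rewrite -iterS; move: id.
  rewrite leq_eqVlt => /predU1P[->|id]; first by rewrite (string_end char0 t ev hv) mem0v.
  by rewrite memv_span // ms.
have sW : (<<s>> <= W)%VS.
  by apply/span_subvP => _ /sP[i _ ->]; elim: i => //= i; apply: fW.
have [s0|Es] := simpleW _ es hs fs sW.
  by have := memv_span (ms 0%N isT); rewrite s0 memv0 /= (negPf v0).
have dd : d' = d.
  have /eqP := string_free v0 ev hv (leqnn _); rewrite -/s Es dW size_map size_rev size_iota.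
  by case.
have Cs : (<<s>> <= lker (linfun (shiftl (casimir e h f) (d%:R * (d%:R + 2)))))%VS.
  apply/span_subvP => _ /sP[i _ ->]; rewrite memv_ker lfunE /= /shiftl subr_eq0 -dd.
  apply/eqP; elim: i => [|i IH] /=; first by rewrite (casimir_highest f ev hv).
  by rewrite (casimir_f t) IH (linearZ_LR f).
move=> w; rewrite -Es => /(subvP Cs); rewrite memv_ker lfunE /= /shiftl subr_eq0.
by move/eqP.
Qed.

Theorem ltr_h2_decomposition (I : finType) (W : I -> {vspace V}) (d : I -> nat) :
  (\sum_i W i)%VS = fullv -> directv (\sum_i W i) ->
  (forall i, [/\ stable_under e (W i), stable_under h (W i), stable_under f (W i),
     \dim (W i) = (d i).+1 & forall U : {vspace V}, stable_under e U ->
       stable_under h U -> stable_under f U -> (U <= W i)%VS -> U = 0%VS \/ U = W i]) ->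
  3%:R * ltr (h \o h) = (\sum_i d i * (d i).+1 * (d i).+2)%:R :> k.
Proof.
move=> sumW dirW WP; rewrite -(tr_casimir t).
pose cd i : k := (d i)%:R * ((d i)%:R + 2).
pose Z i := [seq (cd i, v) | v <- vbasis (W i)].
pose s := \big[cat/[::]]_i Z i.
have bs : basis_of fullv (unzip2 s).
  have -> : unzip2 s = \big[cat/[::]]_i (vbasis (W i) : seq V).
    rewrite /s; elim: (index_enum I) => [|i r IH]; first by rewrite !big_nil.
    by rewrite !big_cons -IH /unzip2 map_cat /Z -[in LHS]map_comp map_id.
  by rewrite -sumW; apply: bigcat_basis => // i _; apply: vbasisP.
rewrite (ltr_eigenbasis (f := casimir e h f) bs) => [|p]; last first.
  rewrite /s => ps; suff [i /mapP[v vW ->]] : exists i, p \in Z i.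
    have [eW hW fW dW simpleW] := WP i.
    exact: (simple_casimir eW hW fW dW simpleW (vbasis_mem vW)).
  move: ps; elim/big_ind: _ => // [x y IHx IHy|i _ pZ]; last by exists i.
  by rewrite mem_cat => /orP[/IHx|/IHy].
have -> : \sum_(p <- s) p.1 = \sum_i \sum_(p <- Z i) p.1.
  rewrite /s; elim: (index_enum I) => [|i r IH]; first by rewrite !big_nil.
  by rewrite !big_cons big_cat /= IH.
rewrite natr_sum; apply: eq_bigr => i _; rewrite big_map big_const_seq count_predT.
rewrite size_tuple (let: And5 _ _ _ dW _ := WP i in dW) iter_addr_0 -mulr_natr !natrM.
by rewrite /cd -[(d i).+2]addn2 natrD; ring.
Qed.

End SimpleModules.

(** * Algebraically independent weighted homogeneous polynomials *)

Section MpolyCalculus.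
Context (k : fieldType) (N : nat).
Implicit Types (p q : {mpoly k[N]}) (i j : 'I_N).

Lemma mpoly_ring_ind (P : {mpoly k[N]} -> Prop) :
  (forall c, P c%:MP) -> (forall i, P 'X_i) ->
  (forall p q, P p -> P q -> P (p + q)) -> (forall p q, P p -> P q -> P (p * q)) ->
  forall p, P p.
Proof.
move=> PC PX PD PM p; rewrite (mpolyE p); apply: big_ind => [|p1 p2|m _]; [exact: (PC 0) | exact: PD |].
rewrite -mul_mpolyC; apply: (PM) => //; rewrite mpolyXE_id.
apply: big_ind => [|p1 p2|i _]; [exact: (PC 1) | exact: PM |].
by elim: (m i) => [|n IH]; [exact: (PC 1) | rewrite exprS; apply: PM].
Qed.

(* The chain rule, for any derivation of any commutative algebra. *)
Lemma mmap_derivation (S : comNzRingType) (iota : {rmorphism k -> S})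
    (delta : {additive S -> S}) (c : 'I_N -> S) p :
  (forall a, delta (iota a) = 0) ->
  (forall x y, delta (x * y) = delta x * y + x * delta y) ->
  delta (mmap iota c p) = \sum_i mmap iota c p^`M(i) * delta (c i).
Proof.
move=> d0 dM; elim/mpoly_ring_ind: p => [a|i|p q IHp IHq|p q IHp IHq].
- by rewrite mmapC d0 big1 // => i _; rewrite mderivC mmap0 mul0r.
- rewrite mmapX mmap1U (bigD1 i) //= big1 ?addr0 => [|j ji]; rewrite mderivX mnm1E.
    have -> : (U_(i) - U_(i) = 0)%MM by apply/mnmP => j; rewrite mnmBE subnn mnm0E.
    by rewrite eqxx mmapZ mmapX mmap11 rmorph1 !mul1r.
  by rewrite eq_sym (negPf ji) scale0r mmap0 mul0r.
- rewrite mmapD raddfD /= IHp IHq -big_split; apply: eq_bigr => i _ /=.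
  by rewrite mderivD mmapD mulrDl.
rewrite rmorphM dM IHp IHq mulr_suml mulr_sumr -big_split; apply: eq_bigr => i _ /=.
by rewrite mderivM mmapD !rmorphM /= mulrDl; ring.
Qed.

Lemma horner_mmap (c : 'I_N -> {poly k}) p t :
  (mmap polyC c p).[t] = p.@[fun i => (c i).[t]].
Proof.
elim/mpoly_ring_ind: p => [a|i|p q IHp IHq|p q IHp IHq].
- by rewrite mmapC hornerC mevalC.
- by rewrite mmapX mmap1U mevalXU.
- by rewrite mmapD hornerD IHp IHq mevalD.
by rewrite !rmorphM hornerM IHp IHq.
Qed.

Context (char0 : [pchar k] =i pred0).

Lemma poly_fun_eq0 (P : {poly k}) : (forall t, P.[t] = 0) -> P = 0.
Proof.
move=> P0; apply/eqP; apply: contraT => nz.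
pose s := [seq n%:R : k | n <- iota 0 (size P)].
have us : uniq s.
  by rewrite map_inj_uniq ?iota_uniq // => m n /eqP; rewrite (natr_eq char0) => /eqP.
have := max_poly_roots nz _ us; rewrite size_map size_iota ltnn; apply.
by apply/allP => x _; apply/rootP.
Qed.

Lemma meval_curve_const (c : 'I_N -> {poly k}) p a t0 :
  (forall t, p.@[fun i => (c i).[t]] = a) ->
  \sum_i p^`M(i).@[fun i => (c i).[t0]] * (c i)^`().[t0] = 0.
Proof.
move=> pc; have Pc : mmap polyC c p = a%:P.
  apply/eqP; rewrite -subr_eq0; apply/eqP; apply: poly_fun_eq0 => t.
  by rewrite hornerD hornerN hornerC horner_mmap pc subrr.
have := @mmap_derivation _ polyC deriv c p (fun a => derivC a) (fun x y => derivM x y).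
rewrite Pc /= derivC => /(congr1 (fun P : {poly k} => P.[t0])) /=.
rewrite horner0 horner_sum => E; rewrite [RHS]E; by apply: eq_bigr => i _; rewrite hornerM horner_mmap.
Qed.

Definition vfield (c : 'I_N -> {mpoly k[N]}) q := \sum_i c i * q^`M(i).

Lemma vfieldD c p q : vfield c (p + q) = vfield c p + vfield c q.
Proof. by rewrite -big_split; apply: eq_bigr => i _; rewrite mderivD mulrDr. Qed.

Lemma vfield0 c : vfield c 0 = 0.
Proof. by apply: big1 => i _; rewrite mderiv0 mulr0. Qed.

Lemma vfield_sum c I (r : seq I) (F : I -> {mpoly k[N]}) :
  vfield c (\sum_(i <- r) F i) = \sum_(i <- r) vfield c (F i).
Proof. exact: (big_morph _ (vfieldD c) (vfield0 c)). Qed.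

Lemma vfieldM c p q : vfield c (p * q) = vfield c p * q + p * vfield c q.
Proof.
rewrite mulr_suml mulr_sumr -big_split; apply: eq_bigr => i _ /=.
by rewrite mderivM; ring.
Qed.

Lemma vfield_coefD c d q : vfield (fun i => c i + d i) q = vfield c q + vfield d q.
Proof. by rewrite -big_split; apply: eq_bigr => i _; rewrite mulrDl. Qed.

Lemma vfield_coefZ a c q : vfield (fun i => a *: c i) q = a *: vfield c q.
Proof. by rewrite scaler_sumr; apply: eq_bigr => i _; rewrite scalerAl. Qed.

Lemma eq_vfield c d q : c =1 d -> vfield c q = vfield d q.
Proof. by move=> cd; apply: eq_bigr => i _; rewrite cd. Qed.

Lemma vfield_commutator c d q :
  vfield c (vfield d q) - vfield d (vfield c q) =
  vfield (fun j => vfield c (d j) - vfield d (c j)) q.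
Proof.
have E a b : vfield a (vfield b q) =
    \sum_j vfield a (b j) * q^`M(j) + \sum_j \sum_i b j * a i * q^`M(j)^`M(i).
  rewrite vfield_sum -big_split; apply: eq_bigr => j _ /=.
  by rewrite vfieldM; congr (_ + _); rewrite mulr_sumr; apply: eq_bigr => i _; ring.
have -> : vfield (fun j => vfield c (d j) - vfield d (c j)) q =
    \sum_j vfield c (d j) * q^`M(j) - \sum_j vfield d (c j) * q^`M(j).
  by rewrite -sumrB; apply: eq_bigr => j _; rewrite mulrBl.
rewrite !E exchange_big /= [X in _ - (_ + X)](_ : _ =
  \sum_j \sum_i d i * c j * q^`M(i)^`M(j)); first by ring.
by apply: eq_bigr => j _; apply: eq_bigr => i _; rewrite mderiv_comm; ring.
Qed.

(** Taylor's formula at x, by induction on a degree bound: the partial derivatives vanish by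
    induction, so p is a constant, and its value at x is 0. *)
Lemma derivs_eq0_bounded n x p : (forall m, (n <= mdeg m)%N -> p@_m = 0) ->
  (forall s : seq 'I_N, (foldr (fun i q => q^`M(i)) p s).@[x] = 0) -> p = 0.
Proof.
elim: n p => [|n IH] p pn px; first by apply/mpolyP => m; rewrite pn ?mcoeff0.
have dp i : p^`M(i) = 0.
  apply: IH => [m nm|s].
    by rewrite mcoeff_deriv pn ?mul0rn // mdegD mdeg1 addn1.
  by have := px (rcons s i); rewrite foldr_rcons.
suff pC : p = (p@_0%MM)%:MP by have := px [::]; rewrite /= pC mevalC => ->; rewrite mpolyC0.
apply/mpolyP => m; rewrite mcoeffC; case: eqVneq => [->|m0]; first by rewrite mulr1.
rewrite mulr0; have [i mi] : exists i, m i != 0%N.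
  apply/existsP; apply: contraNT m0; rewrite negb_exists => /forallP m0.
  by apply/eqP/mnmP => i; rewrite mnm0E; apply/eqP; have := m0 i; rewrite negbK.
have := congr1 (mcoeff (m - U_(i))%MM) (dp i).
rewrite mcoeff_deriv submK ?lep1mP // mcoeff0 mnmBE mnm1E eqxx.
rewrite -mulr_natr => /eqP; rewrite mulf_eq0 ((pcharf0P k).1 char0) orbF => /eqP -> //.
Qed.

Lemma derivs_eq0 x p :
  (forall s : seq 'I_N, (foldr (fun i q => q^`M(i)) p s).@[x] = 0) -> p = 0.
Proof.
apply: (@derivs_eq0_bounded (msize p)) => m mp.
by apply: memN_msupp_eq0; apply: msize_mdeg_ge.
Qed.

Lemma meval_line (u x : 'I_N -> k) p : (forall t, p.@[fun i => x i + t * u i] = 0) ->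
  \sum_i p^`M(i).@[x] * u i = 0.
Proof.
move=> pl; pose c i := (x i)%:P + (u i)%:P * 'X.
have cE t i : (c i).[t] = x i + t * u i.
  by rewrite /c hornerD hornerM !hornerC hornerX mulrC.
have := @meval_curve_const c p 0 0; have c0 i : (c i).[0] = x i by rewrite cE mul0r addr0.
move=> H; rewrite -[RHS]H => [|t]; last by rewrite -[RHS](pl t); apply: meval_eq => i.
apply: eq_bigr => i _; congr (_ * _); first by apply: meval_eq => j; rewrite c0.
by rewrite /c derivD derivC derivM derivC derivX mul0r !add0r mulr1 hornerC.
Qed.

Lemma meval_fun_eq0 p : (forall x, p.@[x] = 0) -> p = 0.
Proof.
move=> p0; apply: (@derivs_eq0 (fun=> 0)) => s.
suff H : forall x, (foldr (fun i q => q^`M(i)) p s).@[x] = 0 by exact: H.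
elim: s => //= i s IH x.
have := @meval_line (fun j => (i == j)%:R) x _ (fun t => IH _).
rewrite (bigD1 i) //= eqxx mulr1 big1 ?addr0 // => j; rewrite eq_sym => /negPf ->.
by rewrite mulr0.
Qed.

Lemma mcoeff_mulX_deriv i p m : ('X_i * p^`M(i))@_m = p@_m *+ m i.
Proof.
rewrite {1}(mpolyE p) linear_sum mulr_sumr raddf_sum /=.
rewrite [in RHS](mpolyE p) raddf_sum /= -sumrMnl; apply: eq_bigr => m' _.
rewrite mderivZ mderivX -!scalerAr !mcoeffZ mcoeffX.
case: (eqVneq (m' i) 0%N) => [E|nz].
  rewrite E mul0r mulr0; case: eqVneq => [<-|_]; first by rewrite E mulr0n.
  by rewrite mulr0 mul0rn.
rewrite -mpolyXD addmC submK ?lep1mP // mcoeffX; case: eqVneq => [->|_].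
  by rewrite !mulr1 mulr_natr.
by rewrite !mulr0 mul0rn.
Qed.

Lemma euler d p : p \is d.-homog -> \sum_i 'X_i * p^`M(i) = p *+ d.
Proof.
move=> hp; apply/mpolyP => m; rewrite raddf_sum /= mcoeffMn.
rewrite (eq_bigr (fun i => p@_m *+ m i)); last by move=> i _; rewrite mcoeff_mulX_deriv.
rewrite sumrMnr -mdegE; case: (eqVneq p@_m 0) => [->|]; first by rewrite !mul0rn.
by rewrite -mcoeff_msupp => /(dhomog_mf hp) ->.
Qed.

End MpolyCalculus.

Section AlgebraicDependence.
Context (k : fieldType) (n n' : nat) (F : n.-tuple {mpoly k[n']}).

Definition supported_in (J : {set 'I_n'}) (d : nat) (p : {mpoly k[n']}) :=
  forall m, m \in msupp p -> (forall j, j \notin J -> m j = 0%N) /\ (mdeg m <= d)%N.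

Lemma supported1 J : supported_in J 0 1.
Proof.
move=> m; rewrite msupp1 inE => /eqP ->; split=> [j _|]; first by rewrite mnm0E.
by rewrite mdeg0.
Qed.

Lemma supportedM J d d' p q : supported_in J d p -> supported_in J d' q ->
  supported_in J (d + d') (p * q).
Proof.
move=> Jp Jq m /msuppM_le /allpairsP[[m1 m2] /= [/Jp[z1 d1] /Jq[z2 d2] ->]]; split.
  by move=> j jJ; rewrite mnmDE z1 ?z2.
by rewrite mdegD leq_add.
Qed.

Lemma supportedX J d p e : supported_in J d p -> supported_in J (e * d) (p ^+ e).
Proof.
move=> Jp; elim: e => [|e IH]; first exact: supported1.
by rewrite exprS mulSn; apply: supportedM.
Qed.

(* Count monomials: the monomials in F_i, i in S, with exponents < K number
   K^#|S|, more than the O(K^#|J|) monomials in the variables of J available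
   for them. *)
Lemma algebraic_dependence (S : {set 'I_n}) (J : {set 'I_n'}) : (#|J| < #|S|)%N ->
  (forall i m j, i \in S -> m \in msupp (tnth F i) -> j \notin J -> m j = 0%N) ->
  exists2 q : {mpoly k[n]}, q != 0 & q \mPo F = 0.
Proof.
move=> ltJS FJ.
pose c := (\max_(i < n) msize (tnth F i))%N.
(* This K closes the count. A is formed by the exponent vectors with entries at most K that vanish
   off S, and |B| = (L+1)^|J| <= ((n c + 1) (K+1))^|J| = K (K+1)^|J| < (K+1)^|S| = |A|. *)
pose K := ((n * c).+1 ^ #|J|)%N.
pose L := (n * (K * c))%N.
have suppF i : i \in S -> supported_in J c (tnth F i).
  move=> iS m mF; split=> [j jJ|]; first exact: FJ mF jJ.
  by apply: leq_trans (ltnW (msize_mdeg_lt mF)) _; apply: leq_bigmax.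
pose A := pffun_on (ord0 : 'I_K.+1) (mem S) predT.
pose B := pffun_on (ord0 : 'I_L.+1) (mem J) predT.
pose mA (a : {ffun 'I_n -> 'I_K.+1}) : 'X_{1..n} := [multinom (a i : nat) | i < n].
pose mB (b : {ffun 'I_n' -> 'I_L.+1}) : 'X_{1..n'} := [multinom (b i : nat) | i < n'].
have cAB : (#|B| < #|A|)%N.
  rewrite !card_pffun_on !card_ord.
  have LK : (L.+1 <= (n * c).+1 * K.+1)%N by rewrite /L; nia.
  apply: (@leq_ltn_trans (((n * c).+1 * K.+1) ^ #|J|)%N); first by case: #|J| => // r; rewrite leq_exp2r.
  apply: (@leq_trans (K.+1 ^ #|J|.+1)%N); last by rewrite leq_pexp2l.
  by rewrite expnMn expnS ltn_mul2r expn_gt0 /= ltnS.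
pose M := \matrix_(i < #|A|, j < #|B|) ('X_[mA (enum_val i)] \mPo F)@_(mB (enum_val j)).
have kM0 : kermx M != 0.
  rewrite -mxrank_eq0 mxrank_ker subn_eq0 -ltnNge.
  exact: leq_ltn_trans (rank_leq_col M) cAB.
pose u := nz_row (kermx M).
have uM : u *m M = 0 by apply/sub_kermxP; apply: nz_row_sub.
have u0 : u != 0 by rewrite nz_row_eq0.
pose q := \sum_(i < #|A|) u 0 i *: 'X_[mA (enum_val i)].
exists q.
  apply: contraNneq u0 => q0; apply/eqP/rowP => i; rewrite mxE.
  have := congr1 (mcoeff (mA (enum_val i))) q0; rewrite mcoeff0 /q raddf_sum (bigD1 i) //=.
  rewrite mcoeffZ mcoeffX eqxx mulr1 big1 ?addr0 // => j ji.
  rewrite mcoeffZ mcoeffX; case: eqP => [/mnmP E|_]; last by rewrite mulr0.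
  case/eqP: ji; apply: enum_val_inj; apply/ffunP => l; apply: val_inj.
  by have := E l; rewrite !mnmE.
apply/mpolyP => m; rewrite mcoeff0 /q (linear_sum (comp_mpoly F)) raddf_sum /=.
have [/existsP[b /andP[bB /eqP Em]]|nb] := boolP [exists b, (b \in B) && (mB b == m)].
  have := congr1 (fun v : 'rV_#|B| => v 0 (enum_rank_in bB b)) uM; rewrite /= !mxE => E; rewrite -[RHS]E.
  apply: eq_bigr => i _; rewrite linearZ /= mcoeffZ; congr (_ * _).
  by rewrite mxE enum_rankK_in // Em.
apply: big1 => i _; rewrite linearZ /= mcoeffZ.
suff -> : ('X_[mA (enum_val i)] \mPo F)@_m = 0 by rewrite mulr0.
apply: memN_msupp_eq0; apply: contra nb => mX.
have /pffun_onP[/subsetP sA _] := enum_valP i.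
have supX : supported_in J L ('X_[mA (enum_val i)] \mPo F).
  rewrite comp_mpolyX /L -[X in (X * _)%N]card_ord -sum_nat_const.
  elim/big_rec2: _ => [|l d p _ IH]; first exact: supported1.
  apply: supportedM => //; rewrite mnmE.
  have [lS|lS] := boolP (l \in S).
    move=> m' /(supportedX (e := enum_val i l) (suppF l lS))[z dm]; split=> //.
    by apply: leq_trans dm _; rewrite leq_mul2r leq_ord orbT.
  have -> : (enum_val i l : nat) = 0%N.
    by apply/eqP; apply: contraNT lS => nz; apply: sA; rewrite inE -val_eqE.
  by move=> m' /(@supported1 J)[z dm]; split=> //; apply: leq_trans dm _.
have [mJ mL] := supX m mX.
have mjL j : (m j < L.+1)%N.
  by rewrite ltnS; apply: leq_trans mL; rewrite mdegE (bigD1 j) //= leq_addr.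
apply/existsP; exists [ffun j => Ordinal (mjL j)]; apply/andP; split.
  apply/pffun_onP; split=> //; apply/subsetP => j; rewrite inE ffunE -val_eqE /=.
  by apply: contraR => /mJ ->.
by apply/eqP/mnmP => j; rewrite mnmE ffunE.
Qed.

End AlgebraicDependence.

(* If the i-th smallest degree were below the i-th smallest weight, the first
   i+1 polynomials would only involve the first i variables. *)
Lemma weights_le_degrees (k : fieldType) (n : nat) (F : n.-tuple {mpoly k[n]})
    (w D : 'I_n -> nat) :
  {homo w : i j / (i <= j)%N} -> {homo D : i j / (i <= j)%N} ->
  (forall i, (0 < w i)%N) ->
  (forall i m, m \in msupp (tnth F i) -> (\sum_j w j * m j)%N = D i) ->
  (forall q : {mpoly k[n]}, q \mPo F = 0 -> q = 0) ->
  forall i, (w i <= D i)%N.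
Proof.
move=> w_mono D_mono w0 FD indep i; rewrite leqNgt; apply/negP => Dw.
have [|l m j iS mF jJ|q q0 qF] :=
    @algebraic_dependence k n n F [set l : 'I_n | (l <= i)%N] [set j : 'I_n | (j < i)%N].
- apply: proper_card; apply/properP; split.
    by apply/subsetP => j; rewrite !inE => /ltnW.
  by exists i; rewrite !inE ?leqnn ?ltnn.
- move: iS jJ; rewrite !inE -leqNgt => li ij; apply/eqP; rewrite -leqn0 leqNgt; apply/negP => mj.
  have : (w j <= D l)%N.
    by rewrite -(FD l m mF) (bigD1 j) //=; apply: leq_trans (leq_addr _ _); rewrite leq_pmulr.
  by rewrite leqNgt => /negP; apply; apply: leq_ltn_trans (D_mono _ _ li) (leq_trans Dw (w_mono _ _ ij)).
by rewrite (indep q qF) eqxx in q0.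
Qed.

Section LieIdentities.
Context (k : fieldType) (g : lieAlgType k).
Implicit Types x y z : g.

Lemma lie_is_linear x : linear (lie x).
Proof. by move=> c y z; rewrite linearPr. Qed.

HB.instance Definition _ x := GRing.isLinear.Build k g g *:%R (lie x) (lie_is_linear x).

Lemma lieDl x y z : lie (x + y) z = lie x z + lie y z.
Proof. exact: linearDl. Qed.

Lemma lieZl c x y : lie (c *: x) y = c *: lie x y.
Proof. exact: linearZl_LR. Qed.

Lemma lieNl x y : lie (- x) y = - lie x y.
Proof. exact: linearNl. Qed.

Lemma lie0l y : lie 0 y = 0.
Proof. exact: linear0l. Qed.

Lemma lieC x y : lie x y = - lie y x.
Proof.
apply/eqP; rewrite -addr_eq0; have := liexx (x + y).
by rewrite linearD /= !lieDl !liexx add0r addr0 addrC => ->.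
Qed.

Lemma lie_jacobi x y z : lie x (lie y z) = lie (lie x y) z + lie y (lie x z).
Proof.
have := jacobi x y z; rewrite -addrA => /eqP; rewrite addr_eq0 => /eqP ->.
by rewrite [lie z (lie x y)]lieC [lie z x]lieC linearN /= opprD !opprK addrC.
Qed.

End LieIdentities.

(** * Invariant polynomials and Kostant's slice *)

Section InvariantPolynomials.
Context (k : fieldType) (char0 : [pchar k] =i pred0) (g : lieAlgType k).
Local Notation N := (\dim {:g}).
Local Notation b := (vbasis {:g}).
Local Notation crd i x := (coord b i x).
Implicit Types (x y z u v : g) (p q : {mpoly k[N]}).

Lemma coord_vect (c : 'I_N -> k) i : crd i (\sum_(j < N) c j *: b`_j) = c i.
Proof. by rewrite coord_sum_free // (basis_free (vbasisP _)). Qed.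

Lemma poly_eval_eq0 p : (forall x, poly_eval p x = 0) -> p = 0.
Proof.
move=> p0; apply: (meval_fun_eq0 char0) => c; rewrite -[RHS](p0 (\sum_(j < N) c j *: b`_j)).
by apply: meval_eq => i; rewrite coord_vect.
Qed.

(* The linear form phi, as a polynomial. *)
Definition linform (phi : g -> k) : {mpoly k[N]} := \sum_(i < N) phi b`_i *: 'X_i.

Lemma linform_eval (phi : {scalar g}) x : poly_eval (linform phi) x = phi x.
Proof.
rewrite /poly_eval /linform raddf_sum /= [in RHS](coord_vbasis (memvf x)) linear_sum.
by apply: eq_bigr => i _; rewrite mevalZ mevalXU linearZ mulrC.
Qed.

(** The constant vector field u; below, [adfield x] is the linear field y -> [x, y]. Invariance of q
    under x reads [vfield (adfield x) q = 0]. *)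
Definition constfield u i : {mpoly k[N]} := (crd i u)%:MP.
Definition coordad i x y : k := crd i (lie x y).

Lemma coordad_is_linear i x : linear_for *%R (coordad i x).
Proof. by move=> c u v; rewrite /coordad !linearP. Qed.

HB.instance Definition _ i x :=
  GRing.isLinear.Build k g k *%R (coordad i x) (coordad_is_linear i x).

Definition adfield x i : {mpoly k[N]} := linform (coordad i x).

Lemma vfield_linform (c : 'I_N -> {mpoly k[N]}) phi :
  vfield c (linform phi) = \sum_(i < N) phi b`_i *: c i.
Proof.
rewrite /linform vfield_sum; apply: eq_bigr => i _.
rewrite /vfield (bigD1 i) //= big1 ?addr0 => [|j ji]; rewrite mderivZ mderivX mnm1E.
  have -> : (U_(i) - U_(i) = 0)%MM by apply/mnmP => j; rewrite mnmBE subnn mnm0E.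
  by rewrite eqxx mpolyX0 -scalerAr scale1r mulr1.
by rewrite eq_sym (negPf ji) scale0r scaler0 mulr0.
Qed.

Lemma linform_comp_ad x (phi : {scalar g}) :
  vfield (adfield x) (linform phi) = linform (fun y => phi (lie x y)).
Proof.
rewrite vfield_linform /adfield /linform.
under eq_bigr do rewrite scaler_sumr.
rewrite exchange_big; apply: eq_bigr => j _ /=.
rewrite [in RHS](coord_vbasis (memvf (lie x b`_j))) linear_sum scaler_suml.
by apply: eq_bigr => i _; rewrite scalerA linearZ mulrC.
Qed.

(** The bracket comes out reversed because linear fields act on functions contragrediently. *)
Lemma ad_ad_commutator x y q :
  vfield (adfield x) (vfield (adfield y) q) - vfield (adfield y) (vfield (adfield x) q) =
  vfield (adfield (lie y x)) q.
Proof.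
rewrite vfield_commutator; apply: eq_vfield => j.
rewrite /adfield !linform_comp_ad /linform -sumrB.
apply: eq_bigr => i _; rewrite -scalerBl /= /coordad -linearB.
by rewrite (lie_jacobi y x) addrK.
Qed.

Lemma const_ad_commutator u x q :
  vfield (constfield u) (vfield (adfield x) q) =
  vfield (adfield x) (vfield (constfield u) q) + vfield (constfield (lie x u)) q.
Proof.
apply/eqP; rewrite addrC -subr_eq vfield_commutator; apply/eqP; apply: eq_vfield => j.
rewrite {2}/constfield [X in _ - X]/vfield [X in _ - X]big1 ?subr0 => [|i _]; last first.
  by rewrite mderivC mulr0.
rewrite vfield_linform /constfield [in RHS](coord_vbasis (memvf u)) linear_sum linear_sum raddf_sum /=.
by apply: eq_bigr => i _; rewrite !linearZ /= -mul_mpolyC mulrC -mpolyCM.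
Qed.

Lemma const_comm u v q :
  vfield (constfield u) (vfield (constfield v) q) = vfield (constfield v) (vfield (constfield u) q).
Proof.
apply/eqP; rewrite -subr_eq0 vfield_commutator /vfield big1 // => j _.
by rewrite /constfield !big1 ?subrr ?mul0r // => i _; rewrite mderivC mulr0.
Qed.

Definition derivative (us : seq g) q := foldr (fun u => vfield (constfield u)) q us.

Lemma derivative_cat us vs q : derivative (us ++ vs) q = derivative us (derivative vs q).
Proof. by rewrite /derivative foldr_cat. Qed.

Lemma derivative_vfield us u q :
  derivative us (vfield (constfield u) q) = vfield (constfield u) (derivative us q).
Proof. by elim: us => //= v us ->; rewrite const_comm. Qed.

(** Moving the field of x past a derivative along u costs a derivative along [x, u]. The error terms
    keep the order of [us], one less than the order at stake in [slice_vanishing]. *)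
Lemma derivative_ad us x : exists vss : seq (seq g),
  (forall vs, vs \in vss -> size vs = size us) /\
  forall q, derivative us (vfield (adfield x) q) =
    vfield (adfield x) (derivative us q) + \sum_(vs <- vss) derivative vs q.
Proof.
elim: us => [|u us [vss [vssP IH]]].
  by exists [::]; split=> // q; rewrite big_nil addr0.
exists ((lie x u :: us) :: [seq u :: vs | vs <- vss]); split.
  by move=> vs; rewrite inE => /predU1P[-> //|/mapP[ws /vssP /= <- ->]].
move=> q; rewrite /= IH vfieldD const_ad_commutator vfield_sum -addrA.
by rewrite big_cons big_map.
Qed.

Lemma vfield_const_eval u q x :
  poly_eval (vfield (constfield u) q) x = \sum_i poly_eval q^`M(i) x * crd i u.
Proof.
rewrite /poly_eval /vfield raddf_sum /=; apply: eq_bigr => i _.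
by rewrite rmorphM /= mevalC mulrC.
Qed.

Lemma vfield_ad_eval x q y :
  poly_eval (vfield (adfield x) q) y = poly_eval (vfield (constfield (lie x y)) q) y.
Proof.
rewrite vfield_const_eval /poly_eval /vfield raddf_sum /=; apply: eq_bigr => i _.
rewrite rmorphM /= mulrC; congr (_ * _).
rewrite /adfield /linform raddf_sum /= [in RHS](coord_vbasis (memvf y)) linear_sum linear_sum.
by apply: eq_bigr => j _; rewrite mevalZ mevalXU !linearZ mulrC.
Qed.

Lemma vfield_const_add u v q :
  vfield (constfield (u + v)) q = vfield (constfield u) q + vfield (constfield v) q.
Proof.
by rewrite -vfield_coefD; apply: eq_vfield => i; rewrite /constfield linearD mpolyCD.
Qed.

Lemma poly_eval_sum (I : Type) (r : seq I) (F : I -> {mpoly k[N]}) x :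
  poly_eval (\sum_(i <- r) F i) x = \sum_(i <- r) poly_eval (F i) x.
Proof. by rewrite /poly_eval raddf_sum. Qed.

Lemma poly_evalD p q x : poly_eval (p + q) x = poly_eval p x + poly_eval q x.
Proof. by rewrite /poly_eval mevalD. Qed.

Lemma derivative_along (Z : {vspace g}) e q : (forall z, z \in Z -> poly_eval q (e + z) = 0) ->
  forall u z, u \in Z -> z \in Z -> poly_eval (vfield (constfield u) q) (e + z) = 0.
Proof.
move=> qZ u z uZ zZ; rewrite vfield_const_eval.
apply: (meval_line char0) => t; have := qZ (z + t *: u) (memvD zZ (memvZ _ uZ)).
by rewrite addrA => <-; apply: meval_eq => i; rewrite [in RHS]linearD linearZ.
Qed.

(* The slice e + Z is transversal to the orbit of e.  All derivatives of p at
   e vanish: along Z because p vanishes on the slice, and along [g, e] because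
   [x, -] p = 0 trades a derivative along [x, e] for lower order ones. *)
Lemma slice_vanishing (Z : {vspace g}) e p :
  (forall v, exists x z, z \in Z /\ v = lie x e + z) ->
  (forall x, vfield (adfield x) p = 0) ->
  (forall z, z \in Z -> poly_eval p (e + z) = 0) -> p = 0.
Proof.
move=> trans adp pZ.
have alongZ us : {subset us <= Z} -> forall z, z \in Z -> poly_eval (derivative us p) (e + z) = 0.
  elim: us => [|u us IH] usZ; first exact: pZ.
  move=> z zZ /=; apply: (derivative_along (Z := Z)) => //; last by apply: usZ; apply: mem_head.
  by apply: IH => v vus; apply: usZ; rewrite inE vus orbT.
have pe us : poly_eval (derivative us p) e = 0.
  move Es: (size us) => s; elim/ltn_ind: s us Es => s IHs us Es.
  (* The list ws collects directions in Z. A direction v = [x, e] + z leaves vs: its part z moves to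
     ws, and its part [x, e] lowers the order. *)
  suff H vs ws : {subset ws <= Z} -> (size (vs ++ ws) = s)%N ->
      poly_eval (derivative (vs ++ ws) p) e = 0.
    by rewrite -[us]cats0; apply: H => //; rewrite cats0.
  elim: vs ws => [|v vs IHv] ws wsZ Ews.
    by have := alongZ ws wsZ 0 (mem0v _); rewrite addr0.
  have [x [z [zZ ->]]] := trans v; rewrite /= vfield_const_add poly_evalD.
  have -> : poly_eval (vfield (constfield z) (derivative (vs ++ ws) p)) e = 0.
    have := IHv (z :: ws); rewrite !derivative_cat /= derivative_vfield; apply.
      by move=> w; rewrite inE => /predU1P[->|/wsZ].
    by move: Ews; rewrite !size_cat /= addnS.
  rewrite addr0 -vfield_ad_eval.
  have [vss [vssP /(_ p)]] := derivative_ad (vs ++ ws) x.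
  have d0 us' : derivative us' 0 = 0 by elim: us' => //= ? ? ->; rewrite vfield0.
  rewrite adp d0 => /eqP; rewrite eq_sym addrC addr_eq0 => /eqP E.
  have -> : vfield (adfield x) (derivative (vs ++ ws) p) = - \sum_(vs <- vss) derivative vs p.
    by rewrite E opprK.
  rewrite /poly_eval mevalN -/(poly_eval _ e) poly_eval_sum big_seq big1 ?oppr0 // => vs' /vssP sz.
  by apply: (IHs (size (vs ++ ws))) => //; rewrite -Ews.
apply: (derivs_eq0 char0) => s; have := pe [seq b`_i | i : 'I_N <- s].
rewrite /poly_eval => <-; congr meval; elim: s => //= i s ->.
rewrite /vfield (bigD1 i) //= /constfield coord_free ?(basis_free (vbasisP _)) // eqxx.
rewrite mpolyC1 mul1r big1 ?addr0 // => j ji.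
by rewrite coord_free ?(basis_free (vbasisP _)) // eq_sym (negPf ji) mpolyC0 mul0r.
Qed.

End InvariantPolynomials.

Section InfinitesimalInvariance.
Context (k : fieldType) (char0 : [pchar k] =i pred0) (g : lieAlgType k).
Local Notation N := (\dim {:g}).
Local Notation b := (vbasis {:g}).
Local Notation crd i x := (coord b i x).
Implicit Types (x y z u v : g) (p q : {mpoly k[N]}).

Lemma iter_lieZ c x n y : iter n (lie (c *: x)) y = c ^+ n *: iter n (lie x) y.
Proof.
elim: n => [|n IH]; first by rewrite scale1r.
by rewrite !iterS IH lieZl (linearZ_LR (lie x)) scalerA exprS.
Qed.

(** The curve t -> exp (t ad x) y is polynomial and p is constant along it; differentiate at t = 0.
    The bound [1 < N] ensures that the truncated exponential contains its linear term. *)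
Lemma nilpotent_kills_invariant x p : (1 < N)%N -> ad_nilpotent x -> invariant_poly p ->
  vfield (adfield x) p = 0.
Proof.
move=> N1 [n nx] ip; apply: (poly_eval_eq0 char0) => y.
rewrite vfield_ad_eval vfield_const_eval.
pose c i := \poly_(j < N) ((j`!%:R)^-1 * crd i (iter j (lie x) y)).
have cE t i : (c i).[t] = crd i (exp_ad (t *: x) y).
  rewrite horner_poly /exp_ad linear_sum; apply: eq_bigr => j _.
  by rewrite iter_lieZ !linearZ /= mulrC mulrCA mulrA.
have c0 i : (c i).[0] = crd i y.
  rewrite cE scale0r /exp_ad (bigD1 (Ordinal (ltnW N1))) //= fact0 invr1 scale1r.
  rewrite big1 ?addr0 // => -[[|j] jN] /= j0; last by rewrite lie0l scaler0.
  by [].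
have /(meval_curve_const char0 0) : forall t, p.@[fun i => (c i).[t]] = poly_eval p y.
  move=> t; rewrite -[RHS](ip (exp_ad (t *: x) \o id)).
    by apply: meval_eq => i; rewrite cE.
  apply: adjoint_exp; last exact: adjoint_id.
  by exists n => z; rewrite iter_lieZ nx scaler0.
move=> E; rewrite -[RHS]E; apply: eq_bigr => i _; congr (_ * _).
  by apply: meval_eq => j; rewrite c0.
rewrite horner_coef0 coef_deriv mulr1n coef_poly N1 /=.
by rewrite invr1 mul1r.
Qed.

Lemma adfieldP c x y q : vfield (adfield (c *: x + y)) q =
  c *: vfield (adfield x) q + vfield (adfield y) q.
Proof.
rewrite -vfield_coefZ -vfield_coefD; apply: eq_vfield => i.
rewrite /adfield /linform scaler_sumr -big_split; apply: eq_bigr => j _ /=.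
by rewrite /coordad lieDl lieZl linearD linearZ /= scalerDl scalerA.
Qed.

Definition kills_invariants x :=
  forall p : {mpoly k[N]}, invariant_poly p -> vfield (adfield x) p = 0.

Lemma kills_invariantsP c x y :
  kills_invariants x -> kills_invariants y -> kills_invariants (c *: x + y).
Proof. by move=> kx ky p ip; rewrite adfieldP kx // ky // scaler0 addr0. Qed.

Lemma kills_invariants_lie x y :
  kills_invariants x -> kills_invariants y -> kills_invariants (lie x y).
Proof.
move=> kx ky p ip; rewrite -ad_ad_commutator (kx _ ip) (ky _ ip).
by rewrite !vfield0 subrr.
Qed.

End InfinitesimalInvariance.

Lemma comp_mpolyA (R : fieldType) n1 n2 n3 (q : {mpoly R[n1]})
    (f : n1.-tuple {mpoly R[n2]}) (c : n2.-tuple {mpoly R[n3]}) :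
  (q \mPo f) \mPo c = q \mPo [tuple tnth f i \mPo c | i < n1].
Proof.
elim/mpoly_ring_ind: q => [a|i|p q IHp IHq|p q IHp IHq].
- by rewrite !comp_mpolyC.
- by rewrite !comp_mpolyXU -!tnth_nth tnth_mktuple.
- by rewrite !comp_mpolyD IHp IHq.
by rewrite !rmorphM /= IHp IHq.
Qed.

Section KostantSlice.
Context (k : fieldType) (char0 : [pchar k] =i pred0) (g : lieAlgType k).
Local Notation N := (\dim {:g}).
Local Notation b := (vbasis {:g}).
Local Notation crd i x := (coord b i x).
Context (n : nat) (e h : g) (v : 'I_n -> g) (d : 'I_n -> nat).
Hypothesis kill : forall x : g, kills_invariants x.
Hypothesis he : lie h e = 2 *: e.
Hypothesis hv : forall j, lie h (v j) = - ((d j)%:R *: v j).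

Definition slice_coord l : {mpoly k[n]} :=
  (crd l e)%:MP + \sum_j crd l (v j) *: 'X_j.

Definition slice := [tuple slice_coord l | l < N].

Lemma slice_eval (z : 'I_n -> k) l :
  (slice_coord l).@[z] = crd l (e + \sum_j z j *: v j).
Proof.
rewrite mevalD mevalC linearD linear_sum raddf_sum /=; congr (_ + _).
by apply: eq_bigr => j _; rewrite mevalZ mevalXU linearZ mulrC.
Qed.

Lemma comp_slice_eval (p : {mpoly k[N]}) z :
  (p \mPo slice).@[z] = poly_eval p (e + \sum_j z j *: v j).
Proof.
by rewrite comp_mpoly_meval; apply: meval_eq => l; rewrite tnth_mktuple slice_eval.
Qed.

Lemma deriv_slice (p : {mpoly k[N]}) j :
  (p \mPo slice)^`M(j) = \sum_l crd l (v j) *: (p^`M(l) \mPo slice).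
Proof.
have := @mmap_derivation k N {mpoly k[n]} (mpolyC n (R := k)) (mderiv j) (tnth slice) p.
move=> ->; [|by move=> c; exact: mderivC|by move=> x y; exact: mderivM].
apply: eq_bigr => l _; rewrite tnth_mktuple /slice_coord /= mderivD mderivC add0r.
rewrite linear_sum (bigD1 j) //= big1 ?addr0 => [|i ij]; rewrite mderivZ mderivX mnm1E.
  have -> : (U_(j) - U_(j) = 0)%MM by apply/mnmP => i; rewrite mnmBE subnn mnm0E.
  by rewrite eqxx mpolyX0 scale1r -scalerAr mulr1.
by rewrite (negPf ij) scale0r scaler0.
Qed.

(** At y = e + sum z_j v_j one has 2 y - [h, y] = sum (d_j + 2) z_j v_j, so twice the Euler field
    minus the field of h is tangent to the slice. It multiplies p by 2 M, since h kills p; on a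
    monomial of F it acts by the weighted degree. *)
Lemma slice_weighted_homogeneous (p : {mpoly k[N]}) M : invariant_poly p -> p \is M.-homog ->
  forall m, m \in msupp (p \mPo slice) -> (\sum_j (d j + 2) * m j)%N = (2 * M)%N.
Proof.
move=> ip hp m mF; set F := p \mPo slice in mF.
have E1 : \sum_l slice_coord l * (p^`M(l) \mPo slice) = F *+ M.
  have := congr1 (comp_mpoly slice) (euler hp); rewrite raddfMn /= raddf_sum => <-.
  apply: eq_bigr => l _.
  by rewrite /= (rmorphM (comp_mpoly slice)) /= comp_mpolyXU -tnth_nth tnth_mktuple.
have E2 : \sum_l (adfield h l \mPo slice) * (p^`M(l) \mPo slice) = 0.
  have := congr1 (comp_mpoly slice) (kill h ip); rewrite raddf0 raddf_sum => E; rewrite -[RHS]E.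
  by apply: eq_bigr => l _; rewrite /= (rmorphM (comp_mpoly slice)).
have ad_slice l : adfield h l \mPo slice =
    2 *: slice_coord l - \sum_j ((d j + 2)%:R * crd l (v j)) *: 'X_j.
  apply/eqP; rewrite -subr_eq0; apply/eqP; apply: (meval_fun_eq0 char0) => z.
  rewrite mevalB comp_slice_eval linform_eval /= /coordad mevalB mevalZ slice_eval.
  set y := e + _.
  have -> : lie h y = 2 *: y - \sum_j (z j * (d j + 2)%:R) *: v j.
    rewrite /y (linearD (lie h)) /= he (linear_sum (lie h)) scalerDr -addrA; congr (_ + _).
    rewrite scaler_sumr -sumrB; apply: eq_bigr => j _.
    by rewrite /= (linearZ_LR (lie h)) /= hv natrD; lmod; ring.
  rewrite (linearB (coord b l)) (linearZ_LR (coord b l)) (linear_sum (coord b l)).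
  rewrite (raddf_sum (meval z)) /=.
  rewrite (eq_bigr (fun j => (((d j + 2)%:R * crd l (v j)) *: 'X_j).@[z])) ?subrr //.
  by move=> j _; rewrite mevalZ mevalXU (linearZ_LR (coord b l)) /=; ring.
have E3 : \sum_j (d j + 2)%:R *: ('X_j * F^`M(j)) = F *+ (2 * M).
  rewrite mulnC mulrnA -E1 -mulr_natr.
  apply/eqP; rewrite eq_sym -subr_eq0 -[X in _ == X]E2; apply/eqP.
  under [RHS]eq_bigr do rewrite ad_slice mulrBl.
  rewrite sumrB mulr_suml; congr (_ - _).
    by apply: eq_bigr => l _; rewrite mulr_natr -scalerAl scaler_nat.
  under eq_bigr do rewrite deriv_slice mulr_sumr scaler_sumr.
  rewrite exchange_big; apply: eq_bigr => l _ /=; rewrite mulr_suml.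
  by apply: eq_bigr => j _; rewrite -scalerA -!scalerAl -scalerAr.
have := congr1 (mcoeff m) E3; rewrite raddf_sum mcoeffMn /=.
rewrite (eq_bigr (fun j => F@_m * ((d j + 2) * m j)%:R)); last first.
  by move=> j _; rewrite mcoeffZ mcoeff_mulX_deriv natrM -mulr_natr; ring.
rewrite -mulr_sumr -natr_sum -[RHS]mulr_natr.
have Fm : F@_m != 0 by rewrite -mcoeff_msupp.
by move=> E; apply/eqP; rewrite -(natr_eq char0); apply/eqP/(mulfI Fm).
Qed.

(* Kostant: the restrictions of the basic invariants to the slice e + <v_j>
   are algebraically independent and weighted homogeneous. *)
Theorem exponents_ge_weights (m : 'I_n -> nat) :
  (forall u, exists x z, z \in <<[tuple v j | j < n]>>%VS /\ u = lie x e + z) ->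
  is_exponents g m -> {homo m : i j / (i <= j)%N} -> {homo d : i j / (i <= j)%N} ->
  forall i, (d i <= 2 * m i)%N.
Proof.
move=> trans [f [finv _ findep]] m_mono d_mono i.
have homF l mm : mm \in msupp (tnth [tuple tnth f l \mPo slice | l < n] l) ->
    (\sum_j (d j + 2) * mm j)%N = (2 * (m l).+1)%N.
  rewrite tnth_mktuple; have [il hl] := finv l; exact: slice_weighted_homogeneous.
have -> : (d i <= 2 * m i)%N = (d i + 2 <= 2 * (m i).+1)%N by lia.
apply: (@weights_le_degrees k n [tuple tnth f l \mPo slice | l < n]
  (fun j => d j + 2)%N (fun j => 2 * (m j).+1)%N _ _ _ homF _ i).
- by move=> j l /d_mono; rewrite leq_add2r.
- by move=> j l /m_mono; rewrite leq_pmul2l.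
- by move=> j; rewrite addn2.
(* A relation between the restrictions is an invariant vanishing on the slice; it is zero by
   [slice_vanishing], hence is a relation between the basic invariants themselves. *)
move=> q; rewrite -comp_mpolyA => qs; apply: findep.
have iqf : invariant_poly (q \mPo f).
  move=> s gs x; rewrite /poly_eval !comp_mpoly_meval; apply: meval_eq => l.
  by have [il _] := finv l; apply: il.
apply: (@slice_vanishing _ char0 g <<[tuple v j | j < n]>>%VS e) => // [x|z]; first exact: kill.
move=> /coord_span ->; have := congr1 (meval (coord [tuple v j | j < n] ^~ z)) qs.
rewrite meval0 comp_slice_eval => E; rewrite -[RHS]E; congr (poly_eval _ (_ + _)).
by apply: eq_bigr => j _; rewrite -tnth_nth tnth_mktuple.
Qed.

End KostantSlice.

(** * Roots *)

Section CommonKernel.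
Context (k : fieldType) (V : vectType k) (n : nat) (D : 'I_n -> {linear V -> V}).

(* Engel's argument, for commuting operators nilpotent on the orbit of x. *)
Lemma common_kernel_mod (W : {vspace V}) (U : V -> Prop) :
  (forall i j v, D i (D j v) = D j (D i v)) ->
  (forall i v, v \in W -> D i v \in W) -> (forall i v, U v -> U (D i v)) ->
  (forall i v, U v -> exists N, iter N (D i) v = 0) ->
  forall x, U x -> x \notin W -> exists y, [/\ U y, y \notin W & forall i, D i y \in W].
Proof.
move=> DC DW DU Dnil x Ux xW.
suff H m : (m <= n)%N -> exists y, [/\ U y, y \notin W &
    forall i : 'I_n, (i < m)%N -> D i y \in W].
  by have [y [Uy yW yD]] := H n (leqnn n); exists y; split=> // i; apply: yD.
elim: m => [|m IH] mn; first by exists x; split.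
have [y [Uy yW yD]] := IH (ltnW mn); pose im := Ordinal mn.
have [N yN] := Dnil im y Uy.
have [M [MW MW']] : exists M, iter M (D im) y \notin W /\ iter M.+1 (D im) y \in W.
  elim: N yN => [|N IHN] yN; first by move: yN yW => /= ->; rewrite mem0v.
  have [NW|NW] := boolP (iter N (D im) y \in W); last by exists N; rewrite yN mem0v.
  elim: N NW {yN IHN} => [|N IHN] NW; first by rewrite NW in yW.
  by have [/IHN|NW'] := boolP (iter N (D im) y \in W); last by exists N.
exists (iter M (D im) y); split=> //; first by elim: (M) => //= l; apply: DU.
move=> i; rewrite ltnS leq_eqVlt => /predU1P[E|im_lt].
  by have -> : i = im by apply: val_inj.
rewrite -iter_comm //; elim: M {MW MW'} => [|M IHM] /=; first exact: yD.
exact: DW.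
Qed.

End CommonKernel.

Section Dual.
Context (k : fieldType) (V : vectType k).

Definition coordo n (X : n.-tuple V) i (v : V) : k^o := coord X i v.

Lemma coordo_is_linear n (X : n.-tuple V) i : linear (coordo X i).
Proof. by move=> c u v; rewrite /coordo linearP. Qed.

HB.instance Definition _ n (X : n.-tuple V) i :=
  GRing.isLinear.Build k V k^o *:%R (coordo X i) (coordo_is_linear X i).

Lemma dual_separates (v : V) : (forall l : 'Hom(V, k^o), l v = 0) -> v = 0.
Proof.
move=> lv; rewrite (coord_vbasis (memvf v)) big1 // => i _.
by have := lv (linfun (coordo (vbasis {:V}) i)); rewrite lfunE /= /coordo => ->; rewrite scale0r.
Qed.

Lemma span_separates (P : seq 'Hom(V, k^o)) (v : V) : <<P>>%VS = fullv ->
  (forall l, l \in P -> l v = 0) -> v = 0.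
Proof.
move=> sP Pv; apply: dual_separates => l.
have /coord_span -> : l \in <<in_tuple P>>%VS by rewrite sP memvf.
by rewrite sum_lfunE big1 // => i _; rewrite scale_lfunE Pv ?scaler0 ?mem_nth.
Qed.

End Dual.

Section Weights.
Context (k : closedFieldType) (char0 : [pchar k] =i pred0).
Context (g : lieAlgType k) (T : root_data g) (B : {biscalar g}).
Hypothesis BN : normalised_form T B.
Local Notation t := (csa T : {vspace g}).
Local Notation tT := (subvs_of t).
Implicit Types (s : tT) (a l : dual t) (x y z : g).

Let Bsym x y : B x y = B y x. Proof. by case: BN. Qed.
Let Binv x y z : B (lie x y) z = B x (lie y z). Proof. by case: BN. Qed.
Let Bnondeg x : (forall y, B x y = 0) -> x = 0. Proof. by case: BN => _ _ + _; apply. Qed.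

Lemma simple_roots_basis : basis_of fullv (simple_roots T).
Proof. by case: (simple_rootsP T). Qed.

Lemma simple_roots_separate s : (forall a, a \in simple_roots T -> a s = 0) -> s = 0.
Proof. by apply: span_separates; apply: span_basis simple_roots_basis. Qed.

(** On each root vector the bracket [s, s'] acts as a commutator of scalars, so every simple root
    vanishes on it, and the simple roots span the dual. *)
Lemma csa_abelian s s' : lie (vsval s) (vsval s') = 0.
Proof.
have zt : lie (vsval s) (vsval s') \in t by exact: (Defs.subalg_closed (subvsP s) (subvsP s')).
pose z : tT := Subvs zt.
suff -> : lie (vsval s) (vsval s') = vsval (0 : tT) by [].
rewrite -[LHS]/(vsval z); congr vsval; apply: simple_roots_separate => a aP.
have [_ /(_ a aP) [_ [x x0 xa]] _] := simple_rootsP T.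
have : lie (vsval z) x = 0.
  have -> : lie (vsval z) x = lie (vsval s) (lie (vsval s') x) - lie (vsval s') (lie (vsval s) x).
    by rewrite lie_jacobi addrK.
  by rewrite !xa !(linearZ_LR (lie _)) /= !xa; lmod; ring.
by rewrite xa => /eqP; rewrite scaler_eq0 (negPf x0) orbF => /eqP.
Qed.

Lemma csa_ad_comm s s' x : lie (vsval s) (lie (vsval s') x) = lie (vsval s') (lie (vsval s) x).
Proof. by rewrite lie_jacobi csa_abelian lie0l add0r. Qed.

(** Both notions are carried along: that generalised root vectors are honest ones is only known
    after [root_space_line]. *)
Definition wt l x := forall s, lie (vsval s) x = (l s : k) *: x.
Definition gwt l x := forall s, gev (lie (vsval s)) (l s) x.

Lemma wt_gwt l x : wt l x -> gwt l x.
Proof. by move=> xl s; exact: gev_eigen (xl s). Qed.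

Lemma subspace_gwt l : subspace_pred (gwt l).
Proof.
split=> [s|c x y gx gy s]; first by case: (subspace_gev (lie (vsval s)) (l s)).
by have [_] := subspace_gev (lie (vsval s)) (l s); apply.
Qed.

Lemma gev_lieZ c y d x : gev (lie y) d x -> gev (lie (c *: y)) (c * d) x.
Proof.
case=> n nx; exists n.
suff -> : iter n (shiftl (lie (c *: y)) (c * d)) x = c ^+ n *: iter n (shiftl (lie y) d) x.
  by rewrite nx scaler0.
elim: n {nx} => [|n IH]; first by rewrite scale1r.
rewrite !iterS IH; set u := iter n _ x.
by rewrite /shiftl (linearZ_LR (lie (c *: y))) /= lieZl exprS; lmod; ring.
Qed.

Lemma vsval_sum s : vsval s = \sum_i coord (vbasis {:tT}) i s *: vsval (vbasis {:tT})`_i.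
Proof. by rewrite {1}(coord_vbasis (memvf s)) linear_sum. Qed.

Lemma gwt_span (W : g -> Prop) : subspace_pred W ->
  (forall l x, gwt l x -> W x) -> forall x, W x.
Proof.
move=> sW gW x; pose b := vbasis {:tT}.
apply: (@joint_gev_ind k g _ (fun i => lie (vsval b`_i)) (fun=> True)) => //.
  by move=> i j u /=; rewrite csa_ad_comm.
move=> v _ /fin_all_exists[c cv].
pose l : dual t := \sum_i c i *: linfun (coordo b i).
apply: (gW l) => s.
have -> : l s = \sum_i coord b i s * c i :> k.
  rewrite /l sum_lfunE; apply: eq_bigr => i _.
  by rewrite scale_lfunE lfunE /= mulrC.
rewrite vsval_sum -/b; elim: (index_enum _) => [|i r IH].
  by rewrite !big_nil; apply: gev_eigen; rewrite /= lie0l scale0r.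
rewrite !big_cons; apply: gev_add (gev_lieZ _ (cv i)) IH => u /=; last by rewrite lieDl.
have -> : \sum_(j <- r) coord b j s *: vsval b`_j = vsval (\sum_(j <- r) coord b j s *: b`_j).
  by rewrite linear_sum.
by rewrite !lieZl csa_ad_comm (linearZ_LR (lie _)).
Qed.

Lemma gwt_lie a l x y : gwt a x -> gwt l y -> gwt (a + l) (lie x y).
Proof.
move=> gx gy s; have [m mx] := gx s; have [n ny] := gy s; exists (m + n)%N.
apply: (iter_pairing (m := @lie k g)) mx ny; try by rewrite linear0.
- exact: lie0l.
- by move=> z; rewrite linear0.
move=> u v; rewrite /= /shiftl /= lie_jacobi add_lfunE.
by rewrite (linearBZ (lie u)) lieDl lieNl lieZl; lmod; ring.
Qed.

(** By invariance of B the Leibniz rule holds with D the multiplication by -(a + l)(s); a power of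
    this non-zero scalar kills B x y. *)
Lemma gwt_orthogonal a l x y : gwt a x -> gwt l y -> a + l != 0 -> B x y = 0.
Proof.
move=> gx gy /lfunPn[s]; rewrite zero_lfunE add_lfunE => al.
have [m mx] := gx s; have [n ny] := gy s.
have : iter (m + n) ( *:%R (- (a s + l s) : k)) (B x y : k^o) = 0.
  apply: (@iter_pairing g g k^o B ( *:%R (- (a s + l s) : k)) _ _ _ _ _ _ _ _ _ _ _ mx ny);
    try by rewrite linear0.
  - by move=> z; rewrite linear0l.
  - by move=> z; rewrite linear0r.
  move=> u v /=; rewrite /shiftl /= linearBl linearBr /= linearZl_LR linearZr_LR /=.
  have -> : B (lie (vsval s) u) v = - B u (lie (vsval s) v).
    by rewrite lieC linearNl Binv.
  rewrite /GRing.scale /=; ring.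
have -> : forall p (c : k) (r : k^o), iter p ( *:%R c) r = c ^+ p * r.
  by elim=> [|p IH] c r; rewrite ?mul1r // iterS IH exprS -mulrA.
by move/eqP; rewrite mulf_eq0 expf_eq0 oppr_eq0 (negPf al) andbF => /eqP.
Qed.

(** Otherwise Engel's argument modulo t produces y outside t with [t, y] inside t, against
    self-normalisation. *)
Lemma gwt0_csa x : gwt 0 x -> x \in t.
Proof.
move=> gx; apply: contraT => xt; pose b := vbasis {:tT}.
have [y [_ /negP yt yD]] : exists y, [/\ gwt 0 y, y \notin t &
    forall i : 'I_(\dim {:tT}), lie (vsval b`_i) y \in t].
  apply: (common_kernel_mod (D := fun i : 'I_(\dim {:tT}) => lie (vsval b`_i)) _ _ _ _ gx xt).
  - by move=> i j u /=; rewrite csa_ad_comm.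
  - by move=> i v vt; exact: (Defs.subalg_closed (subvsP _) vt).
  - by move=> i v gv s; apply: gev_comm (gv s) => u /=; rewrite csa_ad_comm.
  - move=> i v /(_ b`_i)[N]; rewrite zero_lfunE => Nv; exists N; rewrite -[RHS]Nv.
    by apply: eq_iter => u; rewrite /shiftl scale0r subr0.
case: yt; have [_ norm] := csaP T; apply: norm => u ut.
rewrite lieC memvN -[u]/(vsval (Subvs ut)) vsval_sum.
rewrite (_ : lie _ y = \sum_i coord b i (Subvs ut) *: lie (vsval b`_i) y).
  by apply: memv_suml => i _; rewrite memvZ.
elim: (index_enum _) => [|i r IH]; first by rewrite !big_nil lie0l.
by rewrite !big_cons lieDl lieZl IH.
Qed.

Lemma gwt_true a x : gwt a x -> x != 0 -> exists y, y != 0 /\ wt a y.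
Proof.
move=> gx x0; pose b := vbasis {:tT}.
have x0' : x \notin 0%VS by rewrite memv0.
have [y [_ y0 yD]] : exists y, [/\ gwt a y, y \notin 0%VS &
    forall i : 'I_(\dim {:tT}), shiftl (lie (vsval b`_i)) (a b`_i) y \in 0%VS].
  apply: (common_kernel_mod
    (D := fun i : 'I_(\dim {:tT}) => shiftl (lie (vsval b`_i)) (a b`_i)) _ _ _ _ gx x0').
  - move=> i j u; apply: shiftl_comm => v; symmetry; apply: shiftl_comm => w.
    exact: csa_ad_comm.
  - by move=> i v; rewrite memv0 => /eqP ->; rewrite linear0 mem0v.
  - move=> i v gv s; apply: gev_comm (gv s) => u; symmetry; apply: shiftl_comm => w.
    exact: csa_ad_comm.
  - by move=> i v /(_ b`_i).
exists y; rewrite -memv0; split=> // s.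
rewrite vsval_sum -/b [in RHS](coord_vbasis (memvf s)) linear_sum scaler_suml.
elim: (index_enum _) => [|i r IH]; first by rewrite !big_nil lie0l.
rewrite !big_cons lieDl lieZl IH; congr (_ + _).
have := yD i; rewrite memv0 subr_eq0 => /eqP /= ->.
by rewrite (linearZ_LR a) scalerA.
Qed.

Lemma csa_nondegenerate s : (forall s', B (vsval s) (vsval s') = 0) -> s = 0.
Proof.
move=> sB; apply: val_inj => /=; apply: Bnondeg => x.
apply: (gwt_span (W := fun x => B (vsval s) x = 0)) => [|l y gy].
  by split=> [|c y z y0 z0]; rewrite ?linear0r // linearPr /= y0 z0 mulr0 addr0.
have [l0|l0] := eqVneq l 0.
  have yt : y \in t by apply: gwt0_csa; rewrite -l0.
  exact: (sB (Subvs yt)).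
apply: (gwt_orthogonal (a := 0)) gy _; last by rewrite add0r.
apply: wt_gwt => s'; by rewrite csa_abelian zero_lfunE scale0r.
Qed.

(** The functions inside [flat], named so that they carry linear structures; [flatE] identifies the
    two by conversion. *)
Definition flat_fun s s' : k^o := B (vsval s) (vsval s').

Lemma flat_fun_is_linear s : linear (flat_fun s).
Proof. by move=> c u v; exact: (linearPr B (vsval s) c (vsval u) (vsval v)). Qed.

HB.instance Definition _ s :=
  GRing.isLinear.Build k tT k^o *:%R (flat_fun s) (flat_fun_is_linear s).

Definition flat_map s : dual t := linfun (flat_fun s).

Lemma flat_map_is_linear : linear flat_map.
Proof.
move=> c u v; apply/lfunP => s; rewrite add_lfunE scale_lfunE !lfunE.
exact: (linearPl B (vsval s) c (vsval u) (vsval v)).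
Qed.

HB.instance Definition _ :=
  GRing.isLinear.Build k tT (dual t) *:%R flat_map flat_map_is_linear.

Lemma flatE s s' : flat t B s s' = B (vsval s) (vsval s').
Proof. by rewrite -[flat t B]/(linfun flat_map) lfunE /= lfunE. Qed.

Definition tv a : tT := (flat t B)^-1%VF a.

Lemma flat_ker0 : lker (flat t B) = 0%VS.
Proof.
apply/eqP; rewrite -subv0; apply/subvP => s; rewrite memv_ker memv0 => /eqP E.
by apply/eqP/csa_nondegenerate => s'; rewrite -flatE E zero_lfunE.
Qed.

Lemma flatK a : flat t B (tv a) = a.
Proof.
apply: limg_lfunVK; suff -> : limg (flat t B) = fullv by rewrite memvf.
apply/eqP; rewrite eqEdim subvf /=.
have := limg_ker_dim (flat t B) fullv; rewrite capfv flat_ker0 dimv0 add0n => ->.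
by rewrite !dimvf; change (\dim t * 1 <= \dim t)%N; rewrite muln1.
Qed.

Lemma tvE a s : B (vsval (tv a)) (vsval s) = a s.
Proof. by rewrite -flatE flatK. Qed.

Lemma dual_formE a l : dual_form B a l = a (tv l).
Proof. by rewrite -tvE. Qed.

Lemma tv_eq0 a : tv a = 0 -> a = 0.
Proof. by move=> a0; rewrite -(flatK a) a0 linear0. Qed.

Definition coroot_vector a : tT := (2 / a (tv a)) *: tv a.

Lemma opposite_gwt a x : wt a x -> x != 0 -> exists2 y, gwt (- a) y & B x y != 0.
Proof.
move=> xa x0; have [z Bz] : exists z, B x z != 0.
  have [/existsP[i Bi]|] := boolP [exists i : 'I_(\dim {:g}), B x (vbasis {:g})`_i != 0].
    by exists (vbasis {:g})`_i.
  rewrite negb_exists => /forallP B0; case/eqP: x0; apply: Bnondeg => y.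
  rewrite (coord_vbasis (memvf y)) (linear_sum (B x)) big1 // => i _.
  by have := B0 i; rewrite negbK /= linearZr_LR => /eqP /= ->; rewrite mulr0.
suff [Bz0|//] : B x z = 0 \/ exists2 y, gwt (- a) y & B x y != 0 by rewrite Bz0 eqxx in Bz.
(* The conclusion is put into the predicate as an alternative, which turns an existence claim into a
   subspace. *)
apply: (gwt_span (W := fun z => B x z = 0 \/ exists2 y, gwt (- a) y & B x y != 0)) => [|l y gy].
  split=> [|c u v [Bu|?] [Bv|?]]; [by left; rewrite linear0r| |by right|by right|by right].
  by left; rewrite linearPr /= Bu Bv mulr0 addr0.
have [E|al] := eqVneq (a + l) 0; last by left; apply: gwt_orthogonal (wt_gwt xa) gy al.
have [|Bxy] := eqVneq (B x y) 0; first by left.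
by right; exists y => //; have -> : - a = l by apply/eqP; rewrite eq_sym -addr_eq0 addrC E.
Qed.

Lemma lie_opposite a x y : wt a x -> gwt (- a) y -> lie x y = B x y *: vsval (tv a).
Proof.
move=> xa gy; have xyt : lie x y \in t.
  by apply: gwt0_csa; rewrite -(subrr a); apply: gwt_lie gy; apply: wt_gwt.
suff /eqP : Subvs xyt - B x y *: tv a = 0 by rewrite subr_eq0 => /eqP/(congr1 vsval).
apply: csa_nondegenerate => s; rewrite linearB /= linearBl /= linearZl_LR tvE.
have -> : B (lie x y) (vsval s) = a s * B x y.
  rewrite Binv [lie y _]lieC linearNr /= -Binv [lie x _]lieC linearNl opprK xa.
  by rewrite linearZl_LR.
by rewrite mulrC subrr.
Qed.

Lemma wt_lie_nilpotent a x : a != 0 -> wt a x -> exists N, forall z, iter N (lie x) z = 0.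
Proof.
move=> /lfunPn[s]; rewrite zero_lfunE => as0 xa.
apply: (weight_shift_nilpotent char0 (phi := lie (vsval s)) as0) => z /=.
by rewrite lie_jacobi xa lieZl addrC.
Qed.

(** If a (t_a) = 0, then x, t_a and a multiple of y obey the relations of [ker_spectrumP] with c =
    0, so t_a has only the eigenvalue 0 on ker (ad x). Raising a root vector of a simple root l by x
    keeps its eigenvalue l (t_a) and ends in that kernel; hence all l (t_a) vanish and a = 0. *)
Lemma root_norm_neq0 a x : a != 0 -> wt a x -> x != 0 -> a (tv a) != 0.
Proof.
move=> a0 xa x0; have [y gy Bxy] := opposite_gwt xa x0.
have [N xN] := wt_lie_nilpotent a0 xa.
apply/eqP => aa; case/eqP: a0; apply: tv_eq0; apply: simple_roots_separate => l lP.
have [_ /(_ l lP) [_ [v v0 lv]] _] := simple_rootsP T.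
have [M [wM wM']] := iter_last v0 (xN v).
have hx z : lie (vsval (tv a)) (lie x z) = lie x (lie (vsval (tv a)) z) + 0 *: lie x z.
  by rewrite lie_jacobi xa aa lieZl !scale0r addr0 add0r.
have xy z : lie x (lie ((B x y)^-1 *: y) z) = lie ((B x y)^-1 *: y) (lie x z) + lie (vsval (tv a)) z.
  rewrite lie_jacobi addrC; congr (_ + lie _ z).
  by rewrite linearZ /= (lie_opposite xa gy) scalerA mulVf ?scale1r.
have hw : lie (vsval (tv a)) (iter M (lie x) v) = l (tv a) *: iter M (lie x) v.
  elim: (M) => [|m IH]; first by rewrite /= lv.
  by rewrite iterS hx IH linearZ scale0r addr0.
have := ker_spectrumP char0 hx xy xN wM' => /(shifts_eigen0 hw wM) /mapP[i _ ->].
by rewrite !mul0r.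
Qed.

Lemma coroot_vectorE a : a (tv a) != 0 -> a (coroot_vector a) = 2 :> k.
Proof.
by move=> aa; rewrite /coroot_vector (linearZ_LR a); apply: divfK.
Qed.

(** The coroot has generalised eigenvalue -2 on the weight space of -a, but natural eigenvalues on
    ker (ad x). *)
Lemma root_ker a x y u : a != 0 -> wt a x -> x != 0 -> gwt (- a) y -> B x y != 0 ->
  gwt (- a) u -> lie x u = 0 -> u = 0.
Proof.
move=> a0 xa x0 gy Bxy gu xu; have [N xN] := wt_lie_nilpotent a0 xa.
have aa := root_norm_neq0 a0 xa x0; pose h := coroot_vector a.
have ah : a h = 2 :> k by exact: coroot_vectorE.
have hx z : lie (vsval h) (lie x z) = lie x (lie (vsval h) z) + 2 *: lie x z.
  by rewrite lie_jacobi xa ah lieZl addrC.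
pose f := (2 / a (tv a) / B x y) *: y.
have xf z : lie x (lie f z) = lie f (lie x z) + lie (vsval h) z.
  rewrite lie_jacobi addrC; congr (_ + lie _ z).
  by rewrite /f linearZ /= (lie_opposite xa gy) scalerA mulfVK.
apply: (gev_shifts0 (gu h) (ker_spectrumP char0 hx xf xN xu)).
rewrite opp_lfunE ah; apply/mapP => -[i _ E].
have : (2 + i)%:R == 0 :> k.
  rewrite natrD -[X in _ + X](mulKf (_ : (2 : k) != 0)) ?((pcharf0P k).1 char0) //.
  by rewrite mulrC -E subrr.
by rewrite ((pcharf0P k).1 char0).
Qed.

(** By [lie_opposite] and [root_ker], ad x maps the weight space of -a injectively into the line of
    t_a. That space is thus a line stable under t, so y is an honest weight vector; exchanging x and
    y gives the rest. *)
Lemma root_space_line a x : a != 0 -> wt a x -> x != 0 ->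
  (exists y, [/\ wt (- a) y, y != 0 & B x y != 0]) /\
  forall u, gwt a u -> exists c, u = c *: x.
Proof.
move=> a0 xa x0; have [y gy Bxy] := opposite_gwt xa x0.
have line u : gwt (- a) u -> u = (B x u / B x y) *: y.
  move=> gu; apply/eqP; rewrite -subr_eq0; apply/eqP.
  have sg := subspace_gwt (- a).
  apply: (root_ker a0 xa x0 gy Bxy).
    exact: subspaceB sg gu (subspaceZ _ sg gy).
  rewrite linearB linearZ /= !(lie_opposite xa) // scalerA -mulrA mulVf // mulr1.
  by rewrite subrr.
have y0 : y != 0 by apply: contraNneq Bxy => ->; rewrite linear0r.
have ya : wt (- a) y.
  move=> s; have gsy : gwt (- a) (lie (vsval s) y).
    by move=> s'; apply: gev_comm (gy s') => u; exact: csa_ad_comm.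
  move: (line _ gsy); set c := _ / _ => E.
  by rewrite E (gev_gev (@gev_eigen _ _ (lie (vsval s)) c y E) (gy s) y0).
split; first by exists y.
move=> u gu.
have Byx : B y x != 0 by rewrite Bsym.
have na : - a != 0 by rewrite oppr_eq0.
exists (B y u / B y x); apply/eqP; rewrite -subr_eq0; apply/eqP.
have sg := subspace_gwt a; have gx := wt_gwt xa.
apply: (root_ker na ya y0 (y := x)); rewrite ?opprK //.
  exact: subspaceB sg gu (subspaceZ _ sg gx).
rewrite linearB linearZ /= !(lie_opposite ya) ?opprK // scalerA -mulrA mulVf // mulr1.
by rewrite subrr.
Qed.

End Weights.

Lemma seq_choice (A : eqType) (C : Type) (Q : A -> C -> Prop) (s : seq A) (c0 : C) :
  (forall a, a \in s -> exists c, Q a c) -> exists f, forall a, a \in s -> Q a (f a).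
Proof.
elim: s => [|a s IH] H; first by exists (fun=> c0).
have [b bs|f fP] := IH; first by apply: H; rewrite inE bs orbT.
have [c ac] := H a (mem_head _ _).
exists (fun b => if b == a then c else f b) => b; rewrite inE.
by case: eqP => [-> _|_ /= /fP].
Qed.

Lemma span_ind (k : fieldType) (V : vectType k) (s : seq V) (W : V -> Prop) :
  subspace_pred W -> (forall x, x \in s -> W x) -> forall v, v \in <<s>>%VS -> W v.
Proof.
move=> sW Ws v vs; have /coord_span -> : v \in <<in_tuple s>>%VS by [].
by apply: subspace_sum => // i _; apply: subspaceZ => //; apply: Ws; apply: mem_nth.
Qed.

Section LieTriples.
Context (k : closedFieldType) (g : lieAlgType k).

Definition lie_triple (e h f : g) :=
  [/\ lie h e = 2 *: e, lie h f = - (2 *: f) & lie e f = h].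

Lemma lie_triple_sl2 e h f : lie_triple e h f -> sl2_triple (lie e) (lie h) (lie f).
Proof.
case=> he hf ef; split=> v.
- by rewrite lie_jacobi he lieZl addrC.
- by rewrite lie_jacobi hf lieNl lieZl addrC.
by rewrite lie_jacobi ef addrC.
Qed.

Lemma lie_triple_opp e h f : lie_triple e h f -> lie_triple f (- h) e.
Proof.
case=> he hf ef; split; first by rewrite lieNl hf opprK.
  by rewrite lieNl he.
by rewrite lieC ef.
Qed.

End LieTriples.

Section Roots.
Context (k : closedFieldType) (char0 : [pchar k] =i pred0).
Context (g : lieAlgType k) (T : root_data g) (B : {biscalar g}).
Hypothesis BN : normalised_form T B.
Local Notation t := (csa T : {vspace g}).
Local Notation tT := (subvs_of t).
Local Notation NN := (nonneg_comb (simple_roots T)).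
Local Notation tv := (tv B).
Implicit Types (s : tT) (a l : dual t) (x y z : g).

Lemma nonneg_combD a l : NN a -> NN l -> NN (a + l).
Proof.
case=> c -> [d ->]; exists (fun i => c i + d i)%N; rewrite -big_split.
by apply: eq_bigr => i _ /=; rewrite mulrnDr.
Qed.

Lemma nonneg_comb_anti a : NN a -> NN (- a) -> a = 0.
Proof.
case=> c Ec [d Ed].
have /freeP fP : free (in_tuple (simple_roots T)) by apply: basis_free (simple_roots_basis T).
have E : \sum_(i < size (simple_roots T)) (c i + d i)%:R *: (in_tuple (simple_roots T))`_i = 0.
  rewrite (eq_bigr (fun i : 'I_(size (simple_roots T)) =>
    nth 0 (simple_roots T) i *+ c i + nth 0 (simple_roots T) i *+ d i)).
    by rewrite big_split /= -Ec -Ed subrr.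
  by move=> i _; rewrite scaler_nat mulrnDr.
rewrite Ec big1 // => i _.
by have /eqP := fP _ E i; rewrite ((pcharf0P k).1 char0) addn_eq0 => /andP[/eqP-> _].
Qed.

Definition roots := positive_roots T ++ [seq - a | a <- positive_roots T].

Lemma is_root_opp a : is_root a -> is_root (- a).
Proof.
case=> a0 [x x0 xa]; have [[y [ya y0 _]] _] := root_space_line char0 BN a0 xa x0.
by split; [rewrite oppr_eq0 | exists y].
Qed.

Lemma mem_roots a : a \in roots <-> is_root a.
Proof.
rewrite mem_cat; split=> [/orP[/positive_rootsP[]//|/mapP[b /positive_rootsP[rb _] ->]]|ra].
  exact: is_root_opp.
have [_ _ /(_ a ra)[pa|na]] := simple_rootsP T.
  by have -> : a \in positive_roots T by apply/positive_rootsP.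
rewrite orbC; have -> // : a \in [seq - b | b <- positive_roots T].
rewrite -[a]opprK map_f //; apply/positive_rootsP; split=> //; exact: is_root_opp.
Qed.

Lemma roots_uniq : uniq roots.
Proof.
rewrite cat_uniq positive_roots_uniq map_inj_uniq ?positive_roots_uniq ?andbT /=; last exact: oppr_inj.
apply/hasPn => _ /mapP[a /positive_rootsP[[a0 _] pa] ->]; apply/negP => /positive_rootsP[_ na].
by case/eqP: a0; apply: nonneg_comb_anti.
Qed.

Lemma root_vectors : exists X : dual t -> g, forall a, a \in roots -> wt a (X a) /\ X a != 0.
Proof.
apply: (@seq_choice _ _ (fun (a : dual t) x => wt a x /\ x != 0)) => [|a /mem_roots[_ [x x0 xa]]].
  exact: 0.
by exists x.
Qed.

Lemma gwt_root a x : a != 0 -> gwt a x -> x != 0 -> is_root a.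
Proof. by move=> a0 gx x0; split=> //; have [y [y0 ya]] := gwt_true gx x0; exists y. Qed.

(** Independence is read off from B: it is non-degenerate on t, t is orthogonal to the root vectors,
    and a vector of weight -a detects X a among them. *)
Lemma root_basis (X : dual t -> g) :
  (forall a, a \in roots -> wt a (X a) /\ X a != 0) ->
  basis_of fullv (vbasis t ++ [seq X a | a <- roots]).
Proof.
move=> XP; rewrite /basis_of cat_free; apply/andP; split.
  apply/eqP/vspaceP => x; rewrite memvf; apply: (gwt_span (W := fun x => x \in _)).
    exact: subspace_vspace.
  move=> l y gy; rewrite span_cat (span_basis (vbasisP t)).
  have [l0|l0] := eqVneq l 0.
    by apply: (subvP (addvSl _ _)); apply: gwt0_csa; rewrite -l0.
  have [->|y0] := eqVneq y 0; first exact: mem0v.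
  have lR : l \in roots by apply/mem_roots; apply: gwt_root gy y0.
  have [Xl X0] := XP l lR; have [_ /(_ y gy)[c ->]] := root_space_line char0 BN l0 Xl X0.
  by apply: (subvP (addvSr _ _)); rewrite memvZ // memv_span // map_f.
have tX s v : v \in <<[seq X a | a <- roots]>>%VS -> B (vsval s) v = 0.
  apply: (span_ind (W := fun v => B (vsval s) v = 0)).
    by split=> [|c u w u0 w0]; rewrite ?linear0r // linearPr /= u0 w0 mulr0 addr0.
  move=> _ /mapP[a aR ->]; have [Xa _] := XP a aR; have [a0 _] := (mem_roots a).1 aR.
  apply: (gwt_orthogonal BN (a := 0) (l := a)); rewrite ?add0r //; last exact: wt_gwt.
  by apply: wt_gwt => s'; rewrite csa_abelian zero_lfunE scale0r.
rewrite (basis_free (vbasisP t)) /=; apply/andP; split; last first.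
  apply/directv_addP/eqP; rewrite -subv0; apply/subvP => v.
  rewrite memv_cap (span_basis (vbasisP t)) memv0 => /andP[vt vX].
  suff : Subvs vt = 0 by move/(congr1 vsval) => /= ->.
  by apply: (csa_nondegenerate BN) => s; case: (BN) => -> _ _ _; apply: tX.
have : uniq roots := roots_uniq.
have : {subset roots <= roots} by [].
elim: {1 3 4}roots => [|a r IH] rR /=; first by rewrite nil_free.
move=> /andP[ar ur]; rewrite free_cons IH // ?andbT; last by move=> b br; rewrite rR // inE br orbT.
have aR : a \in roots by rewrite rR // mem_head.
have [Xa Xa0] := XP a aR; have [a0 _] := (mem_roots a).1 aR.
have [[y [ya y0 By]] _] := root_space_line char0 BN a0 Xa Xa0.
apply/negP => Xar; case/eqP: By.
apply: (span_ind (W := fun v => B v y = 0)) Xar.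
  by split=> [|c u w u0 w0]; rewrite ?linear0l // linearPl /= u0 w0 mulr0 addr0.
move=> _ /mapP[b br ->]; have bR : b \in roots by rewrite rR // inE br orbT.
have [Xb _] := XP b bR; apply: (gwt_orthogonal BN (wt_gwt Xb) (wt_gwt ya)).
by rewrite subr_eq0; apply: contraNneq ar => <-.
Qed.

Lemma ltr_ad_csa s : ltr (lie (vsval s) \o lie (vsval s)) =
  2 * \sum_(a <- positive_roots T) (a s : k) ^+ 2.
Proof.
have [X XP] := root_vectors; have bX := root_basis XP.
pose z := [seq (0 : k, v) | v <- vbasis t] ++ [seq ((a s : k) ^+ 2, X a) | a <- roots].
have z2 : unzip2 z = vbasis t ++ [seq X a | a <- roots].
  by rewrite /unzip2 map_cat -!map_comp map_id.
rewrite (ltr_eigenbasis (f := lie (vsval s) \o lie (vsval s)) (s := z)) ?z2 //; last first.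
  move=> p; rewrite mem_cat => /orP[/mapP[v /vbasis_mem vt ->]|/mapP[a aR ->]] /=.
    by rewrite -[v]/(vsval (Subvs vt)) csa_abelian linear0 scale0r.
  by have [Xa _] := XP a aR; rewrite Xa (linearZ_LR (lie _)) /= Xa scalerA.
rewrite big_cat !big_map /= big1 ?add0r // /roots big_cat big_map /=.
by rewrite mulr_natl mulr2n; congr (_ + _); apply: eq_bigr => a _; rewrite opp_lfunE sqrrN.
Qed.

Lemma root_triple a : is_root a -> exists x f, [/\ wt a x, wt (- a) f, x != 0 &
  lie_triple x (vsval (coroot_vector B a)) f].
Proof.
case=> a0 [x x0 xa]; have [[y [ya y0 Bxy]] _] := root_space_line char0 BN a0 xa x0.
have aa := root_norm_neq0 char0 BN a0 xa x0; have ah := coroot_vectorE aa.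
have fa : wt (- a) ((2 / a (tv a) / B x y) *: y).
  by move=> s; rewrite (linearZ_LR (lie (vsval s))) /= ya !scalerA mulrC.
exists x, ((2 / a (tv a) / B x y) *: y); split=> //; split.
- by rewrite xa ah.
- by rewrite fa opp_lfunE ah scaleNr.
by rewrite (linearZ_LR (lie x)) /= (lie_opposite BN xa (wt_gwt ya)) scalerA mulfVK.
Qed.

Local Notation theta := (highest_root T).
Local Notation htheta := (coroot_vector B theta).

Lemma theta_root : is_root theta. Proof. by case: (highest_rootP T). Qed.

Lemma theta_max a : is_root a -> NN (theta - a).
Proof. by case: (highest_rootP T) => _; apply. Qed.

Lemma theta_pos : NN theta.
Proof.
have [_ _ /(_ _ theta_root)[//|nt]] := simple_rootsP T.
have /theta_max := is_root_opp theta_root; rewrite opprK => tt.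
by have := nonneg_combD tt nt; rewrite -addrA subrr addr0.
Qed.

Lemma htheta_theta : theta htheta = 2 :> k.
Proof.
have [t0 [x x0 xa]] := theta_root.
exact: coroot_vectorE (root_norm_neq0 char0 BN t0 xa x0).
Qed.

(* theta - (theta + a) and theta - (2 theta - a) would have to be nonnegative
   combinations. *)
Lemma theta_string a : a \in positive_roots T -> a != theta ->
  (a htheta : k) ^+ 2 = a htheta.
Proof.
move=> /positive_rootsP[ra pa] a_theta; have [a0 [v v0 va]] := ra.
have [x [f [xt ft x0 tr]]] := root_triple theta_root.
have sl := lie_triple_sl2 tr.
have xv : lie x v = 0.
  apply/eqP; apply: contraT => xv0.
  have gxv : gwt (theta + a) (lie x v) by apply: gwt_lie; apply: wt_gwt.
  have [E|ta0] := eqVneq (theta + a) 0.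
    have Ea : a = - theta by apply/eqP; rewrite -addr_eq0 addrC E.
    by case/eqP: (a0); rewrite Ea (nonneg_comb_anti theta_pos) ?oppr0 // -Ea.
  have := theta_max (gwt_root ta0 gxv xv0); rewrite opprD addrA subrr add0r => na.
  by rewrite (nonneg_comb_anti pa na) eqxx in a0.
(* Since [x, v] = 0, the number a (h_theta) is a natural weight d. The values 0 and 1 satisfy the
   equation; for d >= 2 the vector f^2 v is non-zero of weight a - 2 theta. *)
have [d [Ed hv]] := highest_weight_eigen char0 sl xv v0 (wt_gwt va htheta).
case: d Ed hv => [|[|d]] Ed hv; rewrite Ed ?expr1n ?expr0n //.
have fn i : (i <= d.+2)%N -> iter i (lie f) v != 0.
  move=> /(e_iter_string char0 sl xv hv)[c c0 E].
  by apply: contraNneq v0 => f0; move/eqP: E; rewrite f0 iter_linear0 eq_sym scaler_eq0 (negPf c0).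
have f2 : lie f (lie f v) != 0 by apply: (fn 2%N).
have gf : gwt (- theta + (- theta + a)) (lie f (lie f v)).
  by do 2!(apply: gwt_lie; first exact: wt_gwt); apply: wt_gwt.
have Ew : - theta + (- theta + a) = - (theta + theta - a) by rewrite opprB !addrA addrC opprD addrA.
rewrite Ew in gf.
have [E|w0] := eqVneq (theta + theta - a) 0.
  have Ea : a = theta + theta by apply/eqP; rewrite eq_sym -subr_eq0 E.
  have := theta_max ra; rewrite Ea opprD addrA subrr add0r => nt.
  by have [/eqP[]] := theta_root; apply: nonneg_comb_anti theta_pos nt.
have rw : is_root (theta + theta - a).
  by rewrite -[_ - a]opprK; apply: is_root_opp; apply: gwt_root gf f2; rewrite oppr_eq0.
have := theta_max rw; have -> : theta - (theta + theta - a) = - (theta - a) by lmod; ring.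
by move=> /(nonneg_comb_anti (theta_max ra)) /eqP; rewrite subr_eq0 eq_sym (negPf a_theta).
Qed.

Lemma tv_theta : tv theta = htheta.
Proof.
have tt : theta (tv theta) = 2 :> k by rewrite -(dual_formE BN); case: BN.
by rewrite /coroot_vector tt divff ?scale1r // ((pcharf0P k).1 char0).
Qed.

Lemma dual_coxeterE : dual_coxeter_number T B = 1 + (rho T htheta : k).
Proof.
have tt : dual_form B theta theta = 2 by case: BN.
rewrite /dual_coxeter_number /coroot tt divff ?((pcharf0P k).1 char0) // scale1r.
by rewrite (dual_formE BN) -/(tv theta) tv_theta.
Qed.

Lemma form_htheta : B (vsval htheta) (vsval htheta) = 2.
Proof. by rewrite -{1}tv_theta (tvE BN) htheta_theta. Qed.

(** By [theta_string] squares may be dropped except at theta, where 4 stands for 2. Over the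
    positive roots the sum is 2 + 2 rho (h_theta), twice the dual Coxeter number; the negative roots
    double it. *)
Lemma ltr_ad_htheta : ltr (lie (vsval htheta) \o lie (vsval htheta)) =
  4 * dual_coxeter_number T B.
Proof.
have two : (2 : k) != 0 by rewrite ((pcharf0P k).1 char0).
rewrite ltr_ad_csa dual_coxeterE /rho scale_lfunE sum_lfunE /GRing.scale /=.
have tP : theta \in positive_roots T.
  by apply/positive_rootsP; split; [exact: theta_root | exact: theta_pos].
rewrite !(big_rem theta tP) /= htheta_theta (eq_big_seq (fun a : dual t => a htheta : k)); last first.
  move=> a; rewrite mem_rem_uniq ?positive_roots_uniq // inE => /andP[at' aP].
  exact: theta_string.
by field.
Qed.

End Roots.

(** * The Killing form *)

Section Killing.
Context (k : closedFieldType) (g : lieAlgType k).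
Implicit Types (x y z : g).

Definition killing x y := ltr (lie x \o lie y).

Lemma killingC x y : killing x y = killing y x.
Proof. exact: ltrC. Qed.

Lemma killing_linearl c x y z : killing (c *: x + y) z = c * killing x z + killing y z.
Proof.
rewrite -ltrZ -ltrD; apply: eq_ltr => v /=.
by rewrite lieDl lieZl.
Qed.

Lemma killing_inv x y z : killing (lie x y) z = killing x (lie y z).
Proof.
have -> : killing (lie x y) z =
    ltr (fun v => lie x (lie y (lie z v)) + (-1) *: lie y ((lie x \o lie z) v)).
  apply: eq_ltr => v /=; rewrite scaleN1r (lie_jacobi x y); lmod; ring.
have -> : killing x (lie y z) =
    ltr (fun v => lie x (lie y (lie z v)) + (-1) *: (lie x \o lie z) (lie y v)).
  apply: eq_ltr => v /=; rewrite scaleN1r -linearB /=; congr lie.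
  by rewrite (lie_jacobi y z) addrK.
rewrite !ltrD !ltrZ; congr (_ + _ * _).
exact: (ltrC (lie y) (lie x \o lie z)).
Qed.

Definition killing_row x y : k^o := killing x y.

Lemma killing_row_is_linear x : linear (killing_row x).
Proof. by move=> c u v; rewrite /killing_row ![killing x _]killingC killing_linearl. Qed.

HB.instance Definition _ x :=
  GRing.isLinear.Build k g k^o *:%R (killing_row x) (killing_row_is_linear x).

Definition killing_flat x : 'Hom(g, k^o) := linfun (killing_row x).

Lemma killing_flat_is_linear : linear killing_flat.
Proof.
move=> c u v; apply/lfunP => y; rewrite add_lfunE scale_lfunE !lfunE.
exact: killing_linearl.
Qed.

HB.instance Definition _ :=
  GRing.isLinear.Build k g 'Hom(g, k^o) *:%R killing_flat killing_flat_is_linear.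

Context (B : {biscalar g}).

Definition form_row x y : k^o := B x y.

Lemma form_row_is_linear x : linear (form_row x).
Proof. by move=> c u v; exact: (linearPr B x c u v). Qed.

HB.instance Definition _ x :=
  GRing.isLinear.Build k g k^o *:%R (form_row x) (form_row_is_linear x).

Definition form_flat x : 'Hom(g, k^o) := linfun (form_row x).

Lemma form_flat_is_linear : linear form_flat.
Proof.
move=> c u v; apply/lfunP => y; rewrite add_lfunE scale_lfunE !lfunE.
exact: (linearPl B y c u v).
Qed.

HB.instance Definition _ :=
  GRing.isLinear.Build k g 'Hom(g, k^o) *:%R form_flat form_flat_is_linear.

Hypothesis Bsym : forall x y, B x y = B y x.
Hypothesis Binv : forall x y z, B (lie x y) z = B x (lie y z).
Hypothesis Bnondeg : forall x, (forall y, B x y = 0) -> x = 0.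

(* An eigenspace of the operator turning B into the Killing form is an ideal. *)
Lemma killing_proportional : simple_lie g -> exists c, forall x y, killing x y = c * B x y.
Proof.
case=> -[x0 [y0 xy0]] g_simple; pose b := linfun form_flat.
have b0 : lker b = 0%VS.
  apply/eqP; rewrite -subv0; apply/subvP => x; rewrite memv_ker memv0 lfunE /= => /eqP Bx.
  apply/eqP/Bnondeg => y; have := congr1 (fun l : 'Hom(g, k^o) => l y) Bx.
  by rewrite lfunE zero_lfunE.
have bf : limg b = fullv.
  apply/eqP; rewrite eqEdim subvf /=.
  have := limg_ker_dim b fullv; rewrite capfv b0 dimv0 add0n => ->.
  by rewrite !dimvf; change (dim g * 1 <= dim g)%N; rewrite muln1.
pose phi := linfun ((b^-1)%VF \o killing_flat).
have phiE x : phi x = (b^-1)%VF (killing_flat x) by rewrite /phi lfunE.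
have bphi x : b (phi x) = killing_flat x by rewrite phiE limg_lfunVK // bf memvf.
have [s sP] := shifts_annihilator phi.
have x00 : x0 != 0 by apply: contraNneq xy0 => ->; rewrite lie0l.
have [//|//|c [x [_ _ nx Ex]]] := @eigen_in_subspace k g phi (fun=> True) s x0 _ _ x00 (sP x0).
exists c; pose I := lker (linfun killing_flat - c *: b).
have IP z : (z \in I) <-> (forall y, killing z y = c * B z y).
  split=> [|H]; rewrite memv_ker add_lfunE opp_lfunE scale_lfunE !lfunE /= subr_eq0.
    move=> /eqP E y; have := congr1 (fun l : 'Hom(g, k^o) => l y) E.
    by rewrite scale_lfunE !lfunE.
  apply/eqP/lfunP => y; rewrite scale_lfunE !lfunE; exact: H.
have II : forall y z, z \in I -> lie y z \in I.
  move=> y z /IP zI; apply/IP => w.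
  have kN u v : killing (- u) v = - killing u v.
    by rewrite -mulN1r -ltrZ; apply: eq_ltr => a /=; rewrite lieNl scaleN1r.
  by rewrite lieC kN killing_inv zI -Binv linearNl mulrN.
have xI : x \in I.
  apply/IP => y; have := congr1 (fun l : 'Hom(g, k^o) => l y) (bphi x).
  have bE : b x y = form_row x y by rewrite /b lfunE /= lfunE.
  by rewrite Ex (linearZ_LR b) scale_lfunE lfunE bE => E; symmetry; exact: E.
have [I0|If] := g_simple I II; first by move: xI; rewrite I0 memv0 (negPf nx).
by move=> u v; apply: (IP u).1; rewrite If memvf.
Qed.

End Killing.

(** * Subalgebras isomorphic to sl_2 *)

Section Sl2Algebra.
Context (k : fieldType) (char0 : [pchar k] =i pred0) (s : lieAlgType k) (e h f : s).
Hypothesis bs : basis_of fullv [:: e; h; f].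
Hypothesis he : lie h e = 2 *: e.
Hypothesis hf : lie h f = - (2 *: f).
Hypothesis ef : lie e f = h.

Let two : (2 : k) != 0. Proof. by rewrite ((pcharf0P k).1 char0). Qed.

Definition comb3 a b c := a *: e + b *: h + c *: f.

Lemma comb3_exists x : exists a b c, x = comb3 a b c.
Proof.
have /coord_span E : x \in <<[tuple e; h; f]>>%VS by rewrite (span_basis bs) memvf.
exists (coord [tuple e; h; f] 0 x), (coord [tuple e; h; f] 1 x), (coord [tuple e; h; f] 2 x).
by rewrite {1}E !big_ord_recl big_ord0 addr0 addrA; congr (_ *: _ + _ *: _ + _ *: _);
  congr coord; apply: val_inj.
Qed.

Lemma comb3_eq0 a b c : comb3 a b c = 0 -> [/\ a = 0, b = 0 & c = 0].
Proof.
move=> E; have /freeP fr : free [tuple e; h; f] by exact: basis_free bs.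
pose l (i : 'I_3) := nth 0 [:: a; b; c] i.
have /fr l0 : \sum_(i < 3) l i *: [tuple e; h; f]`_i = 0.
  by rewrite !big_ord_recl big_ord0 addr0 addrA.
by split; [have := l0 0 | have := l0 1 | have := l0 2].
Qed.

Lemma comb3_lie a b c p q r : lie (comb3 a b c) (comb3 p q r) =
  comb3 (2 * (b * p - a * q)) (a * r - c * p) (2 * (c * q - b * r)).
Proof.
have eh : lie e h = - (2 *: e) by rewrite lieC he.
have fh : lie f h = 2 *: f by rewrite lieC hf opprK.
have fe : lie f e = - h by rewrite lieC ef.
rewrite /comb3 !lieDl !lieZl.
have lin z : lie z (p *: e + q *: h + r *: f) = p *: lie z e + q *: lie z h + r *: lie z f.
  by rewrite !(linearD (lie z)) !(linearZ_LR (lie z)).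
rewrite !lin !liexx eh fh fe he hf ef; lmod; ring.
Qed.

Lemma comb3P a b c p q r : comb3 a b c = comb3 p q r -> [/\ a = p, b = q & c = r].
Proof.
move=> E; have [] : [/\ a - p = 0, b - q = 0 & c - r = 0].
  apply: comb3_eq0; transitivity (comb3 a b c - comb3 p q r); last by rewrite E subrr.
  by rewrite /comb3; lmod; ring.
by do 3!move/subr0_eq ->.
Qed.

Lemma comb3Z d a b c : d *: comb3 a b c = comb3 (d * a) (d * b) (d * c).
Proof. by rewrite /comb3; lmod; ring. Qed.

(** The eigenvalues of ad x are 0 and the square roots of 4 (b^2 + a c). The equations F1, F2, F3
    for the coordinates of y have determinant 2 (b^2 + a c - 1). *)
Lemma weight2_discriminant a b c y : y != 0 -> lie (comb3 a b c) y = 2 *: y ->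
  b ^+ 2 + a * c = 1.
Proof.
move=> y0; have [p [q [r Ey]]] := comb3_exists y.
rewrite Ey comb3_lie comb3Z => /comb3P[E1 E2 E3].
have F1 : (b - 1) * p - a * q = 0.
  by apply: (mulfI two); rewrite mulr0 -[RHS](subrr (2 * p)) -{1}E1; ring.
have F2 : - c * p - 2 * q + a * r = 0 by rewrite -E2; ring.
have F3 : c * q - (b + 1) * r = 0.
  by apply: (mulfI two); rewrite mulr0 -[RHS](subrr (2 * r)) -{1}E3; ring.
apply/eqP; rewrite -subr_eq0; apply: contraNT y0 => D.
have D2 : 2 * (b ^+ 2 + a * c - 1) != 0 by rewrite mulf_neq0.
have z0 u : 2 * (b ^+ 2 + a * c - 1) * u = 0 -> u = 0.
  by move/eqP; rewrite mulf_eq0 (negPf D2) => /eqP.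
(* Cramer's rule: here and below, the multipliers of F1, F2, F3 form a row of the adjugate
   matrix. *)
have p0 : p = 0.
  apply: z0; transitivity ((2 * (b + 1) - a * c) * ((b - 1) * p - a * q)
    - a * (b + 1) * (- c * p - 2 * q + a * r) - a ^+ 2 * (c * q - (b + 1) * r)); first by ring.
  by rewrite F1 F2 F3 !mulr0 !subrr.
have q0 : q = 0.
  apply: z0; transitivity (- c * (b + 1) * ((b - 1) * p - a * q)
    - (b ^+ 2 - 1) * (- c * p - 2 * q + a * r) - a * (b - 1) * (c * q - (b + 1) * r)).
    by ring.
  by rewrite F1 F2 F3 !mulr0 !subrr.
have r0 : r = 0.
  apply: z0; transitivity (- c ^+ 2 * ((b - 1) * p - a * q)
    - c * (b - 1) * (- c * p - 2 * q + a * r)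
    + (- 2 * (b - 1) - a * c) * (c * q - (b + 1) * r)); first by ring.
  by rewrite F1 F2 F3 !mulr0 subrr addr0.
by rewrite Ey p0 q0 r0 /comb3 !scale0r !addr0.
Qed.

Lemma form_comb3 (B : {biscalar s}) a b c :
  (forall x y, B x y = B y x) -> (forall x y z, B (lie x y) z = B x (lie y z)) ->
  B (comb3 a b c) (comb3 a b c) = 2 * B e f * (b ^+ 2 + a * c).
Proof.
move=> Bsym Binv.
have half (z : k) : 2 * z = 0 -> z = 0 by move/eqP; rewrite mulf_eq0 (negPf two) => /eqP.
have Bhe : B h e = 0.
  by apply: half; rewrite -(linearZr_LR B) -he -Binv liexx linear0l.
have Bhf : B h f = 0.
  apply: half; apply: oppr_inj; rewrite oppr0 -(linearZr_LR B) -(linearNr B) -hf -Binv liexx.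
  by rewrite linear0l.
have Bee : B e e = 0.
  by apply: half; rewrite -(linearZl_LR B) -he Binv liexx linear0r.
have Bff : B f f = 0.
  apply: half; apply: oppr_inj; rewrite oppr0 -(linearZl_LR B) -(linearNl B) -hf Binv liexx.
  by rewrite linear0r.
have Bhh : B h h = 2 * B e f.
  by rewrite -{1}ef Binv [lie f h]lieC hf opprK linearZr_LR.
rewrite /comb3 !linearDl !linearDr /= !linearZl_LR !linearZr_LR /=.
rewrite Bee Bff Bhe Bhf Bhh (Bsym e h) (Bsym f h) (Bsym f e) Bhe Bhf; ring.
Qed.

(** The characteristic polynomial gives (ad x)^3 = 4 D ad x. If D were non-zero, nilpotency would
    force ad x = 0, and brackets with e and h then give x = 0. *)
Lemma nilpotent_discriminant a b c : comb3 a b c != 0 -> ad_nilpotent (comb3 a b c) ->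
  b ^+ 2 + a * c = 0.
Proof.
move=> x0 [N xN]; set x := comb3 a b c; set D := b ^+ 2 + a * c.
have cubic y : lie x (lie x (lie x y)) = (4 * D) *: lie x y.
  have [p [q [r ->]]] := comb3_exists y.
  by rewrite /x !comb3_lie comb3Z /D; congr comb3; ring.
have odd m y : iter (2 * m).+1 (lie x) y = (4 * D) ^+ m *: lie x y.
  elim: m => [|m IH]; first by rewrite scale1r.
  have -> : ((2 * m.+1).+1 = (2 * m).+3)%N by lia.
  by rewrite iterS iterS IH !(linearZ_LR (lie x)) /= cubic scalerA exprSr.
apply/eqP; apply: contraNT x0 => D0.
have xy y : lie x y = 0.
  have := odd N y; rewrite (@iter_linear_leq _ _ (lie x) N) ?xN //; last first.
    by rewrite mul2n -addnn -addnS leq_addr.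
  move/esym/eqP; rewrite scaler_eq0 expf_eq0 mulf_eq0 (negPf D0) orbF.
  by rewrite ((pcharf0P k).1 char0) andbF => /eqP.
have /comb3_eq0[/eqP b0 /eqP c0 _] :
    comb3 (2 * (b * 1 - a * 0)) (a * 0 - c * 1) (2 * (c * 0 - b * 0)) = 0.
  by rewrite -comb3_lie xy.
have /comb3_eq0[/eqP a0 _ _] :
    comb3 (2 * (b * 0 - a * 1)) (a * 0 - c * 0) (2 * (c * 1 - b * 0)) = 0.
  by rewrite -comb3_lie xy.
move: b0 c0 a0; rewrite !mulr0 !mulr1 ?subr0 ?sub0r mulf_eq0 (negPf two) /= => /eqP -> .
rewrite oppr_eq0 => /eqP ->; rewrite mulrN oppr_eq0 mulf_eq0 (negPf two) /= => /eqP ->.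
by rewrite /x /comb3 !scale0r !addr0.
Qed.

(* x is, up to scale, conjugate to f under exp (t ad e), or a multiple of e. *)
Lemma nilpotent_in_triple x : x != 0 -> ad_nilpotent x -> exists h' f' : s,
  [/\ lie h' x = 2 *: x, lie h' f' = - (2 *: f') & lie x f' = h'].
Proof.
have [a [b [c ->]]] := comb3_exists x => x0 /(nilpotent_discriminant x0) D.
have [c0|c0] := eqVneq c 0.
  move: D; rewrite c0 mulr0 addr0 => /eqP; rewrite expf_eq0 => /eqP /= b0.
  have a0 : a != 0.
    by apply: contraNneq x0 => ->; rewrite c0 b0 /comb3 !scale0r !addr0.
  exists (comb3 0 1 0), (comb3 0 0 a^-1); rewrite b0 !comb3_lie -scaleNr !comb3Z.
  by split; congr comb3; field.
have Ea : a = - b ^+ 2 / c.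
  by apply: (mulIf c0); rewrite divfK //; apply/eqP; rewrite -addr_eq0 addrC D.
(* The image of the triple (c f, -h, c^-1 e) under exp (t ad e) with t = b / c. *)
exists (comb3 (2 * (b / c)) (-1) 0), (comb3 c^-1 0 0).
rewrite !comb3_lie -scaleNr !comb3Z Ea.
by split; congr comb3; field.
Qed.

End Sl2Algebra.

Section DynkinIndex.
Context (k : closedFieldType) (char0 : [pchar k] =i pred0).
Context (g : lieAlgType k) (B : {biscalar g}).

(** The root data of S inside [is_dynkin_index] need not be adapted to x. But x and the coroot of
    the highest root of S both have a 2-eigenvector, hence discriminant 1, and an invariant form
    depends on the discriminant only. *)
Lemma dynkin_index_form (S : lie_subalgebra g) c : is_sl2 (subvs_of S) ->
  is_dynkin_index B S c -> forall x y : subvs_of S, y != 0 -> lie x y = 2 *: y ->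
  B (vsval x) (vsval x) = 2 * c.
Proof.
case=> e [h [f [bs he hf ef]]] [T [B' [BN' BB']]] x y y0 xy.
have [z [_ [_ _ z0 [hz _ _]]]] := root_triple char0 BN' (theta_root T).
have := form_htheta char0 BN'; set x' := vsval _ in hz * => B2.
have [Bsym Binv _ _] := BN'; rewrite BB' mulrC; congr (_ * _); rewrite -B2.
have [a [b [d Ex]]] := comb3_exists bs x; have [a' [b' [d' Ex']]] := comb3_exists bs x'.
rewrite Ex Ex' !(form_comb3 char0 he hf ef) //.
rewrite (weight2_discriminant char0 bs he hf ef y0) -?Ex //.
by rewrite (weight2_discriminant char0 bs he hf ef z0) -?Ex'.
Qed.

End DynkinIndex.

(** * Infinitesimal invariance under the whole algebra *)

Section InvarianceKilling.
Context (k : closedFieldType) (char0 : [pchar k] =i pred0).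
Context (g : lieAlgType k) (T : root_data g) (B : {biscalar g}).
Hypothesis BN : normalised_form T B.
Local Notation t := (csa T : {vspace g}).
Local Notation tT := (subvs_of t).

Lemma csa_spanned (W : tT -> Prop) : subspace_pred W ->
  (forall a, a \in simple_roots T -> W (tv B a)) -> forall s, W s.
Proof.
move=> sW Wa s; have -> : s = tv B (flat t B s).
  by rewrite /tv lker0_lfunK // (flat_ker0 BN).
have /coord_span -> : flat t B s \in <<in_tuple (simple_roots T)>>%VS.
  by rewrite (span_basis (simple_roots_basis T)) memvf.
rewrite /tv linear_sum; apply: subspace_sum => // i _.
by rewrite linearZ; apply: subspaceZ => //; apply: Wa; apply: mem_nth.
Qed.

(** Root vectors are ad-nilpotent, coroots are brackets of root vectors, and the two kinds together
    span g. *)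
Lemma all_kill_invariants : (1 < \dim {:g})%N -> forall x : g, kills_invariants x.
Proof.
move=> g1; have [X XP] := root_vectors char0 BN.
have sK : subspace_pred (@kills_invariants k g).
  split=> [p ip|c u v]; last exact: kills_invariantsP.
  apply: (nilpotent_kills_invariant char0 g1 _ ip).
  by exists 1%N => y; rewrite /= lie0l.
have wtK (a : dual t) (x : g) : a != 0 -> wt a x -> kills_invariants x.
  move=> a0 xa p ip; apply: (nilpotent_kills_invariant char0 g1 _ ip).
  exact: wt_lie_nilpotent a0 xa.
move=> x; have := root_basis char0 BN XP => /span_basis bX.
have := memvf x; rewrite -bX; apply: (span_ind sK) => {}x.
rewrite mem_cat => /orP[/vbasis_mem xt|/mapP[a aR ->]]; last first.
  by have [Xa _] := XP a aR; have [a0 _] := (mem_roots char0 BN a).1 aR; apply: wtK a0 Xa.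
rewrite -[x]/(vsval (Subvs xt)).
apply: (csa_spanned (W := fun s => kills_invariants (vsval s))) => [|a aP].
  by split=> [|c u v ku kv]; [case: sK | apply: (kills_invariantsP c ku kv)].
have [_ /(_ a aP) ra _] := simple_rootsP T; have [a0 [v v0 va]] := ra.
have [y [f [ya fa y0 [_ _ yf]]]] := root_triple char0 BN ra.
have aa := root_norm_neq0 char0 BN a0 va v0.
have := kills_invariants_lie (wtK a y a0 ya) (wtK (- a) f _ fa).
rewrite yf oppr_eq0 => /(_ a0) kh.
have -> : vsval (tv B a) = (a (tv B a) / 2) *: vsval (coroot_vector B a).
  rewrite [vsval (coroot_vector _ _)]/(_ *: vsval (tv B a)) scalerA.
  rewrite -[_ / _ * _]mulrA mulKf ?divff ?scale1r //.
  by rewrite ((pcharf0P k).1 char0).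
exact: subspaceZ sK kh.
Qed.

End InvarianceKilling.

Section PrincipalWeights.
Context (k : closedFieldType) (char0 : [pchar k] =i pred0) (g : lieAlgType k).

(** Stated with lowest weight vectors, that is, a basis of ker (ad f), because these span the slice;
    they come from the opposite triple and are sorted by weight. *)
Lemma principal_weights n (e h f : g) :
  lie_triple e h f -> \dim (centraliser e) = n ->
  exists (v : 'I_n -> g) (d : 'I_n -> nat),
  [/\ forall j, lie h (v j) = - ((d j)%:R *: v j),
      forall u, exists x z, z \in <<[tuple v j | j < n]>>%VS /\ u = lie x e + z,
      {homo d : i j / (i <= j)%N},
      \dim {:g} = (\sum_j (d j).+1)%N
    & 3 * killing h h = (\sum_j d j * (d j).+1 * (d j).+2)%:R].
Proof.
move=> tp ne; have tr := lie_triple_sl2 tp; have tr' := lie_triple_sl2 (lie_triple_opp tp).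
have [X' [bX' _ _ _ sX']] := sl2_structure char0 tr.
have [X [bX hX dX kX sX]] := sl2_structure char0 tr'.
have sizeX : size X = n.
  apply/eqP; rewrite eqn_leq; apply/andP; split; first by rewrite -ne.
  (* The lower bound: n = [size X'] by regularity, and the last clause of [sl2_structure] for the
     original triple bounds it by dim ker (ad f) = [size X]. *)
  have := basis_free bX; have := basis_free bX'.
  rewrite /free (span_basis bX) (span_basis bX') !size_map.
  by move=> /eqP dX' /eqP dimX; rewrite -ne dX' -dimX.
pose Y := sort (fun p q => p.1 <= q.1)%N X; have pY : perm_eq Y X by rewrite perm_sort.
have sizeY : size Y = n by rewrite size_sort.
pose y (j : 'I_n) := nth (0%N, 0) Y j.
have yX j : y j \in X by rewrite -(perm_mem pY) mem_nth // sizeY.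
have sum_y (F : nat -> nat) : (\sum_(p <- X) F p.1 = \sum_j F (y j).1)%N.
  by rewrite -(perm_big _ pY) /= (big_nth (0%N, 0)) big_mkord sizeY.
have killN : killing (- h) (- h) = killing h h.
  by apply: eq_ltr => x; rewrite /= !lieNl linearN opprK.
have spanY : <<[tuple (y j).2 | j < n]>>%VS = lker (linfun (lie f)).
  rewrite -(span_basis bX); apply: eq_span => x; rewrite -(perm_mem (perm_map snd pY)).
  apply/mapP/mapP => [[j _ ->]|[p /(nthP (0%N, 0))[j jn <-] ->]].
    by exists (y j); rewrite ?mem_nth ?sizeY.
  by rewrite sizeY in jn; exists (Ordinal jn); rewrite ?mem_enum.
exists (fun j => (y j).2), (fun j => (y j).1); split.
- by move=> j; rewrite -hX //= lieNl opprK.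
- move=> u; have [x [z [fz ->]]] := im_f_ker_e char0 tr' u.
  exists (- x), z; split; last by rewrite lieNl [lie x e]lieC opprK.
  have : z \in lker (linfun (lie f)) by rewrite memv_ker lfunE /= fz.
  by rewrite -spanY.
- move=> i j ij; apply: (sorted_leq_nth (leT := fun p q : nat * g => p.1 <= q.1)%N) => //.
  + by move=> ? ? ?; apply: leq_trans.
  + by apply: sort_sorted => p q; apply: leq_total.
  + by rewrite inE sizeY.
  + by rewrite inE sizeY.
- by rewrite dX sum_y.
by rewrite -killN /killing -(sum_y (fun d => d * d.+1 * d.+2)%N) -kX.
Qed.

End PrincipalWeights.

Section SubalgebraTriples.
Context (k : closedFieldType) (char0 : [pchar k] =i pred0) (g : lieAlgType k).
Context (S : lie_subalgebra g).

Lemma lie_triple_val (e h f : subvs_of S) : lie_triple e h f ->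
  lie_triple (vsval e) (vsval h) (vsval f).
Proof.
case=> he hf ef; split.
- by rewrite -[LHS]/(vsval (lie h e)) he.
- by rewrite -[LHS]/(vsval (lie h f)) hf.
by rewrite -[LHS]/(vsval (lie e f)) ef.
Qed.

Lemma submodule_stable (e h f : subvs_of S) (U : {vspace g}) :
  basis_of fullv [:: e; h; f] ->
  submodule S U <-> [/\ stable_under (lie (vsval e)) U, stable_under (lie (vsval h)) U
    & stable_under (lie (vsval f)) U].
Proof.
move=> bs; split=> [sU|[eU hU fU] x u xS uU].
  by split=> u uU; apply: sU => //; apply: subvsP.
have [a [b [c E]]] := comb3_exists bs (Subvs xS).
have -> : x = a *: vsval e + b *: vsval h + c *: vsval f by rewrite -[x]/(vsval (Subvs xS)) E.
by rewrite !lieDl !lieZl !memvD ?memvZ ?eU ?hU ?fU.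
Qed.

Lemma decomposes_as_dim ds : decomposes_as S ds -> \dim {:g} = (\sum_(d <- ds) d.+1)%N.
Proof.
case=> V [sV /directvP dV VP]; rewrite -sV dV /= (big_nth 0%N) big_mkord.
by apply: eq_bigr => i _; case: (VP i).
Qed.

Lemma decomposes_as_killing ds (e h f : subvs_of S) : basis_of fullv [:: e; h; f] ->
  lie_triple e h f -> decomposes_as S ds ->
  3 * killing (vsval h) (vsval h) = (\sum_(d <- ds) d * d.+1 * d.+2)%:R.
Proof.
move=> bs /lie_triple_val/lie_triple_sl2 tr [V [sV dV VP]].
rewrite (big_nth 0%N) big_mkord; apply: (ltr_h2_decomposition char0 tr sV dV) => i.
have [[sVi _ minV] dVi] := VP i; have [eV hV fV] := (submodule_stable _ bs).1 sVi.
split=> // U eU hU fU; apply: minV; exact/(submodule_stable _ bs).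
Qed.

End SubalgebraTriples.

Lemma sum_nat_leq_eq (I : finType) (F G : I -> nat) : (forall i, F i <= G i)%N ->
  (\sum_i F i = \sum_i G i)%N -> F =1 G.
Proof.
move=> FG E i; have [_] := leqif_sum (fun (i : I) (_ : xpredT i) => leqif_eq (FG i)).
by rewrite E eqxx => /esym/forallP/(_ i)/eqP.
Qed.

(** * The cubic sums *)

Section Arithmetic.
Variable k : fieldType.
Hypothesis char0 : [pchar k] =i pred0.

(** Three times the trace of h^2 on R_d. *)
Definition cube d := (d * d.+1 * d.+2)%N.

Lemma cube_difference (a b h : nat) : (2 <= a)%N -> (2 <= b)%N -> (a + b = h + 2)%N ->
  (cube (2 * (h - 1)))%:R - (cube (a - 2))%:R - (cube (b - 2))%:R - (cube (h - 2))%:R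
  = 12 * h%:R * ('C(h, 2)%:R + (a%:R - 2) * (b%:R - 2) / 4) :> k.
Proof.
(* From here on a and b stand for a - 2 and b - 2, so natural subtraction disappears. *)
case: a b => [|[|a]] // [|[|b]] // _ _ ab.
have -> : h = (a + b).+2 by lia.
have n0 m : (m.+1%:R : k) != 0 by rewrite ((pcharf0P k).1 char0).
have -> : ('C((a + b).+2, 2)%:R = (a + b).+2%:R * (a + b).+1%:R / 2 :> k).
  apply: (mulIf (n0 1%N)); rewrite divfK // -!natrM; congr (_%:R).
  by rewrite mulnC -[2%N]/(1.+1) -mul_bin_diag bin1.
rewrite !subSS !subn0 /cube.
have -> : (2 * (a + b).+1 = (2 * a + 2 * b).+2)%N by lia.
rewrite !natrM -!natr1 !natrD; field.
by rewrite !((pcharf0P k).1 char0).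
Qed.
End Arithmetic.

(** * The principal and the subregular subalgebra *)

Section SimpleLie.
Context (k : closedFieldType) (char0 : [pchar k] =i pred0).
Context (g : lieAlgType k) (g_simple : simple_lie g).
Context (T : root_data g) (B : {biscalar g}) (BN : normalised_form T B).

Lemma killing_dual_coxeter x y : killing x y = 2 * dual_coxeter_number T B * B x y.
Proof.
have [Bsym Binv Bnd _] := BN.
have [c E] := killing_proportional Binv Bnd g_simple.
rewrite E; congr (_ * _); have n0 m : (m.+1%:R : k) != 0 by rewrite ((pcharf0P k).1 char0).
have := E (vsval (coroot_vector B (highest_root T))) (vsval (coroot_vector B (highest_root T))).
rewrite (form_htheta char0 BN) {1}/killing (ltr_ad_htheta char0 BN) => E2.
by apply: (mulIf (n0 1%N)); rewrite -E2; ring.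
Qed.

Lemma killing_index (S : lie_subalgebra g) c (e h : subvs_of S) :
  is_sl2 (subvs_of S) -> is_dynkin_index B S c -> e != 0 -> lie h e = 2 *: e ->
  killing (vsval h) (vsval h) = 4 * dual_coxeter_number T B * c.
Proof.
move=> sl2S cS e0 he; rewrite killing_dual_coxeter (dynkin_index_form char0 sl2S cS e0 he).
by ring.
Qed.

Lemma principal_nilpotent_neq0 (e : g) : principal_nilpotent T e -> e != 0.
Proof.
case=> _ reg; apply/eqP => e0; case: g_simple => -[x [y /eqP xy0]] _; apply: xy0.
have dimt : \dim (csa T) = \dim {:g}.
  rewrite -[LHS]reg; congr (\dim _); apply/vspaceP => z.
  by rewrite memv_ker lfunE /= e0 lie0l eqxx memvf.
have tf z : z \in (csa T : {vspace g}).
  by have /eqP -> : csa T == fullv :> {vspace g}; rewrite ?memvf // eqEdim subvf dimt leqnn.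
exact: (csa_abelian (Subvs (tf x)) (Subvs (tf y))).
Qed.

(** The standard basis from [is_sl2] need not contain the regular nilpotent element, which is
    therefore completed to a triple of its own. *)
Lemma principal_triple (S : lie_subalgebra g) : principal_sl2 T S ->
  exists e h f : subvs_of S,
  [/\ e != 0, lie_triple e h f & \dim (centraliser (vsval e)) = rank T].
Proof.
case=> -[e0 [h0 [f0 [bs he hf ef]]]] [e eS pe].
have x0 : Subvs eS != 0.
  by apply: contraNneq (principal_nilpotent_neq0 pe) => /(congr1 vsval)/= ->.
have [[N eN] reg] := pe.
have xN : ad_nilpotent (Subvs eS).
  exists N => y; apply: val_inj; rewrite /= -[RHS](eN (vsval y)).
  by elim: N {eN} => //= N <-.
have [h [f [hx hf' xf]]] := nilpotent_in_triple char0 bs he hf ef x0 xN.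
by exists (Subvs eS), h, f.
Qed.

(* The weights of a principal sl_2 on g are bounded by the doubled exponents and
   both families have the same sum. *)
Lemma principal_killing (S : lie_subalgebra g) n (m : 'I_n -> nat) c :
  rank T = n -> (2 <= n)%N -> is_exponents g m -> {homo m : i j / (i <= j)%N} ->
  \dim {:g} = (\sum_i (2 * m i).+1)%N -> principal_sl2 T S -> is_dynkin_index B S c ->
  12 * dual_coxeter_number T B * c = (\sum_i cube (2 * m i))%:R.
Proof.
move=> rn n2 mexp m_mono dimg prS cS.
have [e [h [f [e0 tr]]]] := principal_triple prS; rewrite rn => reg.
have [v [d [hv uv d_mono dimd Kd]]] := principal_weights char0 (lie_triple_val tr) reg.
have g1 : (1 < \dim {:g})%N.
  by rewrite (leq_trans n2) // -rn; apply/dimvS/subvf.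
have [he _ _] := lie_triple_val tr.
have dm : d =1 (fun i => 2 * m i)%N.
  apply: sum_nat_leq_eq => [i|].
    exact: (exponents_ge_weights char0 (all_kill_invariants char0 BN g1) he hv uv mexp).
  have sumS F : (\sum_(i < n) (F i).+1 = \sum_(i < n) F i + n)%N.
    by under eq_bigr do rewrite -addn1; rewrite big_split /= sum1_card card_ord.
  by apply: (@addIn n); rewrite -!sumS -dimd.
have [he' _ _] := tr; have := Kd; rewrite (killing_index prS.1 cS e0 he').
rewrite (eq_bigr (fun i => cube (2 * m i))) => [<-|i _]; first by ring.
by rewrite dm.
Qed.

Lemma decomposed_killing (S : lie_subalgebra g) ds c : is_sl2 (subvs_of S) ->
  decomposes_as S ds -> is_dynkin_index B S c ->
  12 * dual_coxeter_number T B * c = (\sum_(d <- ds) cube d)%:R.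
Proof.
move=> sl2S dS cS; have [e [h [f [bs he hf ef]]]] := sl2S.
have e0 : e != 0 by rewrite (basis_not0 bs) ?mem_head.
rewrite -(decomposes_as_killing char0 bs (And3 he hf ef) dS) (killing_index sl2S cS e0 he).
by ring.
Qed.

End SimpleLie.

Section ExponentSequence.
Variables (n : nat) (m : nat -> nat).
Hypotheses (n_ge2 : (2 <= n)%N) (m_first_lt : (m 1%N < m 2%N)%N)
  (m_mono : forall i, (2 <= i)%N -> (i.+1 <= n.-1)%N -> (m i <= m i.+1)%N)
  (m_last_lt : (m n.-1 < m n)%N).

Lemma exponents_homo : {homo (fun i : 'I_n => m i.+1) : i j / (i <= j)%N}.
Proof.
have m_step j : (1 <= j)%N -> (j < n)%N -> (m j <= m j.+1)%N.
  move=> j1 jn; have [->|j_neq1] := eqVneq j 1%N; first exact: ltnW.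
  have [Ej|j_last] := eqVneq j n.-1.
    by have <- : n = j.+1; [lia | rewrite Ej ltnW].
  by apply: m_mono; lia.
have m_leq j d : (1 <= j)%N -> (j + d <= n)%N -> (m j <= m (j + d))%N.
  move=> j1; elim: d => [|d IH] jd; first by rewrite addn0.
  rewrite addnS in jd *; apply: leq_trans (IH (ltnW jd)) (m_step _ _ jd).
  by rewrite (leq_trans j1) ?leq_addr.
by move=> i j ij; rewrite -(subnKC ij) -addSn; apply: m_leq; rewrite // addSn subnKC.
Qed.

(** Used with [succn] for the dimension and with [cube] for the index. *)
Lemma sum_exponents (F : nat -> nat) (s : seq nat) :
  (\sum_(d <- [seq (2 * m i)%N | i <- iota 1 n.-1] ++ s) F d + F (2 * m n)%N =
   \sum_(i < n) F (2 * m i.+1)%N + \sum_(d <- s) F d)%N.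
Proof.
case: n n_ge2 => // n' _; rewrite big_ord_recr big_cat big_map /=.
have -> : iota 1 n' = index_iota 1 n'.+1 by rewrite /index_iota subn1.
by rewrite big_add1 big_mkord addnAC.
Qed.
End ExponentSequence.

Theorem theorem3p4 (k : closedFieldType) (char0 : [pchar k] =i pred0)
    (g : lieAlgType k) (g_simple : simple_lie g)
    (T : root_data g) (n : nat) (rank_g : rank T = n) (n_ge2 : (2 <= n)%N)
    (B : {biscalar g}) (B_normalised : normalised_form T B)
    (h : nat) (h_coxeter : is_coxeter_number T B h)
    (m : nat -> nat) (m_exponents : is_exponents g (fun i : 'I_n => m i.+1))
    (m_first : m 1%N = 1%N) (m_first_lt : (m 1%N < m 2%N)%N)
    (m_mono : forall i, (2 <= i)%N -> (i.+1 <= n.-1)%N -> (m i <= m i.+1)%N)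
    (m_last_lt : (m n.-1 < m n)%N) (m_last : m n = (h - 1)%N)
    (sl2pr sl2sub : lie_subalgebra g)
    (sl2pr_principal : principal_sl2 T sl2pr)
    (sl2sub_subregular : subregular_sl2 T sl2sub)
    (a b : nat) (a_ge2 : (2 <= a)%N) (a_le_b : (a <= b)%N)
    (ab : (a + b = h + 2)%N)
    (sub_decomposition : decomposes_as sl2sub
       ([seq (2 * m i)%N | i <- iota 1 n.-1] ++ [:: a - 2; b - 2; h - 2]%N))
    (ind_pr ind_sub : k)
    (ind_prP : is_dynkin_index B sl2pr ind_pr)
    (ind_subP : is_dynkin_index B sl2sub ind_sub) :
  ind_pr - ind_sub =
    h%:R / dual_coxeter_number T B *
      ('C(h, 2)%:R + (a%:R - 2) * (b%:R - 2) / 4).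
Proof.
have h2 : (2 <= h)%N.
  by clear - ab a_ge2 a_le_b; move: ab a_ge2 a_le_b; lia.
have m_homo := exponents_homo n_ge2 m_first_lt m_mono m_last_lt.
have sumE F := sum_exponents m n_ge2 F [:: a - 2; b - 2; h - 2]%N.
have dim_g : \dim {:g} = (\sum_(i < n) (2 * m i.+1).+1)%N.
  rewrite (decomposes_as_dim sub_decomposition).
  (* The last three modules have total dimension a + b + h - 3 = 2 h - 1 = 2 m_n + 1. *)
  have := sumE succn; rewrite !big_cons big_nil m_last.
  by clear - ab a_ge2 a_le_b; move: ab a_ge2 a_le_b; lia.
have K_pr := principal_killing char0 g_simple B_normalised rank_g n_ge2 m_exponents m_homo
  dim_g sl2pr_principal ind_prP.
have K_sub := decomposed_killing char0 g_simple B_normalised sl2sub_subregular.1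
  sub_decomposition ind_subP.
have natK j : (j.+1%:R : k) != 0 by rewrite ((pcharf0P k).1 char0).
(* Otherwise the sum of the [cube (2 * m i)] would vanish, although m_1 = 1 alone contributes 24. *)
have hs0 : dual_coxeter_number T B != 0.
  apply/eqP => hs0; move: K_pr; rewrite hs0 mulr0 mul0r => /esym/eqP.
  rewrite ((pcharf0P k).1 char0) sum_nat_eq0 => /forallP/(_ (Ordinal (ltnW n_ge2))).
  by rewrite /= m_first.
have b2 := leq_trans a_ge2 a_le_b.
have diff : 12 * dual_coxeter_number T B * (ind_pr - ind_sub) =
    12 * h%:R * ('C(h, 2)%:R + (a%:R - 2) * (b%:R - 2) / 4).
  rewrite mulrBr K_pr K_sub -(cube_difference char0 a_ge2 b2 ab).
  have := congr1 (fun j => j%:R : k) (sumE cube); rewrite !big_cons big_nil m_last !natrD.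
  move/eqP; rewrite -subr_eq => /eqP <-; ring.
apply: (mulfI (mulf_neq0 (natK 11) hs0)); rewrite diff.
by field; rewrite hs0 (natK 3%N).
Qed.
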